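(* Let $\Omega\subset\mathbb{R}^2$ be a smooth, bounded domain. Let $\epsilon_0,\epsilon_1>0$ be such that $0<\Theta_0-\epsilon_1<1-\epsilon_0$. Then there exist $\kappa_0,C>0$ such that if $(\psi,\mathbf{A})$ is a solution of the Ginzburg-Landau system (as defined in the context) with parameters $\kappa,H>0$ and with $\psi\ne0$, $$\kappa>\kappa_0,\qquad \Theta_0-\epsilon_1\le\kappa/H\le1-\epsilon_0,$$ and $P\in\overline\Omega$ is such that $|\psi(P)|=\|\psi\|_\infty$, then $$\operatorname{dist}(P,\partial\Omega)\le\frac{C}{\sqrt{\kappa H}}.$$
   Context: For a vector field $\mathbf{A}=(A_1,A_2)$: $\operatorname{curl}\mathbf{A}=\partial_{x_1}A_2-\partial_{x_2}A_1$, $\operatorname{curl}^2\mathbf{A}=(\partial_{x_2}(\operatorname{curl}\mathbf{A}),-\partial_{x_1}(\operatorname{curl}\mathbf{A}))$, and $p_{\mathbf{A}}=-i\nabla+\mathbf{A}$. $\nu$ denotes the unit normal to the boundary, and $\|\cdot\|_\infty$ the $L^\infty(\Omega)$ norm. A solution of the Ginzburg-Landau system with parameters $\kappa,H>0$ is a pair $(\psi,\mathbf{A})\in W^{1,2}(\Omega;\mathbb{C})\times W^{1,2}(\Omega;\mathbb{R}^2)$ satisfying (in the weak sense) $$p_{\kappa H\mathbf{A}}^2\psi=\kappa^2(1-|\psi|^2)\psi,\qquad \operatorname{curl}^2\mathbf{A}=-\tfrac{i}{2\kappa H}(\overline{\psi}\nabla\psi-\psi\nabla\overline{\psi})+|\psi|^2\mathbf{A}\quad\text{in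 }\Omega,$$ $$(p_{\kappa H\mathbf{A}}\psi)\cdot\nu=0,\qquad \operatorname{curl}\mathbf{A}-1=0\quad\text{on }\partial\Omega,$$ together with the gauge condition $\operatorname{div}\mathbf{A}=0$ in $\Omega$, $\mathbf{A}\cdot\nu=0$ on $\partial\Omega$. The constant $\Theta_0$: let $\mathbb{R}^2_+=\{(x_1,x_2)\in\mathbb{R}^2: x_1>0\}$ and let $\tilde{\mathbf{F}}$ be any vector potential on $\mathbb{R}^2_+$ with $\operatorname{curl}\tilde{\mathbf{F}}=1$. Let $\mathcal{H}$ be the Neumann realization of $(-i\nabla+\tilde{\mathbf{F}})^2$ on $L^2(\mathbb{R}^2_+)$, i.e. this operator with domain $\{\psi\in L^2(\mathbb{R}^2_+): (-i\nabla+\tilde{\mathbf{F}})^2\psi\in L^2(\mathbb{R}^2_+),\ \nu\cdot(-i\nabla+\tilde{\mathbf{F}})\psi|_{\partial\mathbb{R}^2_+}=0\}$. Then $\Theta_0:=\inf\operatorname{Spec}\mathcal{H}$; it is known that $\Theta_0\in(0,1)$. *)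

(* Defs.v *)
From HB Require Import structures.
From mathcomp Require Export all_boot all_order all_algebra.
From mathcomp Require Export all_classical all_reals all_analysis.
From mathcomp Require Export complex.

Set Implicit Arguments.
Unset Strict Implicit.
Unset Printing Implicit Defensive.

Import Order.TTheory GRing.Theory Num.Theory.
Import numFieldNormedType.Exports.

Local Open Scope classical_set_scope.
Local Open Scope ring_scope.
Local Open Scope complex_scope.

(* The plane is [R * R], with its product topology, product vector space
   structure and product (Borel) sigma-algebra. *)

Definition e1 (R : realType) : R * R := (1, 0).
Definition e2 (R : realType) : R * R := (0, 1).

Definition leb2 (R : realType) :
    {measure set (measurableTypeR R * measurableTypeR R) -> \bar R} :=
  (@lebesgue_measure R \x @lebesgue_measure R)%E.

Definition dotp (R : realType) (u v : R * R) : R := u.1 * v.1 + u.2 * v.2.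

(* The norm provided by the library on [R * R] is the sup norm. *)
Definition enorm (R : realType) (u : R * R) : R := Num.sqrt (dotp u u).

Definition frontier (R : realType) (D : set (R * R)) : set (R * R) :=
  closure D `&` closure (~` D).

Definition edist (R : realType) (P : R * R) (E : set (R * R)) : R :=
  inf [set enorm (P - Q) | Q in E].

Definition half_plane (R : realType) : set (R * R) := [set x | 0 < x.1].
Arguments half_plane : clear implicits.

(* Class C^k on the whole plane: the iterated partial derivatives up to order
   k exist and are continuous. *)
Fixpoint Ck (R : realType) (k : nat) (f : R * R -> R) : Prop :=
  continuous f /\
  match k with
  | 0%N => True
  | k'.+1 => forall v, v = e1 R \/ v = e2 R ->
      (forall x, derivable f x v) /\ Ck k' (fun x => 'D_v f x)
  end.

Definition smooth (R : realType) (f : R * R -> R) : Prop :=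
  forall k, Ck k f.

(* The boundary is described near each of its points by a smooth defining
   function with nonvanishing gradient, so that the set lies locally on one
   side of its boundary, which is a smooth curve. *)
Definition smooth_bounded_domain (R : realType) (D : set (R * R)) : Prop :=
  [/\ open D, connected D, D !=set0, bounded_set D &
      forall p, frontier D p ->
        exists U : set (R * R), exists rho : R * R -> R,
          [/\ open U, U p, smooth rho,
              forall x, U x -> ('D_(e1 R) rho x, 'D_(e2 R) rho x) != 0 &
              D `&` U = [set x | U x /\ rho x < 0]]].

Definition eq_ae (R : realType) (T : Type) (D : set (R * R))
    (f g : R * R -> T) : Prop :=
  {ae leb2 R, forall x, D x -> f x = g x}.

Definition L2 (R : realType) (D : set (R * R)) (f : R * R -> R) : Prop :=
  f \_ D \in Lfun (leb2 R) 2%:E.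

Definition L2loc (R : realType) (D : set (R * R)) (f : R * R -> R) : Prop :=
  forall r : R, L2 (D `&` ball 0 r) f.

Definition loc_integrable (R : realType) (D : set (R * R))
    (f : R * R -> R) : Prop :=
  forall K, compact K -> K `<=` D -> (leb2 R).-integrable K (EFin \o f).

Definition test_function (R : realType) (D : set (R * R))
    (phi : R * R -> R) : Prop :=
  smooth phi /\
  exists K, [/\ compact K, K `<=` D & forall x, ~ K x -> phi x = 0].

Definition is_wpartial (R : realType) (D : set (R * R)) (v : R * R)
    (u g : R * R -> R) : Prop :=
  [/\ loc_integrable D u, loc_integrable D g &
      forall phi, test_function D phi ->
        \int[leb2 R]_(x in D) (u x * 'D_v phi x) =
        - \int[leb2 R]_(x in D) (g x * phi x)].

(* A representative of the weak derivative in D along v; its value is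
   meaningful only when a weak derivative exists, in which case it is
   determined up to equality almost everywhere in D. *)
Definition wpartial (R : realType) (D : set (R * R)) (v : R * R)
    (u : R * R -> R) : R * R -> R :=
  get (is_wpartial D v u).

Definition W12 (R : realType) (D : set (R * R)) (u : R * R -> R) : Prop :=
  L2 D u /\
  forall v, v = e1 R \/ v = e2 R ->
    is_wpartial D v u (wpartial D v u) /\ L2 D (wpartial D v u).

(* Square integrability is only required on the bounded parts of D, up to the
   boundary. *)
Definition W12loc (R : realType) (D : set (R * R)) (u : R * R -> R) : Prop :=
  L2loc D u /\
  forall v, v = e1 R \/ v = e2 R ->
    is_wpartial D v u (wpartial D v u) /\ L2loc D (wpartial D v u).

Definition W12v (R : realType) (D : set (R * R)) (B : R * R -> R * R) : Prop :=
  W12 D (fun x => (B x).1) /\ W12 D (fun x => (B x).2).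

Definition grad (R : realType) (D : set (R * R)) (u : R * R -> R) :
    R * R -> R * R :=
  fun x => (wpartial D (e1 R) u x, wpartial D (e2 R) u x).

Definition curl (R : realType) (D : set (R * R)) (B : R * R -> R * R) :
    R * R -> R :=
  fun x => wpartial D (e1 R) (fun y => (B y).2) x
         - wpartial D (e2 R) (fun y => (B y).1) x.

Definition divg (R : realType) (D : set (R * R)) (B : R * R -> R * R) :
    R * R -> R :=
  fun x => wpartial D (e1 R) (fun y => (B y).1) x
         + wpartial D (e2 R) (fun y => (B y).2) x.

Definition cabs (R : realType) (z : R[i]) : R := ComplexField.Normc.normc z.

Definition re_part (R : realType) (u : R * R -> R[i]) : R * R -> R :=
  fun x => complex.Re (u x).

Definition im_part (R : realType) (u : R * R -> R[i]) : R * R -> R :=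
  fun x => complex.Im (u x).

Definition L2C (R : realType) (D : set (R * R)) (u : R * R -> R[i]) : Prop :=
  L2 D (re_part u) /\ L2 D (im_part u).

Definition W12C (R : realType) (D : set (R * R)) (u : R * R -> R[i]) : Prop :=
  W12 D (re_part u) /\ W12 D (im_part u).

Definition W12locC (R : realType) (D : set (R * R))
    (u : R * R -> R[i]) : Prop :=
  W12loc D (re_part u) /\ W12loc D (im_part u).

Definition LnormC (R : realType) (p : \bar R) (D : set (R * R))
    (u : R * R -> R[i]) : \bar R :=
  Lnorm (leb2 R) p (EFin \o ((fun x => cabs (u x)) \_ D)).

Definition continuous_on (R : realType) (E : set (R * R))
    (u : R * R -> R[i]) : Prop :=
  {within E, continuous (re_part u)} /\ {within E, continuous (im_part u)}.

Definition Cint (R : realType) (D : set (R * R)) (u : R * R -> R[i]) : R[i] :=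
  (\int[leb2 R]_(x in D) re_part u x) +i* (\int[leb2 R]_(x in D) im_part u x).

Definition gradC (R : realType) (D : set (R * R)) (u : R * R -> R[i]) :
    R * R -> R[i] * R[i] :=
  fun x => (wpartial D (e1 R) (re_part u) x +i* wpartial D (e1 R) (im_part u) x,
            wpartial D (e2 R) (re_part u) x +i* wpartial D (e2 R) (im_part u) x).

Definition pA (R : realType) (D : set (R * R)) (A : R * R -> R * R)
    (u : R * R -> R[i]) : R * R -> R[i] * R[i] :=
  fun x => (- 'i%C * (gradC D u x).1 + ((A x).1)%:C * u x,
            - 'i%C * (gradC D u x).2 + ((A x).2)%:C * u x).

Definition cdot (R : realType) (z w : R[i] * R[i]) : R[i] :=
  z.1 * conjc w.1 + z.2 * conjc w.2.

Definition bounded_support (R : realType) (D : set (R * R))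
    (u : R * R -> R[i]) : Prop :=
  exists r : R, forall x, D x -> r < enorm x -> u x = 0.

(* Weak form of the Neumann problem
     p_A^2 u = f in D,   (p_A u) . nu = 0 on the boundary of D.
   When D is bounded the support condition is vacuous (take r large). *)
Definition neumann_weak (R : realType) (D : set (R * R))
    (A : R * R -> R * R) (u f : R * R -> R[i]) : Prop :=
  forall phi, W12C D phi -> bounded_support D phi ->
    Cint D (fun x => cdot (pA D A u x) (pA D A phi x)) =
    Cint D (fun x => f x * conjc (phi x)).

(* An unbounded operator on L^2(D; C) is represented by its graph, a relation
   on functions compatible with equality almost everywhere. The relation below
   is the Neumann realization of p_A^2: [neumann_op D A u f] means that u is in
   the domain and is mapped to f. *)
Definition neumann_op (R : realType) (D : set (R * R)) (A : R * R -> R * R)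
    (u f : R * R -> R[i]) : Prop :=
  [/\ L2C D u, W12locC D u, L2C D f & neumann_weak D A u f].

(* z is in the resolvent set when T - z is a bijection from the domain of T
   onto L^2(D; C) with bounded inverse. *)
Definition resolvent_set (R : realType) (D : set (R * R))
    (T : (R * R -> R[i]) -> (R * R -> R[i]) -> Prop) : set R[i] :=
  [set z |
    (forall u, T u (fun x => z * u x) -> eq_ae D u (fun=> 0)) /\
    exists c : R, forall g, L2C D g ->
      exists u, T u (fun x => z * u x + g x) /\
        (LnormC 2%:E D u <= c%:E * LnormC 2%:E D g)%E].

Definition spectrum (R : realType) (D : set (R * R))
    (T : (R * R -> R[i]) -> (R * R -> R[i]) -> Prop) : set R[i] :=
  ~` resolvent_set D T.

(* F has class C^1 up to the boundary of the half-plane and curl F = 1 there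
   (values outside of the closed half-plane are irrelevant). *)
Definition unit_field_potential (R : realType) (F : R * R -> R * R) : Prop :=
  [/\ Ck 1 (fun x => (F x).1), Ck 1 (fun x => (F x).2) &
      forall x, half_plane R x ->
        'D_(e1 R) (fun y => (F y).2) x - 'D_(e2 R) (fun y => (F y).1) x = 1].

(* The operator is self-adjoint, so its spectrum is real. *)
Definition Theta0 (R : realType) (F : R * R -> R * R) : R :=
  inf [set t : R | spectrum (half_plane R) (neumann_op (half_plane R) F) t%:C].

Definition current (R : realType) (D : set (R * R)) (kappa H : R)
    (psi : R * R -> R[i]) (A : R * R -> R * R) : R * R -> R[i] * R[i] :=
  fun x =>
    let c := - 'i%C / (2 * kappa * H)%:C in
    let dpsi := gradC D psi x in
    let dpsibar := gradC D (fun y => conjc (psi y)) x in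
    (c * (conjc (psi x) * dpsi.1 - psi x * dpsibar.1)
       + (cabs (psi x) ^+ 2 * (A x).1)%:C,
     c * (conjc (psi x) * dpsi.2 - psi x * dpsibar.2)
       + (cabs (psi x) ^+ 2 * (A x).2)%:C).

(* The two equations are tested against W^{1,2}; the absence of boundary terms
   encodes (p_{kappa H A} psi) . nu = 0 and curl A = 1 on the boundary, since
   int curl^2 A . B = int (curl A - 1) curl B when curl A = 1 there. Likewise
   A . nu = 0 is expressed through Green's formula
     int (A . grad phi + phi div A) = int_{boundary} phi A . nu. *)
Record GL_solution (R : realType) (D : set (R * R)) (kappa H : R)
    (psi : R * R -> R[i]) (A : R * R -> R * R) : Prop := {
  GL_psi : W12C D psi;
  GL_A : W12v D A;
  GL_eq_psi :
    neumann_weak D (fun x => (kappa * H) *: A x) psi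
      (fun x => (kappa ^+ 2 * (1 - cabs (psi x) ^+ 2))%:C * psi x);
  GL_eq_A : forall B, W12v D B ->
    (\int[leb2 R]_(x in D) ((curl D A x - 1) * curl D B x))%:C =
    Cint D (fun x => cdot (current D kappa H psi A x)
                          (((B x).1)%:C, ((B x).2)%:C));
  GL_div : eq_ae D (divg D A) (fun=> 0);
  GL_normal : forall phi, W12 D phi ->
    \int[leb2 R]_(x in D) (dotp (A x) (grad D phi x) + phi x * divg D A x) = 0
}.

(* Main.v *)
From HB Require Import structures.
Require Import Defs.
From mathcomp Require Import measurable_realfun simple_functions.
From mathcomp Require Import measurable_fun_approximation lebesgue_integral_under.
From mathcomp Require Import ess_sup_inf ring lra.

(* Put h = kappa H, w = |psi|^2, p = p_{hA} and M = ||psi||_oo, and suppose that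
   the disc of radius R / sqrt h around the maximum point P lies in Omega. In
   the interior, integrating the pointwise bound 2 Im (p_1 psi conj (p_2 psi))
   <= |p psi|^2 against a cut-off by parts bounds h int phi w curl A by the
   energy, while the equation for psi computes that energy as
   kappa^2 int phi (1 - w) w plus half of int w Delta phi. As
   kappa^2 <= (1 - eps0) h, the mass of w on a disc of radius l/2 is at most a
   multiple of (h l^2)^-1 times its mass on the disc of radius l, up to an error
   coming from curl A - 1; that error is controlled through the Maxwell
   equation by the total energy, which is at most kappa^2 |Omega| / 4. On the
   other hand, testing the equation for psi with a regularized logarithm
   centred at P gives M^2 <= C h int w over a disc of radius c / sqrt h around
   P. Two applications of the decay estimate then give
   M^2 <= C M^2 (R^-2 + R / sqrt h), which fails for R, then kappa, large. *)


Import Order.TTheory GRing.Theory Num.Theory.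
Import numFieldNormedType.Exports.

Set Implicit Arguments.
Unset Strict Implicit.
Unset Printing Implicit Defensive.

Local Open Scope classical_set_scope.
Local Open Scope ring_scope.

(** * Smooth functions and flat bumps *)

Section smooth_functions.
Context {R : realType}.
Implicit Types (f g : R * R -> R) (v x : R * R).

(** The value 1 bounding kappa / H is the bottom of the spectrum of the unit-field magnetic operator
    on the whole plane: away from the boundary psi costs an energy of at least h int w, the equation
    supplies at most kappa^2 int w, and the gap eps0 between the two forces decay. The obstacle is
    regularity: psi and A are merely W^{1,2}, curl A - 1 is merely L^2. Hence no elliptic theory:
    every integration by parts is weak and goes through mollification. The field error is not small
    on the scale 1 / sqrt h either; tested against g = phi w it is bounded by kappa^2 int g^2 plus
    M^2 l c, with l the radius of the disc and c independent of kappa and H. The first part is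
    absorbed by the quartic term - kappa^2 int phi w^2 of the energy, the second vanishes with l.
    One decay step applied to the trivial mass bound of order M^2 l^2 yields only a mass of order
    M^2 / h, the same order as the lower bound given by the logarithm; the second step gains the
    factor 1 / (h l^2) = R^-2, and R is chosen from the constants of these two bounds. *)

Definition basis_vec v := v = e1 R \/ v = e2 R.

(** [Ck] provides directional derivatives only. Restricting to a line turns them into derivatives of
    one real variable, where the chain rule, the mean value theorem and differentiation under the
    integral apply. *)
Lemma is_derive_line f x v (d : R) :
  is_derive (0 : R) (1 : R) (fun h : R => f (h *: v + x)) d -> is_derive x v f d.
Proof.
move=> [df dE]; have dfv : derivable f x v by exact/(derivable1P f x v).
apply: DeriveDef => //; rewrite -dE /derive.
set d1 := (fun _ : R => _^-1 *: _); set d2 := (fun _ : R => _^-1 *: _).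
suff -> : d1 = d2 by [].
apply/funext => h; rewrite /d1 /d2 /=.
by rewrite addr0 scale0r add0r [h *: 1]mulr1.
Qed.

Lemma is_derive_lineP f x v (d : R) :
  is_derive x v f d -> is_derive (0 : R) (1 : R) (fun h : R => f (h *: v + x)) d.
Proof.
move=> [df dE]; apply: DeriveDef; first exact: (derivable1P f x v).1.
rewrite -dE /derive.
set d1 := (fun _ : R => _^-1 *: _); set d2 := (fun _ : R => _^-1 *: _).
suff -> : d1 = d2 by [].
apply/funext => h; rewrite /d1 /d2 /=.
by rewrite addr0 scale0r add0r [h *: 1]mulr1.
Qed.

Lemma is_deriveDf f g x v a b :
  is_derive x v f a -> is_derive x v g b ->
  is_derive x v (fun x => f x + g x) (a + b).
Proof. by move=> *; exact: is_deriveD. Qed.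

Lemma is_deriveNf f x v a :
  is_derive x v f a -> is_derive x v (fun x => - f x) (- a).
Proof. by move=> *; exact: is_deriveN. Qed.

Lemma is_deriveBf f g x v a b :
  is_derive x v f a -> is_derive x v g b ->
  is_derive x v (fun x => f x - g x) (a - b).
Proof. by move=> *; exact: is_deriveB. Qed.

Lemma is_deriveMf f g x v a b :
  is_derive x v f a -> is_derive x v g b ->
  is_derive x v (fun x => f x * g x) (a * g x + f x * b).
Proof.
move=> Hf Hg; have := is_deriveM Hf Hg.
by rewrite /GRing.scale/= [g x * a]mulrC addrC.
Qed.

Lemma is_derive_compf (E : R -> R) f x v a b :
  is_derive x v f a -> is_derive (f x) 1 E b ->
  is_derive x v (fun x => E (f x)) (b * a).
Proof.
move=> /is_derive_lineP Hf HE; apply: is_derive_line.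
have := @is_derive1_comp _ E (fun h => f (h *: v + x)) 0 b a.
rewrite scale0r add0r => /(_ HE Hf).
by [].
Qed.

Lemma derivable_basis k f v x : basis_vec v -> Ck k.+1 f -> is_derive x v f ('D_v f x).
Proof. by move=> bv [_ /(_ _ bv)] [/(_ x) /derivableP]. Qed.

Lemma Ck_cont k f : Ck k f -> continuous f.
Proof. by case: k => [|k] []. Qed.

Lemma CkS k f : Ck k.+1 f -> Ck k f.
Proof.
elim: k f => [|k IH] f [cf H]; first by split.
by split => // v /H [df Hd]; split => //; exact: IH.
Qed.

Lemma Ck_derive k f v : Ck k.+1 f -> basis_vec v -> Ck k (fun x => 'D_v f x).
Proof. by move=> [_ H] /H []. Qed.

(** Naming the partial derivatives as explicit functions lets the inductions on the order apply
    closure properties to [df v] in place of ['D_v f]. *)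
Lemma CkI k f (df : R * R -> R * R -> R) : continuous f ->
  (forall v, basis_vec v -> (forall x, is_derive x v f (df v x)) /\ Ck k (df v)) ->
  Ck k.+1 f.
Proof.
move=> cf H; split => // v /H [df1 df2]; split; first by move=> x; case: (df1 x).
suff -> : (fun x => 'D_v f x) = df v by [].
by apply/funext => x; case: (df1 x).
Qed.

Lemma Ck_cst k (c : R) : Ck k (fun=> c).
Proof.
elim: k c => [|k IH] c; first by split => //; exact: cst_continuous.
apply: (@CkI _ _ (fun _ _ => 0)); first exact: cst_continuous.
by move=> v _; split => // x; exact: is_derive_cst.
Qed.

Lemma CkD k f g : Ck k f -> Ck k g -> Ck k (fun x => f x + g x).
Proof.
elim: k f g => [|k IH] f g Hf Hg.
  by split => // x; apply: continuousD; [exact: (Ck_cont Hf)|exact: (Ck_cont Hg)].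
apply: (@CkI _ _ (fun v x => 'D_v f x + 'D_v g x)).
  by move=> x; apply: continuousD; [exact: (Ck_cont Hf)|exact: (Ck_cont Hg)].
move=> v bv; split; last by apply: IH; exact: Ck_derive.
by move=> x; apply: is_deriveDf; [exact: (derivable_basis x bv Hf)|exact: (derivable_basis x bv Hg)].
Qed.

Lemma CkN k f : Ck k f -> Ck k (fun x => - f x).
Proof.
elim: k f => [|k IH] f Hf.
  by split => // x; apply: continuousN; exact: (Ck_cont Hf).
apply: (@CkI _ _ (fun v x => - 'D_v f x)).
  by move=> x; apply: continuousN; exact: (Ck_cont Hf).
move=> v bv; split; last by apply: IH; exact: Ck_derive.
by move=> x; apply: is_deriveNf; exact: (derivable_basis x bv Hf).
Qed.

Lemma CkB k f g : Ck k f -> Ck k g -> Ck k (fun x => f x - g x).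
Proof. by move=> Hf Hg; apply: CkD => //; exact: CkN. Qed.

Lemma CkM k f g : Ck k f -> Ck k g -> Ck k (fun x => f x * g x).
Proof.
elim: k f g => [|k IH] f g Hf Hg.
  by split => // x; apply: continuousM; [exact: (Ck_cont Hf)|exact: (Ck_cont Hg)].
apply: (@CkI _ _ (fun v x => 'D_v f x * g x + f x * 'D_v g x)).
  by move=> x; apply: continuousM; [exact: (Ck_cont Hf)|exact: (Ck_cont Hg)].
move=> v bv; split.
  by move=> x; apply: is_deriveMf; [exact: (derivable_basis x bv Hf)|exact: (derivable_basis x bv Hg)].
by apply: CkD; apply: IH; [exact: Ck_derive|exact: CkS|exact: CkS|exact: Ck_derive].
Qed.

Lemma is_derive_fst x v : is_derive x v (fun y : R * R => y.1) v.1.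
Proof.
apply: is_derive_line => /=.
have -> : (fun h : R => h *: v.1 + x.1) = (fun h : R => (v.1 \*: id) h + cst x.1 h).
  by apply/funext => h /=; rewrite /GRing.scale/= mulrC.
have : is_derive (0 : R) (1 : R) (fun h : R => (v.1 \*: id) h + cst x.1 h) (v.1 *: 1 + 0).
  exact: is_deriveD.
by rewrite addr0 [v.1 *: 1]mulr1.
Qed.

Lemma is_derive_snd x v : is_derive x v (fun y : R * R => y.2) v.2.
Proof.
apply: is_derive_line => /=.
have -> : (fun h : R => h *: v.2 + x.2) = (fun h : R => (v.2 \*: id) h + cst x.2 h).
  by apply/funext => h /=; rewrite /GRing.scale/= mulrC.
have : is_derive (0 : R) (1 : R) (fun h : R => (v.2 \*: id) h + cst x.2 h) (v.2 *: 1 + 0).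
  exact: is_deriveD.
by rewrite addr0 [v.2 *: 1]mulr1.
Qed.

Lemma Ck_fst k : Ck k (fun y : R * R => y.1).
Proof.
have c : continuous (fun y : R * R => y.1) by move=> x; exact: cvg_fst.
case: k => [|k]; first by split.
apply: (@CkI _ _ (fun v _ => v.1)) => // v _; split; last exact: Ck_cst.
by move=> x; exact: is_derive_fst.
Qed.

Lemma Ck_snd k : Ck k (fun y : R * R => y.2).
Proof.
have c : continuous (fun y : R * R => y.2) by move=> x; exact: cvg_snd.
case: k => [|k]; first by split.
apply: (@CkI _ _ (fun v _ => v.2)) => // v _; split; last exact: Ck_cst.
by move=> x; exact: is_derive_snd.
Qed.

(** Regularity at the points of [I] only, so that [ln] can be composed with functions whose values
    stay positive. The derivative is existential because only its own regularity matters. *)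
Fixpoint Ck1 (I : set R) (k : nat) (E : R -> R) : Prop :=
  (forall t, I t -> {for t, continuous E}) /\
  match k with
  | 0%N => True
  | k'.+1 => exists E' : R -> R, (forall t, I t -> is_derive t (1 : R) E (E' t)) /\ Ck1 I k' E'
  end.

Lemma Ck1_cont I k E : Ck1 I k E -> forall t, I t -> {for t, continuous E}.
Proof. by case: k => [|k] []. Qed.

Lemma Ck1S I k E : Ck1 I k.+1 E -> Ck1 I k E.
Proof.
elim: k E => [|k IH] E [cE [E' [dE HE]]]; first by split.
by split => //; exists E'; split => //; exact: IH.
Qed.

Lemma Ck1_cst I k (c : R) : Ck1 I k (fun=> c).
Proof.
elim: k c => [|k IH] c; first by split => // t _; exact: cst_continuous.
split; first by move=> t _; exact: cst_continuous.
by exists (fun=> 0); split => // t _; exact: is_derive_cst.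
Qed.

Lemma Ck1D I k E F : Ck1 I k E -> Ck1 I k F -> Ck1 I k (fun t => E t + F t).
Proof.
elim: k E F => [|k IH] E F HE HF; split => //;
  try by move=> t It; apply: continuousD; [exact: (Ck1_cont HE)|exact: (Ck1_cont HF)].
have [_ [E' [dE HE']]] := HE; have [_ [F' [dF HF']]] := HF.
exists (fun t => E' t + F' t); split; last exact: IH.
by move=> t It; apply: is_deriveD; [exact: dE|exact: dF].
Qed.

Lemma Ck1N I k E : Ck1 I k E -> Ck1 I k (fun t => - E t).
Proof.
elim: k E => [|k IH] E HE; split => //;
  try by move=> t It; apply: continuousN; exact: (Ck1_cont HE).
have [_ [E' [dE HE']]] := HE.
exists (fun t => - E' t); split; last exact: IH.
by move=> t It; apply: is_deriveN; exact: dE.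
Qed.

Lemma Ck1B I k E F : Ck1 I k E -> Ck1 I k F -> Ck1 I k (fun t => E t - F t).
Proof. by move=> HE HF; apply: Ck1D => //; exact: Ck1N. Qed.

Lemma Ck1M I k E F : Ck1 I k E -> Ck1 I k F -> Ck1 I k (fun t => E t * F t).
Proof.
elim: k E F => [|k IH] E F HE HF; split => //;
  try by move=> t It; apply: continuousM; [exact: (Ck1_cont HE)|exact: (Ck1_cont HF)].
have [_ [E' [dE HE']]] := HE; have [_ [F' [dF HF']]] := HF.
exists (fun t => E t * F' t + F t * E' t); split.
  by move=> t It; apply: is_deriveM; [exact: dE|exact: dF].
by apply: Ck1D; apply: IH => //; exact: Ck1S.
Qed.

Lemma Ck1_inv I k : (forall t, I t -> t != 0) -> Ck1 I k (fun t : R => t^-1).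
Proof.
move=> In0.
have cV t : I t -> {for t, continuous (fun t : R => t^-1)}.
  by move=> /In0 t0; apply/differentiable_continuous/differentiable_Rinv.
elim: k => [|k IH]; split => //.
exists (fun t => - (t^-1 * t^-1)); split; last by apply: Ck1N; exact: Ck1M.
move=> t It; have := @is_deriveV R id t 1 1 (In0 t It) (is_derive_id _ _).
by rewrite /GRing.scale/= mulr1 expr2 invfM.
Qed.

Lemma Ck1_ln I k : (forall t, I t -> 0 < t) -> Ck1 I k (@ln R).
Proof.
move=> I0.
have cV t : I t -> {for t, continuous (@ln R)} by move=> /I0 t0; exact: continuous_ln.
case: k => [|k]; split => //.
exists (fun t => t^-1); split; first by move=> t /I0; exact: is_derive1_ln.
by apply: Ck1_inv => t /I0 t0; rewrite gt_eqF.
Qed.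

Lemma Ck_comp I k E f : (forall x, I (f x)) -> Ck1 I k E -> Ck k f -> Ck k (fun x => E (f x)).
Proof.
move=> If; elim: k E f If => [|k IH] E f If HE Hf.
  split => // x; apply: continuous_comp; first exact: (Ck_cont Hf).
  exact: (Ck1_cont HE).
have [cE [E' [dE HE']]] := HE.
apply: (@CkI _ _ (fun v x => E' (f x) * 'D_v f x)).
  move=> x; apply: continuous_comp; first exact: (Ck_cont Hf).
  exact: (Ck1_cont HE).
move=> v bv; split; last first.
  by apply: CkM; [apply: IH => //; exact: CkS|exact: Ck_derive].
by move=> x; apply: is_derive_compf; [exact: (derivable_basis x bv Hf)|exact: dE].
Qed.

Lemma smoothM f g : smooth f -> smooth g -> smooth (fun x => f x * g x).
Proof. by move=> Hf Hg k; exact: CkM. Qed.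
Lemma smoothD f g : smooth f -> smooth g -> smooth (fun x => f x + g x).
Proof. by move=> Hf Hg k; exact: CkD. Qed.
Lemma smoothB f g : smooth f -> smooth g -> smooth (fun x => f x - g x).
Proof. by move=> Hf Hg k; exact: CkB. Qed.
Lemma smooth_cst c : smooth (fun _ : R * R => c).
Proof. by move=> k; exact: Ck_cst. Qed.
Lemma smooth_fst : smooth (fun x : R * R => x.1).
Proof. by move=> k; exact: Ck_fst. Qed.
Lemma smooth_snd : smooth (fun x : R * R => x.2).
Proof. by move=> k; exact: Ck_snd. Qed.
Lemma smooth_derive f v : smooth f -> basis_vec v -> smooth (fun x => 'D_v f x).
Proof. by move=> Hf bv k; apply: Ck_derive => //; exact: Hf. Qed.
Lemma smooth_cont f : smooth f -> continuous f.
Proof. by move=> /(_ 0%N) []. Qed.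
Lemma smooth_is_derive f v x : smooth f -> basis_vec v -> is_derive x v f ('D_v f x).
Proof. by move=> /(_ 1%N) Hf bv; exact: (derivable_basis x bv Hf). Qed.
Lemma smooth_comp I E f : (forall x, I (f x)) -> (forall k, Ck1 I k E) -> smooth f ->
  smooth (fun x => E (f x)).
Proof. by move=> If HE Hf k; exact: Ck_comp If (HE k) (Hf k). Qed.

Lemma deriveMs f g v x : smooth f -> smooth g -> basis_vec v ->
  'D_v (fun x => f x * g x) x = 'D_v f x * g x + f x * 'D_v g x.
Proof.
move=> Hf Hg bv.
by have [] := is_deriveMf (smooth_is_derive x Hf bv) (smooth_is_derive x Hg bv).
Qed.

End smooth_functions.

Section bump.
Context {R : realType}.

(* [t^-k exp(-1/t)] extended by 0 to [t <= 0]. *)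
Definition flat (k : nat) (t : R) : R := if t <= 0 then 0 else t ^- k * expR (- t^-1).

Lemma flat_pos k t : 0 < t -> flat k t = t ^- k * expR (- t^-1).
Proof. by rewrite /flat ltNge => /negbTE ->. Qed.

Lemma flat_neg k t : t <= 0 -> flat k t = 0.
Proof. by rewrite /flat => ->. Qed.

Lemma flat_ge0 k t : 0 <= flat k t.
Proof.
rewrite /flat; case: ifPn => //; rewrite -ltNge => t0.
by rewrite mulr_ge0 ?expR_ge0// invr_ge0 exprn_ge0// ltW.
Qed.

Lemma flat_mul k t : flat k.+1 t * t = flat k t.
Proof.
have [t0|t0] := leP t 0; first by rewrite !flat_neg// mul0r.
rewrite !flat_pos// mulrAC; congr (_ * _).
by rewrite exprS invfM mulrAC mulVf ?mul1r// gt_eqF.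
Qed.

(** One term of the exponential series. With u = 1/t it bounds [flat k] by k!, and these factorials
    are the origin of the numerical constants 224 and 112 further on. *)
Lemma exp_ge_pow (u : R) k : 0 <= u -> u ^+ k <= k`!%:R * expR u.
Proof.
move=> u0; have k0 : (0 : R) < k`!%:R by rewrite ltr0n fact_gt0.
rewrite mulrC -ler_pdivrMr//; case: k k0 => [|k] _.
  by rewrite expr0 divr1; apply: le_trans (expR_ge1Dx u); rewrite lerDl.
by apply: le_trans (expR_ge1Dxn k u0); rewrite lerDr.
Qed.

Lemma flat_le k t : flat k t <= k`!%:R.
Proof.
have [t0|t0] := leP t 0; first by rewrite flat_neg.
rewrite flat_pos// -exprVn expRN ler_pdivrMr ?expR_gt0//.
by apply: exp_ge_pow; rewrite invr_ge0 ltW.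
Qed.

End bump.

Section bump_derive.
Context {R : realType}.

Lemma is_derive_quad (E : R -> R) (C : R) : E 0 = 0 -> (forall t, `|E t| <= C * t ^+ 2) ->
  is_derive (0 : R) (1 : R) E 0.
Proof.
move=> E0 HE; have lim0 : (fun h : R => h^-1 *: ((E \o shift 0) (h *: (1 : R)) - E 0)) @ 0^' --> (0 : R).
  apply/cvgrPdist_le => e e0.
  near=> h.
  have h0 : h != 0 by near: h; exact: nbhs_dnbhs_neq.
  rewrite /= E0 subr0 sub0r normrN addr0 [h *: 1]mulr1 normrZ normfV.
  rewrite mulrC ler_pdivrMr ?normr_gt0//.
  rewrite (le_trans (HE h))// -real_normK ?num_real// expr2 mulrA ler_wpM2r//.
  have hs : `|h| <= e / (`|C| + 1).
    near: h; apply: dnbhs0_le; rewrite divr_gt0// ltr_wpDl//.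
  rewrite (@le_trans _ _ ((`|C| + 1) * `|h|))//.
    rewrite ler_wpM2r// (le_trans (ler_norm C))// lerDl//.
  by rewrite mulrC -ler_pdivlMr// ltr_wpDl.
apply: DeriveDef; first by apply/cvg_ex; exists 0.
exact/cvg_lim.
Unshelve. all: by end_near. Qed.

Lemma flat_norm_quad k (t : R) : `|flat k t| <= k.+2`!%:R * t ^+ 2.
Proof.
rewrite ger0_norm ?flat_ge0// -flat_mul -flat_mul -mulrA -expr2.
by rewrite ler_wpM2r ?sqr_ge0// flat_le.
Qed.

(** The family [flat k] is stable under differentiation up to linear combinations, which gives every
    order of smoothness at once. At the origin, [flat k t = flat k.+2 t * t ^+ 2] is quadratically
    small, so the derivative is 0. *)
Lemma is_derive_flat k (t : R) :
  is_derive t (1 : R) (flat k) (flat k.+2 t - k%:R * flat k.+1 t).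
Proof.
have [t0|t0|->] := ltgtP t 0; last first.
- rewrite !flat_neg// mulr0 subr0.
  by apply: (@is_derive_quad _ (k.+2`!%:R)); [rewrite flat_neg|move=> s; exact: flat_norm_quad].
- rewrite !flat_pos//.
  apply: (@near_eq_is_derive R R R (fun s : R => (s^-1) ^+ k * expR (- s^-1) : R)); last first.
    have tn0 : t != 0 by rewrite gt_eqF.
    have dV : is_derive t (1 : R) (fun s : R => s^-1) (- t ^- 2).
      by have := @is_deriveV R id t 1 1 tn0 _; rewrite /GRing.scale/= mulr1; exact.
    have dE : is_derive t (1 : R) (fun s : R => expR (- s^-1)) (t ^- 2 * expR (- t^-1)).
      have := @is_derive1_comp _ expR (fun s : R => - s^-1) t _ _ (is_derive_expR _) (is_deriveN dV).
      by rewrite opprK mulrC.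
    have dX := @is_deriveX _ _ (fun s : R => s^-1) k t 1 _ dV.
    have := is_deriveM dX dE; rewrite exprfctE.
    set d := (X in is_derive _ _ _ X); suff -> : d = t ^- k.+2 * expR (- t^-1) - k%:R * (t ^- k.+1 * expR (- t^-1)) by [].
    rewrite /d /GRing.scale/= -!exprVn; case: k {dX d} => [|k].
      by ring.
    by rewrite /= !exprS; ring.
  near=> s; have s0 : 0 < s by near: s; exact: lt_nbhsr.
  by rewrite flat_pos// exprVn.
- rewrite !flat_neg ?ltW// mulr0 subr0.
  apply: (@near_eq_is_derive R R R (cst 0)).
  near=> s; have s0 : s < 0 by near: s; exact: lt_nbhsl.
  by rewrite flat_neg// ltW.
Unshelve. all: by end_near. Qed.

End bump_derive.

(** * The plane *)

Notation plane R := (measurableTypeR R * measurableTypeR R)%type.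

Lemma count_bigcup_measurable d (T : measurableType d) (I : countType) (P : set I)
    (F : I -> set T) : (forall i, measurable (F i)) -> measurable (\bigcup_(i in P) F i).
Proof.
move=> mF; rewrite [X in measurable X](_ : _ = \bigcup_n
   (if unpickle n is Some i then if `[< P i >] then F i else set0 else set0)); last first.
  rewrite eqEsubset; split => x.
    by move=> [q qO qx]; exists (pickle q) => //; rewrite pickleK asboolT.
  move=> [n _]; case: (unpickle n) => [q|//].
  by case: asboolP => // qO qx; exists q.
apply: bigcup_measurable => n _; case: (unpickle n) => [q|]; last exact: measurable0.
by case: asboolP => _; [exact: mF|exact: measurable0].
Qed.

Section plane_measure.
Context {R : realType}.
Local Notation mu := (leb2 R).
Implicit Types (x y : R * R) (O K : set (R * R)).

Definition obox (a b : R * R) : set (R * R) := `]a.1, b.1[ `*` `]a.2, b.2[.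

Lemma oboxE a b x : obox a b x = (a.1 < x.1 < b.1 /\ a.2 < x.2 < b.2) :> Prop.
Proof. by rewrite /obox /setX /= !in_itv. Qed.

Lemma measurable_obox a b : measurable (obox a b : set (plane R)).
Proof. by apply: measurableX; exact: measurable_itv. Qed.

Lemma leb2_obox a b : a.1 <= b.1 -> a.2 <= b.2 ->
  mu (obox a b) = ((b.1 - a.1) * (b.2 - a.2))%:E.
Proof.
move=> ab1 ab2; rewrite [LHS](_ : _ = lebesgue_measure `]a.1, b.1[ * lebesgue_measure `]a.2, b.2[)%E; last first.
  by apply: product_measure1E; exact: measurable_itv.
rewrite !lebesgue_measure_itv /= !lte_fin.
move: ab1 ab2; rewrite !le_eqVlt => /predU1P[->|->] /predU1P[->|->];
  by rewrite ?ltxx ?subrr ?mul0r ?mulr0 ?mule0 ?mul0e.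
Qed.

Lemma open_oboxP O x : open O -> O x ->
  exists2 e : R, 0 < e & obox (x.1 - e, x.2 - e) (x.1 + e, x.2 + e) `<=` O.
Proof.
move=> oO Ox; have /nbhs_ballP[e /= e0 He] := open_nbhs_nbhs (conj oO Ox).
exists e => // y; rewrite oboxE /= => -[y1 y2]; apply: He.
by split; rewrite /ball /= ltr_distlC; lra.
Qed.

Definition rbox (q : rat * rat * rat * rat) :=
  obox (ratr q.1.1.1 : R, ratr q.1.1.2 : R) (ratr q.1.2, ratr q.2).

(** The link between the product topology and the product sigma-algebra: countably many boxes
    suffice for open sets. The same boxes later localize almost-everywhere statements. *)
Lemma open_bigcup_rbox O : open O ->
  O = \bigcup_(q in [set q | rbox q `<=` O]) rbox q.
Proof.
move=> oO; rewrite eqEsubset; split => [x Ox|x [q qO]]; last exact: qO.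
have [e e0 He] := open_oboxP oO Ox.
have dense_between (a b : R) : a < b -> exists q : rat, a < ratr q < b.
  by move=> ab; have [q] := rat_in_itvoo ab; rewrite in_itv; exists q.
have l1 : x.1 - e < x.1 by rewrite ltrBlDr ltrDl.
have l2 : x.2 - e < x.2 by rewrite ltrBlDr ltrDl.
have r1 : x.1 < x.1 + e by rewrite ltrDl.
have r2 : x.2 < x.2 + e by rewrite ltrDl.
have [q1 /andP[q1a q1b]] := dense_between _ _ l1.
have [q2 /andP[q2a q2b]] := dense_between _ _ l2.
have [q3 /andP[q3a q3b]] := dense_between _ _ r1.
have [q4 /andP[q4a q4b]] := dense_between _ _ r2.
exists (q1, q2, q3, q4); last by rewrite /rbox oboxE /=; split; apply/andP; split.
move=> y; rewrite /rbox oboxE /= => -[/andP[? ?] /andP[? ?]]; apply: He; rewrite oboxE /=.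
split; apply/andP; split; [exact: lt_trans q1a _|exact: lt_trans q3b|exact: lt_trans q2a _|exact: lt_trans q4b].
Qed.

Lemma open_plane_measurable O : open O -> measurable (O : set (plane R)).
Proof.
move=> oO; rewrite (open_bigcup_rbox oO).
by apply: count_bigcup_measurable => q; exact: measurable_obox.
Qed.

Lemma continuous_plane_measurable (f : R * R -> R) : continuous f ->
  measurable_fun setT (f : plane R -> measurableTypeR R).
Proof.
move=> cf; apply: (measurability (@measurable_realfun.RGenOpens.G R) (measurable_realfun.RGenOpens.measurableE R)).
move=> _ [_ [a [b ->] <-]]; rewrite setTI; apply: open_plane_measurable.
by move/continuousP : cf; apply; exact: interval_open.
Qed.

Lemma closed_plane_measurable K : closed K -> measurable (K : set (plane R)).
Proof.
move=> cK; rewrite -(setCK K); apply: measurableC.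
by apply: open_plane_measurable; exact: closed_openC.
Qed.

Lemma compact_plane_closed K : compact K -> closed K.
Proof. exact: compact_closed. Qed.

Lemma compact_plane_measurable K : compact K -> measurable (K : set (plane R)).
Proof. by move=> /compact_plane_closed /closed_plane_measurable. Qed.

Definition cube (r : R) := obox (- r, - r) (r, r).

Lemma bounded_cube K : bounded_set K -> exists2 r : R, 0 < r & K `<=` cube r.
Proof.
move=> [M [_ HM]]; pose r := `|M| + 2.
have r1 : M < `|M| + 1 by rewrite (le_lt_trans (ler_norm M))// ltrDl.
exists r; first by rewrite /r ltr_wpDl.
move=> x Kx; have : Num.max `|x.1| `|x.2| <= `|M| + 1 := HM _ r1 x Kx.
rewrite ge_max => /andP[x1 x2].
rewrite /cube oboxE /= -!ltr_norml /r; split.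
  by rewrite (le_lt_trans x1)// ltrD2l ltr1n.
by rewrite (le_lt_trans x2)// ltrD2l ltr1n.
Qed.

Lemma compact_cube K : compact K -> exists2 r : R, 0 < r & K `<=` cube r.
Proof. by move=> cK; apply: bounded_cube; exact: compact_bounded. Qed.

Lemma leb2_cube_lty r : (mu (cube r) < +oo)%E.
Proof.
have [r0|r0] := leP 0 r.
  by rewrite leb2_obox ?ltry//=; lra.
rewrite (_ : cube r = set0) ?measure0//.
by rewrite -subset0 => x; rewrite /cube oboxE /=; lra.
Qed.

End plane_measure.

(** * Real-valued integrals *)

Section real_integral.
Context d (T : measurableType d) (R : realType) (mu : {measure set T -> \bar R}).
Implicit Types f g : T -> R.

Definition integ f := mu.-integrable setT (EFin \o f).
Definition rmeas f := measurable_fun setT (f : T -> measurableTypeR R).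

Lemma integ_meas f : integ f -> rmeas f.
Proof. by move=> /measurable_int /measurable_EFinP. Qed.

Lemma integ_le f g : rmeas f -> integ g -> (forall x, `|f x| <= g x) -> integ f.
Proof.
move=> mf ig fg; apply: (le_integrable measurableT _ _ ig).
  exact/measurable_EFinP.
by move=> x _; rewrite /= lee_fin (le_trans (fg x))// ler_norm.
Qed.

Lemma integD f g : integ f -> integ g -> integ (fun x => f x + g x).
Proof. by move=> fi gi; have := integrableD measurableT fi gi. Qed.

Lemma integN f : integ f -> integ (fun x => - f x).
Proof. by move=> fi; have := integrableN fi. Qed.

Lemma integB f g : integ f -> integ g -> integ (fun x => f x - g x).
Proof. by move=> fi gi; apply: integD => //; exact: integN. Qed.

Lemma integZ (c : R) f : integ f -> integ (fun x => c * f x).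
Proof. by move=> fi; have := integrableZl measurableT c fi. Qed.

Lemma integ0 : integ (fun=> 0).
Proof. exact: integrable0. Qed.

Lemma integ_norm f : integ f -> integ (fun x => `|f x|).
Proof. exact: integrable_norm. Qed.

Lemma rmeasD f g : rmeas f -> rmeas g -> rmeas (fun x => f x + g x).
Proof. by move=> *; exact: measurable_funD. Qed.
Lemma rmeasB f g : rmeas f -> rmeas g -> rmeas (fun x => f x - g x).
Proof. by move=> *; exact: measurable_funB. Qed.
Lemma rmeasM f g : rmeas f -> rmeas g -> rmeas (fun x => f x * g x).
Proof. by move=> *; exact: measurable_funM. Qed.
Lemma rmeasN f : rmeas f -> rmeas (fun x => - f x).
Proof. by move=> *; exact: measurableT_comp. Qed.
Lemma rmeas_cst (c : R) : rmeas (fun=> c).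
Proof. exact: measurable_cst. Qed.
Lemma rmeas_norm f : rmeas f -> rmeas (fun x => `|f x|).
Proof. by move=> *; exact: measurableT_comp. Qed.
Lemma rmeas_indic (E : set T) : measurable E -> rmeas (\1_E : T -> R).
Proof. by move=> mE; exact: measurable_indic. Qed.

Lemma integM_bounded f g (C : R) : rmeas g -> (forall x, `|g x| <= C) -> integ f ->
  integ (fun x => g x * f x).
Proof.
move=> mg gC fi; apply: (@integ_le _ (fun x => C * `|f x|)).
- by apply: rmeasM => //; exact: integ_meas.
- by apply: integZ; exact: integ_norm.
- by move=> x; rewrite normrM ler_wpM2r.
Qed.

Lemma intD f g : integ f -> integ g ->
  \int[mu]_x (f x + g x) = \int[mu]_x f x + \int[mu]_x g x.
Proof. by move=> *; exact: RintegralD. Qed.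
Lemma intB f g : integ f -> integ g ->
  \int[mu]_x (f x - g x) = \int[mu]_x f x - \int[mu]_x g x.
Proof. by move=> *; exact: RintegralB. Qed.
Lemma intZ c f : integ f -> \int[mu]_x (c * f x) = c * \int[mu]_x f x.
Proof. by move=> *; exact: RintegralZl. Qed.
Lemma intN f : integ f -> \int[mu]_x (- f x) = - \int[mu]_x f x.
Proof.
move=> fi; rewrite -mulN1r -intZ//; apply: eq_Rintegral => x _; by rewrite mulN1r.
Qed.
Lemma int_le f g : integ f -> integ g -> (forall x, f x <= g x) ->
  \int[mu]_x f x <= \int[mu]_x g x.
Proof. by move=> *; apply: le_Rintegral. Qed.
Lemma int_ge0 f : (forall x, 0 <= f x) -> 0 <= \int[mu]_x f x.
Proof. by move=> f0; apply: Rintegral_ge0. Qed.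
Lemma int_norm_le f : integ f -> `|\int[mu]_x f x| <= \int[mu]_x `|f x|.
Proof. by move=> fi; exact: le_normr_Rintegral. Qed.
Lemma eq_int f g : f =1 g -> \int[mu]_x f x = \int[mu]_x g x.
Proof. by move=> fg; apply: eq_Rintegral => x _. Qed.
Lemma int0 : \int[mu]_x (0 : R) = 0.
Proof. by rewrite /Rintegral integral0. Qed.

Lemma int_indic (E : set T) : measurable E -> \int[mu]_x (\1_E x : R) = fine (mu E).
Proof. by move=> mE; rewrite /Rintegral integral_indic// setIT. Qed.

Lemma integ_indic (E : set T) : measurable E -> (mu E < +oo)%E -> integ (\1_E : T -> R).
Proof.
move=> mE Efin; apply/integrableP; split; first exact/measurable_EFinP/measurable_indic.
rewrite (eq_integral (fun x => (\1_E x)%:E)) ?integral_indic ?setIT// => x _.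
by rewrite /= ger0_norm.
Qed.

Lemma int_ae_eq f g : integ f -> rmeas g -> {ae mu, forall x, f x = g x} ->
  integ g /\ \int[mu]_x f x = \int[mu]_x g x.
Proof.
move=> fi mg fg.
have mfE : measurable_fun setT (EFin \o f) by exact: measurable_int fi.
have mgE : measurable_fun setT (EFin \o g) by exact/measurable_EFinP.
have fgE : ae_eq mu setT (EFin \o f) (EFin \o g).
  by apply: filterS fg => x /= -> _.
split; last by rewrite /Rintegral; congr fine; apply: ae_eq_integral.
apply/integrableP; split => //.
have /integrableP[_] := fi.
congr (_ < _)%E; apply: ae_eq_integral => //; [exact: measurableT_comp..|].
by apply: filterS fg => x /= -> _.
Qed.

Lemma int_cvg (f_ : nat -> T -> R) f g : (forall n, rmeas (f_ n)) -> rmeas f ->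
  {ae mu, forall x, f_ ^~ x @ \oo --> f x} -> integ g ->
  (forall n x, `|f_ n x| <= g x) ->
  \int[mu]_x f_ n x @[n --> \oo] --> \int[mu]_x f x.
Proof.
move=> mf_ mf cf gi fg.
have H1 n : measurable_fun setT (EFin \o f_ n) by apply/measurable_EFinP; exact: mf_.
have H2 : measurable_fun setT (EFin \o f) by exact/measurable_EFinP.
have H3 : {ae mu, forall x, setT x -> (EFin \o f_ n) x @[n --> \oo] --> (EFin \o f) x}.
  by apply: filterS cf => x cfx _ /=; apply: cvg_EFin => //; exact: nearW.
have H4 : {ae mu, forall x n, setT x -> (`|(EFin \o f_ n) x| <= (EFin \o g) x)%E}.
  by apply: aeW => x n _ /=; rewrite lee_fin.
have [fi _ H] := dominated_convergence measurableT H1 H2 H3 gi H4.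
apply: fine_cvg.
rewrite fineK; last exact: integrable_fin_num.
exact: H.
Qed.

(** L^2 as a predicate on functions rather than a space of classes, so that integrands can be
    rewritten pointwise; products are integrable by |f g| <= f^2 + g^2. *)
Definition sqi f := rmeas f /\ integ (fun x => f x ^+ 2).

Lemma sqi_mul f g : sqi f -> sqi g -> integ (fun x => f x * g x).
Proof.
move=> [mf fi] [mg gi]; apply: (@integ_le _ (fun x => f x ^+ 2 + g x ^+ 2)).
- exact: rmeasM.
- exact: integD.
- move=> x; rewrite ler_norml; apply/andP; split; nra.
Qed.

Lemma sqi_sq f : sqi f -> integ (fun x => f x ^+ 2).
Proof. by case. Qed.

Lemma sqi_meas f : sqi f -> rmeas f.
Proof. by case. Qed.

Lemma sqiD f g : sqi f -> sqi g -> sqi (fun x => f x + g x).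
Proof.
move=> sf sg; have [[mf fi] [mg gi]] := (sf, sg); split; first exact: rmeasD.
have := integD (integD fi gi) (integZ 2 (sqi_mul sf sg)).
by congr integ; apply/funext => x; ring.
Qed.

Lemma sqiM_bounded f g (C : R) : rmeas g -> (forall x, `|g x| <= C) -> sqi f ->
  sqi (fun x => g x * f x).
Proof.
move=> mg gC [mf fi]; split; first exact: rmeasM.
have := @integM_bounded _ (fun x => g x * g x) (C * C) (rmeasM mg mg) _ fi.
rewrite (_ : (fun x => _) = (fun x => (g x * f x) ^+ 2)); last by apply/funext => x; ring.
by apply => x; rewrite normrM ler_pM.
Qed.

Lemma sqiZ (c : R) f : sqi f -> sqi (fun x => c * f x).
Proof.
move=> sf; apply: (@sqiM_bounded _ (fun=> c) `|c|) => //; exact: rmeas_cst.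
Qed.

Lemma sqiN f : sqi f -> sqi (fun x => - f x).
Proof. by move=> /(sqiZ (-1)); under eq_fun do rewrite mulN1r. Qed.

Lemma sqiB f g : sqi f -> sqi g -> sqi (fun x => f x - g x).
Proof. by move=> sf sg; apply: sqiD => //; exact: sqiN. Qed.

Lemma sqi_bounded f (C : R) (E : set T) : measurable E -> (mu E < +oo)%E -> rmeas f ->
  (forall x, `|f x| <= C) -> (forall x, ~ E x -> f x = 0) -> sqi f.
Proof.
move=> mE Efin mf fC fE; split => //.
apply: (@integ_le _ (fun x => C ^+ 2 * \1_E x)).
- by apply: rmeasM.
- by apply: integZ; exact: integ_indic.
- move=> x; rewrite indicE; have [Ex|Ex] := boolP (x \in E) => /=.
    by rewrite mulr1 normrX lerXn2r ?nnegrE// (le_trans (normr_ge0 (f x)) (fC x)).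
  by rewrite fE ?expr0n/= ?normr0 ?mulr0//; move: Ex; rewrite notin_setE.
Qed.

Lemma integ_bounded f (C : R) (E : set T) : measurable E -> (mu E < +oo)%E -> rmeas f ->
  (forall x, `|f x| <= C) -> (forall x, ~ E x -> f x = 0) -> integ f.
Proof.
move=> mE Efin mf fC fE.
apply: (@integ_le _ (fun x => C * \1_E x)) => //.
- by apply: integZ; exact: integ_indic.
- move=> x; rewrite indicE; have [Ex|Ex] := boolP (x \in E) => /=; first by rewrite mulr1.
  by rewrite fE ?normr0 ?mulr0//; move: Ex; rewrite notin_setE.
Qed.

End real_integral.
Arguments rmeas {d T R} f.

(** * Test functions: boundedness, integrability, Lipschitz bounds *)

Section test_functions.
Context {R : realType}.
Local Notation mu := (leb2 R).
Implicit Types (x y v : R * R) (D K : set (R * R)) (f g : R * R -> R).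

Lemma zero_off_derive K f v x : closed K -> (forall y, ~ K y -> f y = 0) ->
  ~ K x -> 'D_v f x = 0.
Proof.
move=> cK f0 nKx; have [->|v0] := eqVneq v 0.
  by rewrite derive0.
rewrite -(derive_cst (0 : R) x v); apply: near_eq_derive => //.
have : nbhs x (~` K) by apply: open_nbhs_nbhs; split => //; exact: closed_openC.
by apply: filterS => y /f0.
Qed.

Lemma test_smooth D f : test_function D f -> smooth f.
Proof. by case. Qed.

Lemma test_derive D f v : basis_vec v -> test_function D f ->
  test_function D (fun x => 'D_v f x).
Proof.
move=> bv [sf [K [cK KD H]]]; split; first exact: smooth_derive.
exists K; split => // x; apply: zero_off_derive => //; exact: compact_plane_closed.
Qed.

Lemma testMl D f g : smooth g -> test_function D f -> test_function D (fun x => g x * f x).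
Proof.
move=> sg [sf [K [cK KD H]]]; split; first exact: smoothM.
by exists K; split => // x /H ->; rewrite mulr0.
Qed.

Lemma testMr D f g : smooth g -> test_function D f -> test_function D (fun x => f x * g x).
Proof.
move=> sg /(testMl sg); congr test_function; apply/funext => x; exact: mulrC.
Qed.

Lemma testN D f : test_function D f -> test_function D (fun x => - f x).
Proof.
move=> /(testMl (smooth_cst (-1))); congr test_function; apply/funext => x.
by rewrite mulN1r.
Qed.

Lemma continuous_compact_bounded K f : compact K -> continuous f ->
  exists2 C : R, 0 <= C & forall x, K x -> `|f x| <= C.
Proof.
move=> cK cf; have /compact_bounded[M [_ HM]] : compact (f @` K).
  by apply: continuous_compact => //; exact: continuous_subspaceT.
exists (`|M| + 1); first by rewrite addr_ge0.
move=> x Kx; apply: HM; last by exists x.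
by rewrite (le_lt_trans (ler_norm M))// ltrDl.
Qed.

Lemma test_bounded D f : test_function D f -> exists2 C : R, 0 <= C & forall x, `|f x| <= C.
Proof.
move=> [/smooth_cont cf [K [cK _ H]]].
have [C C0 HC] := continuous_compact_bounded cK cf.
exists C => // x; have [/HC//|/H ->] := pselect (K x).
by rewrite normr0.
Qed.

Lemma smooth_meas f : smooth f -> rmeas (f : plane R -> R).
Proof. by move=> /smooth_cont; exact: continuous_plane_measurable. Qed.

Lemma test_meas D f : test_function D f -> rmeas (f : plane R -> R).
Proof. by move=> /test_smooth/smooth_meas. Qed.

Lemma test_cube D f : test_function D f ->
  exists2 r : R, 0 < r & forall x, ~ cube r x -> f x = 0.
Proof.
move=> [_ [K [cK _ H]]]; have [r r0 Kr] := compact_cube cK.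
by exists r => // x nx; apply: H => /Kr.
Qed.

Lemma cube_meas (r : R) : measurable (cube r : set (plane R)).
Proof. exact: measurable_obox. Qed.

Lemma test_sqi D f : test_function D f -> sqi mu f.
Proof.
move=> tf; have [C C0 fC] := test_bounded tf; have [r r0 fr] := test_cube tf.
apply: (@sqi_bounded _ (plane R) R mu f C (cube r)) => //; [exact: cube_meas|exact: leb2_cube_lty|exact: test_meas tf].
Qed.

Lemma test_integ D f : test_function D f -> integ mu f.
Proof.
move=> tf; have [C C0 fC] := test_bounded tf; have [r r0 fr] := test_cube tf.
apply: (@integ_bounded _ (plane R) R mu f C (cube r)) => //; [exact: cube_meas|exact: leb2_cube_lty|exact: test_meas tf].
Qed.

Lemma line_lipschitz f v (C : R) : smooth f -> basis_vec v ->
  (forall x, `|'D_v f x| <= C) -> forall x h, `|f (x + h *: v) - f x| <= C * `|h|.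
Proof.
move=> sf bv HC x h.
pose F (t : R) := f (t *: v + x).
have dF (t : R) : is_derive t (1 : R) F ('D_v f (t *: v + x)).
  have := is_derive_lineP (smooth_is_derive (t *: v + x) sf bv).
  move=> H; have := @is_derive1_comp R (fun h => f (h *: v + (t *: v + x))) (fun s => s - t) t ('D_v f (t *: v + x)) 1.
  rewrite subrr => /(_ H).
  have -> : (fun h => f (h *: v + (t *: v + x))) \o (fun s => s - t) = F.
    by apply/funext => s /=; rewrite /F addrA -scalerDl subrK.
  rewrite mulr1; apply.
  have := @is_deriveB _ _ _ (@id R) (cst t) t 1 1 0 (is_derive_id _ _) (is_derive_cst _ _ _).
  by rewrite subr0.
have cF (t : R) : {for t, continuous F}.
  by apply/differentiable_continuous/derivable1_diffP; case: (dF t).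
have main (a b : R) : a <= b -> `|F b - F a| <= C * `|b - a|.
  rewrite le_eqVlt => /predU1P[->|ab]; first by rewrite !subrr normr0 mulr0.
  have cFs : {within `[a, b], continuous F} by apply: continuous_subspaceT => t; exact: cF.
  have [c _ ->] := MVT ab (fun t _ => dF t) cFs.
  by rewrite normrM ler_wpM2r.
have -> : f (x + h *: v) - f x = F h - F 0 by rewrite /F scale0r add0r [x + _]addrC.
have [h0|h0] := leP 0 h.
  by have := main 0 h h0; rewrite subr0.
by have := main h 0 (ltW h0); rewrite distrC sub0r normrN.
Qed.

Lemma vec_decomp (z : R * R) : z = z.1 *: e1 R + z.2 *: e2 R.
Proof.
by case: z => a b; apply: injective_projections; rewrite /= /GRing.scale/= !mulr1 !mulr0 ?addr0 ?add0r.
Qed.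

Lemma test_lipschitz D f : test_function D f ->
  exists2 C : R, 0 <= C & forall x z, `|f (x + z) - f x| <= C * (`|z.1| + `|z.2|).
Proof.
move=> tf; have b1 : basis_vec (e1 R) by left. have b2 : basis_vec (e2 R) by right.
have [C1 C10 H1] := test_bounded (test_derive b1 tf).
have [C2 C20 H2] := test_bounded (test_derive b2 tf).
exists (C1 + C2); first by rewrite addr_ge0.
move=> x z; rewrite {1}(vec_decomp z) addrA.
have l1 := line_lipschitz (test_smooth tf) b1 H1 x z.1.
have l2 := line_lipschitz (test_smooth tf) b2 H2 (x + z.1 *: e1 R) z.2.
rewrite (le_trans (ler_distD (f (x + z.1 *: e1 R)) _ _))//.
rewrite (le_trans (lerD l2 l1))// mulrDl !mulrDr.
have : 0 <= C1 * `|z.2| by rewrite mulr_ge0.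
have : 0 <= C2 * `|z.1| by rewrite mulr_ge0.
lra.
Qed.

End test_functions.

(** * Superpositions of translates and differentiation under the integral *)

Section superposition.
Context {R : realType} d (T : measurableType d) (nu : {measure set T -> \bar R}).
Variables (Y : T -> R * R) (b : T -> R).
Hypothesis mY1 : rmeas (fun t => (Y t).1).
Hypothesis mY2 : rmeas (fun t => (Y t).2).
Hypothesis ib : integ nu b.
Implicit Types (x v : R * R) (g : R * R -> R).

(** Common form of convolution ([Y] the identity of the plane), of the primitive along a segment
    ([Y t = (t, 0)], [b] the indicator of an interval) and of a translated integral. Smoothness
    comes from [g] alone; [b] is only integrable. *)
Definition superpos g x := \int[nu]_t (g (x - Y t) * b t).

Lemma superpos_meas g x : continuous g -> rmeas (fun t => g (x - Y t)).
Proof.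
move=> cg.
have mg : measurable_fun setT (g : plane R -> measurableTypeR R) by exact: continuous_plane_measurable.
have mxY : measurable_fun setT ((fun t => (x.1 - (Y t).1, x.2 - (Y t).2)) : T -> plane R).
  by apply/measurable_fun_pairP; split; [exact: (rmeasB (rmeas_cst x.1) mY1)|exact: (rmeasB (rmeas_cst x.2) mY2)].
exact: (measurableT_comp mg mxY).
Qed.

Lemma superpos_integ D g x : test_function D g -> integ nu (fun t => g (x - Y t) * b t).
Proof.
move=> tg; have [C C0 gC] := test_bounded tg.
apply: (@integM_bounded _ _ _ _ _ _ C) => //.
by apply: superpos_meas; apply: smooth_cont; exact: test_smooth tg.
Qed.

Lemma superpos_cont D g : test_function D g -> continuous (superpos g).
Proof.
move=> tg x; have [C C0 HC] := test_lipschitz tg.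
have ibn := integ_norm ib.
set B := \int[nu]_t `|b t|.
have B0 : 0 <= B by exact: int_ge0.
have key z : `|superpos g x - superpos g (x + z)| <= C * (`|z.1| + `|z.2|) * B.
  rewrite distrC /superpos -intB; [|exact: superpos_integ tg..].
  rewrite (le_trans (int_norm_le _))//; first by apply: integB; exact: superpos_integ tg.
  rewrite -intZ//; apply: int_le.
  - by apply: integ_norm; apply: integB; exact: superpos_integ tg.
  - exact: integZ.
  - move=> t; rewrite -mulrBl normrM ler_wpM2r// addrAC; exact: HC.
apply/cvgrPdist_le => e e0.
have p : 0 < 2 * C * B + 1 by rewrite ltr_wpDl// !mulr_ge0.
set k := e / (2 * C * B + 1).
have k0 : 0 < k by rewrite divr_gt0.
have ke : k * (2 * C * B + 1) = e by rewrite divfK// gt_eqF.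
have nb : nbhs (x : R * R) [set y : R * R | `|y.1 - x.1| <= k /\ `|y.2 - x.2| <= k].
  apply/nbhs_ballP; exists k => // y [y1 y2].
  by rewrite /= (distrC y.1) (distrC y.2); split; exact: ltW.
apply: filterS nb => y [y1 y2].
rewrite -(subrK x y) [y - x + x]addrC (le_trans (key _))//.
rewrite (@le_trans _ _ (C * (k + k) * B))//.
  by apply: ler_wpM2r => //; apply: ler_wpM2l => //; exact: lerD.
rewrite (_ : C * (k + k) * B = k * (2 * C * B)); last by ring.
by rewrite -ke ler_wpM2l ?lerDl// ltW.
Qed.

Lemma superpos_derive D g x v : basis_vec v -> test_function D g ->
  is_derive x v (superpos g) (superpos (fun y => 'D_v g y) x).
Proof.
move=> bv tg; apply: is_derive_line.
have sg := test_smooth tg.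
have [C C0 HC] := test_bounded (test_derive bv tg).
pose f (h : R) (t : T) := g (h *: v + x - Y t) * b t.
have df (h : R) (t : T) : is_derive h (1 : R) (f ^~ t) ('D_v g (h *: v + x - Y t) * b t).
  have H := is_derive_lineP (smooth_is_derive (h *: v + x - Y t) sg bv).
  have E := @is_derive1_comp R (fun k => g (k *: v + (h *: v + x - Y t))) (fun s => s - h) h
    ('D_v g (h *: v + x - Y t)) 1.
  rewrite subrr mulr1 in E.
  have D1 : is_derive h (1 : R) (fun s : R => s - h) 1.
    have := @is_deriveB _ _ _ (@id R) (cst h) h 1 1 0 (is_derive_id _ _) (is_derive_cst _ _ _).
    by rewrite subr0.
  have {}E := E H D1.
  have := is_deriveM E (is_derive_cst (b t) h 1).
  rewrite scaler0 add0r /GRing.scale/= [b t * _]mulrC.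
  set F := (X in is_derive _ _ X _); suff -> : F = f ^~ t by [].
  by apply/funext => s; rewrite /F mulrfctE /= !addrA -scalerDl subrK.
have I0 : (`]-1, 1[%classic : set R) 0 by rewrite /= in_itv /= ltrN10 ltr01.
have intf (h : R) : (`]-1, 1[%classic : set R) h -> nu.-integrable setT (EFin \o f h).
  by move=> _; exact: superpos_integ tg.
have derf (h : R) t : (`]-1, 1[%classic : set R) h -> setT t -> derivable (f ^~ t) h 1.
  by move=> _ _; case: (df h t).
have d1 (h : R) t : partial1of2 f h t = 'D_v g (h *: v + x - Y t) * b t.
  by rewrite partial1of2E; case: (df h t).
have Gub (h : R) t : (`]-1, 1[%classic : set R) h -> setT t -> `|partial1of2 f h t| <= C * `|b t|.
  by move=> _ _; rewrite d1 normrM ler_wpM2r.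
have G0 t : 0 <= C * `|b t| by rewrite mulr_ge0.
have iG : nu.-integrable setT (EFin \o (fun t => C * `|b t|)).
  by apply: integZ; exact: integ_norm.
have A := derivable_under_integral measurableT I0 intf derf G0 iG Gub.
have B := differentiation_under_integral measurableT I0 intf derf G0 iG Gub.
apply: DeriveDef; first exact: A.
rewrite -derive1E [LHS]B; apply: eq_int => t.
by rewrite d1 scale0r add0r.
Qed.

Lemma superpos_smooth D g : test_function D g -> smooth (superpos g).
Proof.
move=> tg k; elim: k g tg => [|k IH] g tg; first by split => //; exact: superpos_cont tg.
apply: (@CkI _ _ _ (fun v x => superpos (fun y => 'D_v g y) x)); first exact: superpos_cont tg.
move=> v bv; split; first by move=> x; exact: superpos_derive tg.
by apply: IH; exact: test_derive.
Qed.

End superposition.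

(** * Translation invariance of plane Lebesgue measure *)

Section translation.
Context {R : realType}.
Local Notation mu := (leb2 R).
Local Notation lam := (@lebesgue_measure R).
Implicit Types (x y v : R * R) (D K : set (R * R)) (f g : R * R -> R).

Definition shift1 (c : R) (t : measurableTypeR R) : measurableTypeR R := t + c.

Lemma shift1_meas c : measurable_fun setT (shift1 c).
Proof. exact: (@measurable_funD _ _ R setT id (cst c) (@measurable_id _ _ _) (@measurable_cst _ _ _ _ _ _)). Qed.

(** The pushforward by a translation agrees with Lebesgue measure on half-open intervals, which
    determine it. *)
Lemma lebesgue_shift (c : R) (A : set (measurableTypeR R)) : measurable A ->
  lam (shift1 c @^-1` A) = lam A.
Proof.
move=> mA.
pose phi : {mfun measurableTypeR R >-> measurableTypeR R} :=
  HB.pack (shift1 c)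
    (isMeasurableFun.Build _ _ _ _ _ (shift1_meas c)).
have := @lebesgue_measure_unique R (pushforward lam phi) _ A mA.
move=> ->//= _ [[a b]] _ <-.
rewrite /pushforward /= (_ : _ @^-1` _ = `]a - c, b - c]%classic); last first.
  by apply/seteqP; split => t /=; rewrite !in_itv /= /shift1 ltrBlDr lerBrDr.
rewrite !lebesgue_measure_itv /= !lte_fin ltrD2r.
by case: ifP => // _; rewrite -!EFinB; congr EFin; ring.
Qed.

Definition shift2 (c : R * R) (x : plane R) : plane R := (x.1 + c.1, x.2 + c.2).

Lemma shift2_meas c : measurable_fun setT (shift2 c).
Proof.
apply/measurable_fun_pairP; split.
  exact: (measurable_funD measurable_fst (measurable_cst c.1)).
exact: (measurable_funD measurable_snd (measurable_cst c.2)).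
Qed.

Lemma leb2_shift c (A : set (plane R)) : measurable A -> mu (shift2 c @^-1` A) = mu A.
Proof.
move=> mA.
pose phi : {mfun plane R >-> plane R} :=
  HB.pack (shift2 c) (isMeasurableFun.Build _ _ _ _ _ (shift2_meas c)).
apply/esym; apply: (@product_measure_unique _ _ (measurableTypeR R) (measurableTypeR R) R lam lam
  (pushforward mu phi) _ A mA) => B C mB mC.
rewrite [LHS](_ : _ = mu ((shift1 (c.1) @^-1` B)
   `*` (shift1 (c.2) @^-1` C)))//.
rewrite [LHS](_ : _ = (lam (shift1 (c.1) @^-1` B)
   * lam (shift1 (c.2) @^-1` C))%E).
  by rewrite !lebesgue_shift.
by apply: product_measure1E; rewrite -[X in measurable X]setTI; exact: shift1_meas.
Qed.

Lemma int_shift (f : R * R -> R) c : integ mu f ->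
  integ mu (fun x => f (x + c)) /\ \int[mu]_x f (x + c) = \int[mu]_x f x.
Proof.
move=> fi.
pose phi : {mfun plane R >-> plane R} :=
  HB.pack (shift2 c) (isMeasurableFun.Build _ _ _ _ _ (shift2_meas c)).
have mf : measurable_fun setT (EFin \o f : plane R -> \bar R) by exact: measurable_int fi.
have mfs : measurable_fun setT ((EFin \o f) \o phi : plane R -> \bar R).
  by apply: measurableT_comp => //; exact: shift2_meas.
have E (h : plane R -> \bar R) : (\int[mu]_x h x = \int[pushforward mu phi]_x h x)%E.
  by apply: eq_measure_integral => A mA AT; exact: (esym (leb2_shift c mA)).
have ifs : mu.-integrable setT ((EFin \o f) \o phi).
  apply/integrableP; split => //.
  have := @ge0_integral_pushforward _ _ (plane R) (plane R) R phi (shift2_meas c) mu setT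
    (fun x => `|(EFin \o f) x|)%E measurableT.
  rewrite preimage_setT => <-//; last first.
    exact: measurableT_comp.
  rewrite -E.
  by have /integrableP[] := fi.
split; first exact: ifs.
rewrite /Rintegral; congr fine.
have := @integral_pushforward _ _ (plane R) (plane R) R phi (shift2_meas c) mu setT (EFin \o f) mf.
rewrite preimage_setT => /(_ ifs measurableT) <-.
by apply/esym; exact: E.
Qed.

(** The integral of a translate of f does not depend on the translation; its derivative in the
    translation parameter is the integral of the derivative. *)
Lemma int_derive0 D f v : basis_vec v -> test_function D f -> \int[mu]_x 'D_v f x = 0.
Proof.
move=> bv tf; have [r r0 fr] := test_cube tf.
(* [superpos] against the indicator of a larger cube is locally constant. *)
pose b : R * R -> R := \1_(cube (r + 1)).
pose Y (t : plane R) : R * R := - (t : R * R).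
have ib : integ mu b by apply: integ_indic; [exact: cube_meas|exact: leb2_cube_lty].
have m1 : rmeas (fun t : plane R => (Y t).1) by apply: rmeasN; exact: measurable_fst.
have m2 : rmeas (fun t : plane R => (Y t).2) by apply: rmeasN; exact: measurable_snd.
have dS := superpos_derive m1 m2 ib 0 bv tf.
have tD := test_derive bv tf.
have E1 g : (forall x, ~ cube (r + 1) x -> g x = 0) -> superpos mu Y b g 0 = \int[mu]_x g x.
  move=> g0; rewrite /superpos; apply: eq_int => x; rewrite /Y sub0r opprK /b indicE.
  have [xc|xc] := boolP (x \in cube (r + 1)) => /=; first by rewrite mulr1.
  by rewrite g0 ?mulr0//; move: xc; rewrite notin_setE.
have cube_sub : cube r `<=` cube (r + 1).
  by move=> x; rewrite /cube !oboxE /=; lra.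
have Df0 x : ~ cube (r + 1) x -> 'D_v f x = 0.
  move=> nx; have cK : closed [set x : R * R | `|x.1| <= r /\ `|x.2| <= r].
    apply: closedI.
      by apply: (@closed_comp _ _ (fun x : R * R => `|x.1|) [set t | t <= r]) => [y _|];
        [apply: continuous_comp; [exact: cvg_fst|exact: norm_continuous]|exact: closed_le].
    by apply: (@closed_comp _ _ (fun x : R * R => `|x.2|) [set t | t <= r]) => [y _|];
        [apply: continuous_comp; [exact: cvg_snd|exact: norm_continuous]|exact: closed_le].
  apply: (zero_off_derive v cK) => [y nKy|].
    apply: fr => cy; apply: nKy; move: cy; rewrite /cube oboxE /= => -[/andP[? ?] /andP[? ?]].
    by split; rewrite ler_norml; apply/andP; split; exact: ltW.
  move=> [/= x1 x2]; apply: nx; rewrite /cube oboxE /= -!ltr_norml.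
  by split; [rewrite (le_lt_trans x1)// ltrDl|rewrite (le_lt_trans x2)// ltrDl].
rewrite -(E1 (fun x => 'D_v f x))//.
have dL := is_derive_lineP dS.
have vle : `|v.1| <= 1 /\ `|v.2| <= 1.
  by case: bv => ->; rewrite /= normr1 normr0.
have lc : \forall h \near (0 : R), cst (\int[mu]_x f x) h = superpos mu Y b f (h *: v + 0).
  near=> h; rewrite addr0 /=.
  have h1 : `|h| < 1 by near: h; apply/nbhs_ballP; exists 1; [exact: ltr01|move=> k; rewrite /ball /= sub0r normrN].
  have [_ <-] := int_shift (h *: v) (test_integ tf).
  apply: eq_int => x; rewrite /Y opprK [h *: v + x]addrC /b indicE.
  have [xc|xc] := boolP (x \in cube (r + 1)) => /=; first by rewrite mulr1.
  rewrite fr ?mul0r// => cx; move: xc; rewrite notin_setE; apply.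
  have b1 : `|h * v.1| < 1 by rewrite normrM (le_lt_trans _ h1)// ler_piMr// (proj1 vle).
  have b2 : `|h * v.2| < 1 by rewrite normrM (le_lt_trans _ h1)// ler_piMr// (proj2 vle).
  move: cx b1 b2; rewrite /cube !oboxE /= /GRing.scale/= !ltr_norml.
  by move=> [/andP[? ?] /andP[? ?]] /andP[? ?] /andP[? ?]; split; apply/andP; split; lra.
have dC : is_derive (0 : R) (1 : R) (fun h : R => superpos mu Y b f (h *: v + 0)) 0.
  exact: (@near_eq_is_derive R R R (cst (\int[mu]_x f x)) _ 0 1 0 lc (is_derive_cst _ _ _)).
have [_ <-] := dL.
by have [_ ->] := dC.
Unshelve. all: by end_near. Qed.

End translation.

(** * Boxes as a generating pi-system *)

Section boxes.
Context {R : realType}.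
Local Notation mu := (leb2 R).
Implicit Types (x y v : R * R) (D K : set (R * R)) (f g : R * R -> R).

Definition oboxes : set (set (plane R)) := [set E | exists a b, E = obox a b].

Lemma oboxI (a b c d : R * R) : obox a b `&` obox c d =
  obox (Num.max a.1 c.1, Num.max a.2 c.2) (Num.min b.1 d.1, Num.min b.2 d.2).
Proof.
apply/seteqP; split => x; rewrite /setI /= !oboxE /= !gt_max !lt_min.
  by move=> [[/andP[-> ->] /andP[-> ->]] [/andP[-> ->] /andP[-> ->]]].
by move=> [/andP[/andP[-> ->] /andP[-> ->]] /andP[/andP[-> ->] /andP[-> ->]]].
Qed.

Lemma oboxes_setI : setI_closed oboxes.
Proof. by move=> _ _ [a [b ->]] [c [d ->]]; rewrite oboxI; do 2 eexists. Qed.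

Lemma cube_bigcup : [set: R * R] = \bigcup_n cube (n.+1%:R : R).
Proof.
apply/seteqP; split => // x _.
exists (Num.bound (`|x.1| + `|x.2|)) => //.
have H : `|x.1| + `|x.2| < (Num.bound (`|x.1| + `|x.2|)).+1%:R.
  rewrite (@lt_trans _ _ (Num.bound (`|x.1| + `|x.2|))%:R)//.
    by apply: archi_boundP; rewrite addr_ge0.
  by rewrite ltr_nat.
rewrite /cube oboxE /= -!ltr_norml; split; apply: le_lt_trans H.
  by rewrite lerDl.
by rewrite lerDr.
Qed.

(** Strips are countable unions of boxes, which makes both coordinates measurable for the generated
    sigma-algebra. This is what allows a Dynkin induction starting from boxes. *)
Lemma measurable_oboxes : @measurable _ (plane R) = <<s oboxes >>.
Proof.
apply/seteqP; split; last first.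
  apply: smallest_sub; first exact: sigma_algebra_measurable.
  by move=> _ [a [b ->]]; exact: measurable_obox.
rewrite measurable_prod_measurableType.
apply: smallest_sub; first exact: smallest_sigma_algebra.
pose T' := g_sigma_algebraType oboxes.
have strip1 (a b : R) : (<<s oboxes >>) (`]a, b[ `*` setT).
  rewrite (_ : _ `*` _ = \bigcup_n obox (a, - n.+1%:R) (b, n.+1%:R)).
    by apply: sigma_algebra_bigcup => n; apply: sub_sigma_algebra; do 2 eexists.
  apply/seteqP; split => [[x y] [/= xab _]|[x y] [n _]].
    have : (\bigcup_n cube (n.+1%:R : R)) (0 : R, y) by rewrite -cube_bigcup.
    move=> [n _]; rewrite /cube oboxE /= => -[_ yn]; exists n => //.
  by rewrite oboxE /= => -[xab _]; split => //=; rewrite in_itv.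
have strip2 (a b : R) : (<<s oboxes >>) (setT `*` `]a, b[).
  rewrite (_ : _ `*` _ = \bigcup_n obox (- n.+1%:R, a) (n.+1%:R, b)).
    by apply: sigma_algebra_bigcup => n; apply: sub_sigma_algebra; do 2 eexists.
  apply/seteqP; split => [[x y] [_ /= xab]|[x y] [n _]].
    have : (\bigcup_n cube (n.+1%:R : R)) (x, 0 : R) by rewrite -cube_bigcup.
    move=> [n _]; rewrite /cube oboxE /= => -[yn _]; exists n => //.
  by rewrite oboxE /= => -[_ xab]; split => //=; rewrite in_itv.
have m1 : measurable_fun setT (fst : T' -> measurableTypeR R).
  apply: (measurability (@measurable_realfun.RGenOpens.G R) (measurable_realfun.RGenOpens.measurableE R)).
  move=> _ [_ [a [b ->] <-]]; rewrite setTI.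
  by have := strip1 a b; congr (<<s _ >> _); apply/seteqP; split => -[x y] //= [].
have m2 : measurable_fun setT (snd : T' -> measurableTypeR R).
  apply: (measurability (@measurable_realfun.RGenOpens.G R) (measurable_realfun.RGenOpens.measurableE R)).
  move=> _ [_ [a [b ->] <-]]; rewrite setTI.
  by have := strip2 a b; congr (<<s _ >> _); apply/seteqP; split => -[x y] //= [].
move=> _ [A mA [B mB <-]].
have H1 := m1 measurableT _ mA; have H2 := m2 measurableT _ mB.
have := measurableI _ _ H1 H2; rewrite !setTI.
by congr (<<s _ >> _); apply/seteqP; split => -[x y].
Qed.

(** Null lines make the indicator of a box continuous almost everywhere. *)
Lemma leb2_vline (a : R) : mu [set x | x.1 = a] = 0%E /\ measurable ([set x | x.1 = a] : set (plane R)).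
Proof.
have -> : [set x : plane R | x.1 = a] = [set a] `*` setT.
  by apply/seteqP; split => -[x y] //= [].
split; last exact: measurableX.
rewrite [LHS](_ : _ = (@lebesgue_measure R [set a] * @lebesgue_measure R setT)%E).
  by rewrite lebesgue_measure_set1 mul0e.
exact: product_measure1E.
Qed.

Lemma leb2_hline (a : R) : mu [set x | x.2 = a] = 0%E /\ measurable ([set x | x.2 = a] : set (plane R)).
Proof.
have -> : [set x : plane R | x.2 = a] = setT `*` [set a].
  by apply/seteqP; split => -[x y] //= [].
split; last exact: measurableX.
rewrite [LHS](_ : _ = (@lebesgue_measure R setT * @lebesgue_measure R [set a])%E).
  by rewrite lebesgue_measure_set1 mule0.
exact: product_measure1E.
Qed.

End boxes.

(** * Discs and radial functions *)

Section radial.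
Context {R : realType}.
Local Notation mu := (leb2 R).
Implicit Types (P x y v : R * R) (D K : set (R * R)) (f g : R * R -> R).

(** The squared distance to P in units of r^2. The square makes it a polynomial, smooth also at
    P. *)
Definition rad P (r : R) x : R := ((x.1 - P.1) ^+ 2 + (x.2 - P.2) ^+ 2) / r ^+ 2.

Definition disc P r : set (R * R) := [set x | rad P r x <= 1].

Lemma rad_ge0 P r x : 0 <= rad P r x.
Proof. by rewrite divr_ge0 ?sqr_ge0// addr_ge0 ?sqr_ge0. Qed.

Lemma rad_smooth P r : smooth (rad P r).
Proof.
apply: smoothM; last exact: smooth_cst.
by apply: smoothD; under eq_fun do rewrite expr2; apply: smoothM; apply: smoothB;
  (exact: smooth_fst || exact: smooth_snd || exact: smooth_cst).
Qed.

Lemma is_derive_rad P r x v :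
  is_derive x v (rad P r) (2 * ((x.1 - P.1) * v.1 + (x.2 - P.2) * v.2) / r ^+ 2).
Proof.
have d1 : is_derive x v (fun y : R * R => y.1 - P.1) (v.1 - 0).
  exact: (is_deriveBf (is_derive_fst x v) (is_derive_cst P.1 x v)).
have d2 : is_derive x v (fun y : R * R => y.2 - P.2) (v.2 - 0).
  exact: (is_deriveBf (is_derive_snd x v) (is_derive_cst P.2 x v)).
have := is_deriveMf (is_deriveDf (is_deriveMf d1 d1) (is_deriveMf d2 d2)) (is_derive_cst ((r ^+ 2)^-1) x v).
rewrite !subr0 mulr0 addr0 => H.
have -> : rad P r = (fun y => ((y.1 - P.1) * (y.1 - P.1) + (y.2 - P.2) * (y.2 - P.2)) * (r ^+ 2)^-1).
  by apply/funext => y; rewrite /rad !expr2.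
by apply: is_derive_eq H _ => /=; ring.
Qed.

Lemma disc_box P r x : 0 < r -> disc P r x -> `|x.1 - P.1| <= r /\ `|x.2 - P.2| <= r.
Proof.
move=> r0; rewrite /disc /= /rad ler_pdivrMr ?exprn_gt0// mul1r => H.
have [s1 s2] := (sqr_ge0 (x.1 - P.1), sqr_ge0 (x.2 - P.2)).
by split; rewrite -(@ler_pXn2r _ 2)// ?nnegrE// ?(ltW r0)// real_normK ?num_real//; lra.
Qed.

Lemma disc_closed P r : closed (disc P r).
Proof.
apply: (@closed_comp _ _ (rad P r) [set t | t <= 1]) => [y _|]; last exact: closed_le.
exact: (smooth_cont (rad_smooth P r)).
Qed.

Lemma disc_compact P r : 0 < r -> compact (disc P r).
Proof.
move=> r0.
apply: (@subclosed_compact _ _ (`[P.1 - r, P.1 + r]%classic `*` `[P.2 - r, P.2 + r]%classic)).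
- exact: disc_closed.
- by apply: compact_setX; exact: segment_compact.
- move=> x /(disc_box r0)[]; rewrite !ler_norml => /andP[? ?] /andP[? ?].
  by split; rewrite /= in_itv /=; apply/andP; split; lra.
Qed.

Lemma disc_meas P r : measurable (disc P r : set (plane R)).
Proof. by apply: closed_plane_measurable; exact: disc_closed. Qed.

(** The disc lies in a box of side 4 r. The crude 16 in place of pi is carried into the later
    constants. *)
Lemma disc_leb P r : 0 < r -> (mu (disc P r) <= (16 * r ^+ 2)%:E)%E.
Proof.
move=> r0; pose Q := obox (P.1 - 2 * r, P.2 - 2 * r) (P.1 + 2 * r, P.2 + 2 * r).
have QE : mu Q = (16 * r ^+ 2)%:E by rewrite leb2_obox /=; [congr EFin; ring|lra|lra].
rewrite -QE; apply: le_measure; rewrite ?inE; [exact: disc_meas|exact: measurable_obox|].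
move=> x /(disc_box r0)[]; rewrite !ler_norml /Q oboxE /= => /andP[? ?] /andP[? ?].
by split; apply/andP; split; lra.
Qed.

Lemma test_radial D P r (E : R -> R) (I : set R) : 0 < r -> disc P r `<=` D ->
  (forall s, 0 <= s -> I s) -> (forall k, Ck1 I k E) -> (forall s, 1 < s -> E s = 0) ->
  test_function D (fun x => E (rad P r x)).
Proof.
move=> r0 dD I0 cE E0; split.
  by apply: smooth_comp cE (rad_smooth P r) => x; apply: I0; exact: rad_ge0.
exists (disc P r); split => //; first exact: disc_compact.
by move=> x /negP; rewrite -ltNge => /E0.
Qed.

End radial.

(** * Mollification *)

Section mollifier.
Context {R : realType}.
Local Notation mu := (leb2 R).
Implicit Types (x y v : R * R) (D K : set (R * R)) (f g : R * R -> R).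

Lemma flat0_mono (s t : R) : s <= t -> flat 0 s <= flat 0 t.
Proof.
move=> st; have [s0|s0] := leP s 0; first by rewrite flat_neg// flat_ge0.
have t0 : 0 < t by exact: lt_le_trans st.
by rewrite !flat_pos// !expr0 !invr1 !mul1r ler_expR lerN2 lef_pV2.
Qed.

Lemma flat_gt0 k (t : R) : 0 < t -> 0 < flat k t.
Proof. by move=> t0; rewrite flat_pos// mulr_gt0 ?expR_gt0// invr_gt0 exprn_gt0. Qed.

Definition bump0 (r : R) x : R := flat 0 (1 - rad 0 r x).

Lemma flat_1sub_Ck1 k m : Ck1 setT m (fun s : R => flat k (1 - s)).
Proof.
have d j (t : R) : is_derive t (1 : R) (fun s : R => flat j (1 - s))
    (j%:R * flat j.+1 (1 - t) - flat j.+2 (1 - t)).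
  have D1 : is_derive t (1 : R) (fun s : R => 1 - s) (0 - 1).
    exact: (@is_deriveB R R R (cst (1 : R)) (@id R) t 1 0 1 (is_derive_cst _ _ _) (is_derive_id _ _)).
  have := @is_derive1_comp R (flat j) (fun s => 1 - s) t _ _ (is_derive_flat j (1 - t)) D1.
  by rewrite sub0r mulrN1 opprB.
have c j (t : R) : {for t, continuous (fun s : R => flat j (1 - s))}.
  by apply/differentiable_continuous/derivable1_diffP; case: (d j t).
elim: m k => [|m IH] k; first by split => // t _; exact: c.
split; first by move=> t _; exact: c.
exists (fun t => k%:R * flat k.+1 (1 - t) - flat k.+2 (1 - t)); split; first by move=> t _; exact: d.
by apply: Ck1B => //; apply: Ck1M => //; exact: Ck1_cst.
Qed.

Lemma bump0_test r : 0 < r -> test_function setT (bump0 r).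
Proof.
move=> r0; apply: (@test_radial _ setT 0 r (fun s => flat 0 (1 - s)) setT) => //.
- by move=> k; exact: flat_1sub_Ck1.
- by move=> s s1; rewrite flat_neg// subr_le0 ltW.
Qed.

Lemma bump0_ge0 r x : 0 <= bump0 r x. Proof. exact: flat_ge0. Qed.

Lemma bump0_int r : 0 < r -> 0 < \int[mu]_x bump0 r x.
Proof.
(* On this cube [rad 0 r] is at most 1/2, so the bump is at least [flat 0 2^-1]. *)
move=> r0; pose Q := cube (r / 2).
have mQ : measurable (Q : set (plane R)) by exact: cube_meas.
have r2 : 0 < r / 2 by rewrite divr_gt0.
apply: (@lt_le_trans _ _ (\int[mu]_x (flat 0 (2^-1) * \1_Q x))).
  rewrite intZ; last by apply: integ_indic => //; exact: leb2_cube_lty.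
  rewrite int_indic// /Q /cube leb2_obox /=; [|lra|lra].
  apply: mulr_gt0; first by apply: flat_gt0; rewrite invr_gt0.
  by apply: mulr_gt0; lra.
apply: int_le.
- by apply: integZ; apply: integ_indic => //; exact: leb2_cube_lty.
- exact: test_integ (bump0_test r0).
- move=> x; rewrite indicE; have [xQ|xQ] := boolP (x \in Q) => /=; last by rewrite mulr0 flat_ge0.
  rewrite mulr1; apply: flat0_mono.
  move: xQ; rewrite inE /Q /cube oboxE /= -!ltr_norml => -[x1 x2].
  have s1 : x.1 ^+ 2 <= (r / 2) ^+ 2 by rewrite -[leLHS]real_normK ?num_real// lerXn2r ?nnegrE// ltW.
  have s2 : x.2 ^+ 2 <= (r / 2) ^+ 2 by rewrite -[leLHS]real_normK ?num_real// lerXn2r ?nnegrE// ltW.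
  rewrite lerBrDr -lerBrDl /rad !subr0 ler_pdivrMr ?exprn_gt0//.
  rewrite (le_trans (lerD s1 s2))//.
  by rewrite (_ : 1 - 2^-1 = 2^-1); [rewrite expr_div_n; lra|lra].
Qed.

Definition moll (r : R) x : R := (\int[mu]_y bump0 r y)^-1 * bump0 r x.

Lemma moll_test r : 0 < r -> test_function setT (moll r).
Proof. by move=> r0; apply: testMl; [exact: smooth_cst|exact: bump0_test]. Qed.

Lemma moll_ge0 r x : 0 < r -> 0 <= moll r x.
Proof. by move=> r0; rewrite mulr_ge0 ?bump0_ge0// invr_ge0 ltW// bump0_int. Qed.

Lemma moll_even r x : moll r (- x) = moll r x.
Proof. by rewrite /moll /bump0 /rad /= !subr0 !sqrrN. Qed.

Lemma moll_int r : 0 < r -> \int[mu]_x moll r x = 1.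
Proof.
move=> r0; rewrite intZ ?mulVf//; first by rewrite gt_eqF// bump0_int.
exact: test_integ (bump0_test r0).
Qed.

Lemma moll_supp r x : 0 < r -> r <= `|x.1| \/ r <= `|x.2| -> moll r x = 0.
Proof.
move=> r0 H; rewrite /moll /bump0 flat_neg ?mulr0//.
rewrite subr_le0 /rad !subr0 ler_pdivlMr ?exprn_gt0// mul1r.
have [s1 s2] := (sqr_ge0 x.1, sqr_ge0 x.2).
case: H => H.
  have : r ^+ 2 <= x.1 ^+ 2 by rewrite -[leRHS]real_normK ?num_real// lerXn2r ?nnegrE// ltW.
  lra.
have : r ^+ 2 <= x.2 ^+ 2 by rewrite -[leRHS]real_normK ?num_real// lerXn2r ?nnegrE// ltW.
lra.
Qed.

Lemma moll_shift_int r y : 0 < r ->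
  integ mu (fun x => moll r (x - y)) /\ \int[mu]_x moll r (x - y) = 1.
Proof.
move=> r0; have [i1 i2] := int_shift (- y) (test_integ (moll_test r0)).
by split; [exact: i1|rewrite i2; exact: moll_int].
Qed.

Definition conv r f x : R := \int[mu]_y (moll r (x - y) * f y).

Let mid1 : rmeas (fun t : plane R => (id t).1). Proof. exact: measurable_fst. Qed.
Let mid2 : rmeas (fun t : plane R => (id t).2). Proof. exact: measurable_snd. Qed.

Lemma conv_smooth r f : 0 < r -> integ mu f -> smooth (conv r f).
Proof. by move=> r0 fi; exact: (superpos_smooth mid1 mid2 fi (moll_test r0)). Qed.

Lemma conv_meas r f : 0 < r -> integ mu f -> rmeas (conv r f : plane R -> R).
Proof. by move=> r0 fi; apply: smooth_meas; exact: conv_smooth. Qed.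

Lemma conv_derive r f v x : 0 < r -> integ mu f -> basis_vec v ->
  is_derive x v (conv r f) (\int[mu]_y ('D_v (moll r) (x - y) * f y)).
Proof. by move=> r0 fi bv; exact: (superpos_derive mid1 mid2 fi x bv (moll_test r0)). Qed.

Lemma moll_meas2 r x : 0 < r -> rmeas (fun y : plane R => moll r (x - y)).
Proof.
move=> r0; apply: (superpos_meas mid1 mid2 x).
by apply: smooth_cont; exact: test_smooth (moll_test r0).
Qed.

Lemma conv_integ_bounded r f x (C : R) : 0 < r -> rmeas (f : plane R -> R) ->
  (forall y, `|f y| <= C) -> integ mu (fun y => moll r (x - y) * f y).
Proof.
move=> r0 mf fC.
have [i1 _] := moll_shift_int x r0.
have := @integM_bounded _ (plane R) R mu _ f C mf fC i1.
congr integ; apply/funext => y; rewrite mulrC; congr (_ * _).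
by rewrite -moll_even opprB.
Qed.

Lemma moll_int2 r x : 0 < r -> \int[mu]_y moll r (x - y) = 1.
Proof.
move=> r0; have [_ <-] := moll_shift_int x r0.
by apply: eq_int => y; rewrite -moll_even opprB.
Qed.

Lemma moll_integ2 r x : 0 < r -> integ mu (fun y => moll r (x - y)).
Proof.
move=> r0; have [+ _] := moll_shift_int x r0.
by congr integ; apply/funext => y; rewrite -moll_even opprB.
Qed.

Lemma conv_bounded r f x (C : R) : 0 < r -> rmeas (f : plane R -> R) ->
  (forall y, `|f y| <= C) -> `|conv r f x| <= C.
Proof.
move=> r0 mf fC; have C0 : 0 <= C by rewrite (le_trans _ (fC x)).
have ii := conv_integ_bounded x r0 mf fC.
rewrite (le_trans (int_norm_le ii))//.
rewrite -[leRHS]mulr1 -(moll_int2 x r0) -intZ; last exact: moll_integ2.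
apply: int_le.
- exact: integ_norm.
- by apply: integZ; exact: moll_integ2.
- by move=> y; rewrite normrM ger0_norm ?moll_ge0// mulrC ler_wpM2r// moll_ge0.
Qed.

Lemma conv_near r f x (C e : R) : 0 < r -> rmeas (f : plane R -> R) ->
  (forall y, `|f y| <= C) -> 0 <= e ->
  (forall y, `|x.1 - y.1| < r -> `|x.2 - y.2| < r -> `|f y - f x| <= e) ->
  `|conv r f x - f x| <= e.
Proof.
move=> r0 mf fC e0 He.
have ii := conv_integ_bounded x r0 mf fC.
have im := moll_integ2 x r0.
have -> : f x = \int[mu]_y (f x * moll r (x - y)) by rewrite intZ// moll_int2// mulr1.
rewrite -intB//; last exact: integZ.
have E : (fun y => moll r (x - y) * f y - f x * moll r (x - y)) = (fun y => moll r (x - y) * (f y - f x)).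
  by apply/funext => y; ring.
have iE : integ mu (fun y => moll r (x - y) * (f y - f x)).
  by rewrite -E; apply: integB => //; exact: integZ.
rewrite (_ : \int[mu]_y _ = \int[mu]_y (moll r (x - y) * (f y - f x))); last by rewrite -E.
rewrite (le_trans (int_norm_le iE))//.
rewrite -[leRHS]mulr1 -(moll_int2 x r0) -intZ//.
apply: int_le; [exact: integ_norm|exact: integZ|].
move=> y; rewrite normrM ger0_norm ?moll_ge0// mulrC.
have [y1|y1] := ltP `|x.1 - y.1| r; last by rewrite moll_supp ?mulr0//; left.
have [y2|y2] := ltP `|x.2 - y.2| r; last by rewrite moll_supp ?mulr0//; right.
by rewrite ler_wpM2r ?moll_ge0// He.
Qed.

Lemma conv_cvg (r_ : nat -> R) f x (C : R) : (forall n, 0 < r_ n) ->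
  r_ n @[n --> \oo] --> (0 : R) -> rmeas (f : plane R -> R) ->
  (forall y, `|f y| <= C) -> {for x, continuous f} ->
  conv (r_ n) f x @[n --> \oo] --> f x.
Proof.
move=> r0 rc mf fC cf; apply/cvgrPdist_le => e e0.
have /nbhs_ballP[d /= d0 Hd] : nbhs (x : R * R) [set y | `|f y - f x| <= e].
  by move/cvgrPdist_le : cf => /(_ _ e0); apply: filterS => y /=; rewrite distrC.
near=> n; rewrite distrC; apply: (@conv_near _ _ _ C) => //; first exact: ltW.
have rd : r_ n < d.
  near: n; apply: (cvgr_lt (0 : R)) => //.
move=> y y1 y2; apply: Hd; split; rewrite /ball /=; exact: lt_trans rd.
Unshelve. all: by end_near. Qed.

End mollifier.

(** * Self-adjointness of mollification *)

Section fubini_conv.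
Context {R : realType}.
Local Notation mu := (leb2 R).
Implicit Types (x y v : R * R) (D K : set (R * R)) (f g F d : R * R -> R).

(* The product measure [leb2] packaged as a sigma-finite measure, as required by
   the Fubini theorems. *)
Definition leb2s (A : set (plane R)) : \bar R := mu A.
Let leb2s0 : leb2s set0 = 0%E. Proof. exact: measure0. Qed.
Let leb2s_ge0 A : (0 <= leb2s A)%E. Proof. exact: measure_ge0. Qed.
Let leb2s_additive : semi_sigma_additive leb2s.
Proof. exact: (@measure_semi_sigma_additive _ _ _ mu). Qed.
HB.instance Definition _ := isMeasure.Build _ _ _ leb2s leb2s0 leb2s_ge0 leb2s_additive.
Let leb2s_sigma_finite : sigma_finite setT leb2s.
Proof.
exists (fun n => cube (n.+1%:R : R)); first exact: cube_bigcup.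
by move=> n; split; [exact: measurable_obox|exact: leb2_cube_lty].
Qed.
HB.instance Definition _ := Measure_isSigmaFinite.Build _ _ _ leb2s leb2s_sigma_finite.

(** Fubini for F(x) moll(x - y) d(y), integrable because integrating |.| in x leaves at most C
    |d(y)|; the two sides match since the mollifier is even. It moves the mollification from an
    integrable function to a bounded one, where pointwise convergence is at hand. *)
Lemma conv_adj r F d (C : R) : 0 < r -> rmeas (F : plane R -> R) ->
  (forall x, `|F x| <= C) -> integ mu d ->
  integ mu (fun x => F x * conv r d x) /\
  \int[mu]_x (F x * conv r d x) = \int[mu]_x (conv r F x * d x).
Proof.
move=> r0 mF FC di.
have md := integ_meas di.
have C0 : 0 <= C by rewrite (le_trans _ (FC 0)).
pose h (z : plane R * plane R) : R := F z.1 * (moll r ((z.1 : R * R) - z.2) * d z.2).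
have mm : rmeas (fun z : plane R * plane R => moll r ((z.1 : R * R) - z.2)).
  have mg : measurable_fun setT (moll r : plane R -> measurableTypeR R).
    by apply: smooth_meas; exact: test_smooth (moll_test r0).
  have ms : measurable_fun setT ((fun z => (z.1.1 - z.2.1, z.1.2 - z.2.2)) : plane R * plane R -> plane R).
    apply/measurable_fun_pairP; split.
      exact: (rmeasB (measurableT_comp measurable_fst measurable_fst) (measurableT_comp measurable_fst measurable_snd)).
    exact: (rmeasB (measurableT_comp measurable_snd measurable_fst) (measurableT_comp measurable_snd measurable_snd)).
  exact: (measurableT_comp mg ms).
have mh : rmeas h.
  apply: rmeasM; first exact: (measurableT_comp mF measurable_fst).
  apply: rmeasM => //; exact: (measurableT_comp md measurable_snd).
have mhE : measurable_fun setT (EFin \o h) by exact/measurable_EFinP.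
have dn := integ_norm di.
have iy y : integ mu (fun x => h (x, y)) /\ \int[mu]_x `|h (x, y)| <= C * `|d y|.
  have [i1 i2] := moll_shift_int y r0.
  have j1 : integ mu (fun x => moll r (x - y) * d y).
    by have := integZ (d y) i1; congr integ; apply/funext => x; rewrite mulrC.
  have j2 := @integM_bounded _ (plane R) R mu _ F C mF FC j1; split => //.
  have E : C * `|d y| = \int[mu]_x (C * `|d y| * moll r (x - y)) by rewrite intZ// i2 mulr1.
  rewrite E; apply: int_le; [exact: integ_norm|exact: integZ|].
  move=> x; have m0 := moll_ge0 (x - y) r0.
  rewrite /h normrM normrM /= [X in _ * (X * _)]ger0_norm; last exact: m0.
  rewrite -[leRHS]mulrA [`|d y| * _]mulrC.
  by apply: ler_wpM2r; rewrite ?FC// mulr_ge0.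
have ih : (leb2s \x leb2s)%E.-integrable setT (EFin \o h).
  apply/(integrable21ltyP _ _ mhE).
  apply: (@le_lt_trans _ _ (\int[mu]_y (C * `|d y|)%:E)%E); last first.
    have /integrableP[_] := integZ C dn.
    apply: le_lt_trans; rewrite le_eqVlt; apply/orP; left; apply/eqP.
    by apply: eq_integral => y _; rewrite gee0_abs// lee_fin mulr_ge0.
  apply: ge0_le_integral => //.
  - by move=> y _; apply: integral_ge0.
  - have mha : measurable_fun setT (abse \o (EFin \o h)) by exact: measurableT_comp.
    have ha0 z : (0 <= (abse \o (EFin \o h)) z)%E by rewrite /= lee_fin.
    exact: (measurable_fun_fubini_tonelli_G (m1 := leb2s) _ mha ha0).
  - by apply/measurable_EFinP; exact: integ_meas (integZ C dn).
  - move=> y _; have [i1 i2] := iy y.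
    have fin : (\int[mu]_x `|(h (x, y))%:E|)%E \is a fin_num.
      have /integrableP[_] := i1; rewrite ge0_fin_numE//; exact: integral_ge0.
    by rewrite -(fineK fin) lee_fin; exact: i2.
have iin x : integ mu (fun y => moll r (x - y) * d y).
  have [M M0 HM] := test_bounded (moll_test r0).
  exact: (@integM_bounded _ (plane R) R mu _ _ M (moll_meas2 x r0) _ di).
have EF : fubini_F leb2s (EFin \o h) = EFin \o (fun x => F x * conv r d x).
  apply/funext => x; rewrite /fubini_F /= /h /=.
  rewrite -[LHS]fineK; last exact: (integrable_fin_num measurableT (integZ (F x) (iin x))).
  by congr EFin; exact: (intZ (F x) (iin x)).
have EG : fubini_G leb2s (EFin \o h) = EFin \o (fun y => conv r F y * d y).
  apply/funext => y; rewrite /fubini_G /= /h /=.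
  have jj := conv_integ_bounded y r0 mF FC.
  have := integZ (d y) jj.
  have -> : (fun x => d y * (moll r (y - x) * F x)) = (fun x => F x * (moll r (x - y) * d y)).
    by apply/funext => x; rewrite -[x - y]opprB moll_even; ring.
  move=> kk; rewrite -[LHS]fineK; last exact: (integrable_fin_num measurableT kk).
  congr EFin; rewrite mulrC -intZ//; apply: eq_int => x.
  by rewrite -[x - y]opprB moll_even; ring.
split.
  have := integrable_fubini_F ih; rewrite EF; exact.
have := integral12_prod_meas1 ih; rewrite EF => H1.
have := integral21_prod_meas1 ih; rewrite EG => H2.
by rewrite /Rintegral; congr fine; rewrite [LHS]H1 -H2.
Qed.

End fubini_conv.

Section young.
Context d (T : measurableType d) (R : realType) (mu : {measure set T -> \bar R}).

Lemma young_int (f g : T -> R) (l : R) : 0 < l -> sqi mu f -> sqi mu g ->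
  `|\int[mu]_x (f x * g x)| <= l * \int[mu]_x (f x ^+ 2) + l^-1 * \int[mu]_x (g x ^+ 2).
Proof.
move=> l0 sf sg; have [fi gi] := (sqi_sq sf, sqi_sq sg).
have fg := sqi_mul sf sg.
rewrite (le_trans (int_norm_le fg))// -!intZ// -intD; [|exact: integZ..].
apply: int_le; [exact: integ_norm|by apply: integD; exact: integZ|].
move=> x; have i0 : 0 < l^-1 by rewrite invr_gt0.
have H : 0 <= l * (`|f x| - l^-1 * `|g x|) ^+ 2 by rewrite mulr_ge0 ?sqr_ge0// ltW.
have E : l * (`|f x| - l^-1 * `|g x|) ^+ 2 = l * `|f x| ^+ 2 + l^-1 * `|g x| ^+ 2 - 2 * (`|f x| * `|g x|).
  have ll : l * l^-1 = 1 by rewrite mulfV// gt_eqF.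
  transitivity (l * `|f x| ^+ 2 + (l * l^-1) * l^-1 * `|g x| ^+ 2 - 2 * (l * l^-1) * (`|f x| * `|g x|)); first by ring.
  by rewrite ll !mul1r mulr1.
rewrite normrM; rewrite E !real_normK ?num_real// in H.
have : 0 <= `|f x| * `|g x| by rewrite mulr_ge0.
lra.
Qed.

Lemma ae_imp (P Q : T -> Prop) : {ae mu, forall x, P x} -> (forall x, P x -> Q x) ->
  {ae mu, forall x, Q x}.
Proof. by move=> aeP PQ; apply: filterS aeP. Qed.

Lemma ae_and (P Q : T -> Prop) : {ae mu, forall x, P x} -> {ae mu, forall x, Q x} ->
  {ae mu, forall x, P x /\ Q x}.
Proof. by move=> aeP aeQ; apply: filterS2 aeP aeQ. Qed.

End young.

Lemma quarters_le (F : realFieldType) (e : F) : 0 <= e -> e / 4 + (e / 4 + e / 4) <= e.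
Proof. by move=> e0; lra. Qed.

Lemma thirds_le (F : realFieldType) (e : F) : e / 3 + (e / 3 + e / 3) <= e.
Proof. by lra. Qed.

(** * Weak convergence of mollifications *)

Section weak_convergence.
Context {R : realType}.
Local Notation mu := (leb2 R).
Implicit Types (x y v : R * R) (D K : set (R * R)) (f g F d : R * R -> R).

Lemma conv_cst1 r x : 0 < r -> conv r (fun=> 1) x = 1.
Proof.
by move=> r0; rewrite /conv -[RHS](moll_int2 x r0); apply: eq_int => y; rewrite mulr1.
Qed.

Lemma conv_int r d : 0 < r -> integ mu d ->
  integ mu (conv r d) /\ \int[mu]_x conv r d x = \int[mu]_x d x.
Proof.
move=> r0 di.
have one1 (x : R * R) : `|(fun=> 1 : R) x| <= 1 by rewrite normr1.
have [H1 H2] := @conv_adj R r (fun=> 1) d 1 r0 (rmeas_cst 1) one1 di.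
split; first by move: H1; congr integ; apply/funext => x; rewrite mul1r.
transitivity (\int[mu]_x (1 * conv r d x)); first by apply: eq_int => x; rewrite mul1r.
by rewrite H2; apply: eq_int => x; rewrite conv_cst1// mul1r.
Qed.

Lemma conv_integ r d x : 0 < r -> integ mu d -> integ mu (fun y => moll r (x - y) * d y).
Proof.
move=> r0 di; have [M M0 HM] := test_bounded (moll_test r0).
exact: (@integM_bounded _ (plane R) R mu _ _ M (moll_meas2 x r0) _ di).
Qed.

Lemma convB r f g x : 0 < r -> integ mu f -> integ mu g ->
  conv r (fun y => f y - g y) x = conv r f x - conv r g x.
Proof.
move=> r0 fi gi; rewrite /conv -intB; [|exact: conv_integ..].
by apply: eq_int => y; rewrite mulrBr.
Qed.

Lemma conv_norm r d x : 0 < r -> integ mu d -> `|conv r d x| <= conv r (fun y => `|d y|) x.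
Proof.
move=> r0 di; have ii := conv_integ x r0 di.
rewrite (le_trans (int_norm_le ii))//; apply: int_le.
- exact: integ_norm.
- by apply: conv_integ => //; exact: integ_norm.
- by move=> y; rewrite normrM ger0_norm ?moll_ge0.
Qed.

Lemma conv_L1 r d : 0 < r -> integ mu d ->
  \int[mu]_x `|conv r d x| <= \int[mu]_x `|d x|.
Proof.
move=> r0 di; have [i1 i2] := conv_int r0 (integ_norm di).
have [j1 j2] := conv_int r0 di.
rewrite -i2; apply: int_le => //; first exact: integ_norm.
by move=> x; exact: conv_norm.
Qed.

(** The variance of d under the probability density moll(x - .) is nonnegative. *)
Lemma conv_jensen r d x : 0 < r -> integ mu d -> sqi mu d ->
  conv r d x ^+ 2 <= conv r (fun y => d y ^+ 2) x.
Proof.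
move=> r0 di sd; set m := conv r d x.
have i2 := conv_integ x r0 (sqi_sq sd).
have i1 := conv_integ x r0 di.
have i0 := moll_integ2 x r0.
have E : \int[mu]_y (moll r (x - y) * (d y - m) ^+ 2) =
   conv r (fun y => d y ^+ 2) x - 2 * m * conv r d x + m ^+ 2.
  have e1 : m ^+ 2 = \int[mu]_y (m ^+ 2 * moll r (x - y)) by rewrite intZ// moll_int2// mulr1.
  rewrite [X in _ = _ + X]e1 /conv -intZ// -intB//; last exact: integZ.
  rewrite -intD; [|by apply: integB => //; exact: integZ|exact: integZ].
  by apply: eq_int => y; ring.
have : 0 <= \int[mu]_y (moll r (x - y) * (d y - m) ^+ 2).
  by apply: int_ge0 => y; rewrite mulr_ge0 ?moll_ge0 ?sqr_ge0.
rewrite E -/m; lra.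
Qed.

Lemma conv_sq r d : 0 < r -> integ mu d -> sqi mu d ->
  sqi mu (conv r d) /\ \int[mu]_x (conv r d x ^+ 2) <= \int[mu]_x (d x ^+ 2).
Proof.
move=> r0 di sd; have [i1 i2] := conv_int r0 (sqi_sq sd).
have J x : `|conv r d x ^+ 2| <= conv r (fun y => d y ^+ 2) x.
  by rewrite ger0_norm ?sqr_ge0//; exact: conv_jensen.
have mc := conv_meas r0 di.
have ic : integ mu (fun x => conv r d x ^+ 2).
  by apply: integ_le i1 J; under eq_fun do rewrite expr2; exact: rmeasM.
split; first by split.
by rewrite -i2; apply: int_le => // x; rewrite (le_trans (ler_norm _) (J x)).
Qed.

Variable r_ : nat -> R.
Hypothesis r0 : forall n, 0 < r_ n.
Hypothesis rc : r_ n @[n --> \oo] --> (0 : R).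

Lemma indic_bound (E : set (R * R)) x : `|\1_E x : R| <= 1.
Proof. by rewrite indicE; case: (x \in E); rewrite ?normr1 ?normr0. Qed.

Lemma indic_cont_in (O : set (R * R)) x : open O -> O x -> {for x, continuous (\1_O : R * R -> R)}.
Proof.
move=> oO Ox; apply/cvgrPdist_le => e e0.
have : nbhs (x : R * R) O by exact: open_nbhs_nbhs.
by apply: filterS => y Oy; rewrite !indicE !mem_set// subrr normr0 ltW.
Qed.

Lemma indic_cont_out (O U : set (R * R)) x : open U -> U x -> U `&` O = set0 ->
  {for x, continuous (\1_O : R * R -> R)}.
Proof.
move=> oU Ux UO; apply/cvgrPdist_le => e e0.
have nO y : U y -> y \in O = false.
  by move=> Uy; apply/negbTE; rewrite notin_setE => Oy; have : (U `&` O) y by []; rewrite UO.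
have : nbhs (x : R * R) U by exact: open_nbhs_nbhs.
by apply: filterS => y Uy; rewrite !indicE !nO// subrr normr0 ltW.
Qed.

Lemma obox_open (a b : R * R) : open (obox a b).
Proof.
rewrite /obox (_ : _ `*` _ = (fst @^-1` `]a.1, b.1[) `&` (snd @^-1` `]a.2, b.2[)); last first.
  by apply/seteqP; split => -[x y].
apply: openI; apply: open_comp; rewrite ?interval_open// => x _; [exact: cvg_fst|exact: cvg_snd].
Qed.

Lemma obox_cont_ae (a b : R * R) :
  {ae mu, forall x, {for x, continuous (\1_(obox a b) : R * R -> R)}}.
Proof.
pose N : set (plane R) := ([set x | x.1 = a.1] `|` [set x | x.1 = b.1]) `|`
  ([set x | x.2 = a.2] `|` [set x | x.2 = b.2]).
have [a1 ma1] := @leb2_vline R a.1; have [b1 mb1] := @leb2_vline R b.1.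
have [a2 ma2] := @leb2_hline R a.2; have [b2 mb2] := @leb2_hline R b.2.
have n0 : mu.-negligible N.
  apply: negligibleU; apply: negligibleU.
  - by apply/negligibleP.
  - by apply/negligibleP.
  - by apply/negligibleP.
  - by apply/negligibleP.
apply: negligibleS n0 => x /= nc; apply: contrapT => nN; apply: nc.
move/not_orP : nN => [/not_orP[n1 n2] /not_orP[n3 n4]].
have [xin|xout] := pselect (obox a b x).
  by apply: indic_cont_in => //; exact: obox_open.
have cfst : continuous (fun y : R * R => y.1) by move=> y; exact: cvg_fst.
have csnd : continuous (fun y : R * R => y.2) by move=> y; exact: cvg_snd.
have oL1 (c : R) : open [set y : R * R | y.1 < c] by move/continuousP : cfst => /(_ [set t | t < c] (@open_lt _ c)).
have oG1 (c : R) : open [set y : R * R | c < y.1] by move/continuousP : cfst => /(_ [set t | c < t] (@open_gt _ c)).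
have oL2 (c : R) : open [set y : R * R | y.2 < c] by move/continuousP : csnd => /(_ [set t | t < c] (@open_lt _ c)).
have oG2 (c : R) : open [set y : R * R | c < y.2] by move/continuousP : csnd => /(_ [set t | c < t] (@open_gt _ c)).
have [h1|h1] := ltP x.1 a.1.
  apply: (indic_cont_out (oL1 a.1)) => //; rewrite -subset0 => y [] /= ?; rewrite oboxE; lra.
have [h2|h2] := ltP b.1 x.1.
  apply: (indic_cont_out (oG1 b.1)) => //; rewrite -subset0 => y [] /= ?; rewrite oboxE; lra.
have [h3|h3] := ltP x.2 a.2.
  apply: (indic_cont_out (oL2 a.2)) => //; rewrite -subset0 => y [] /= ?; rewrite oboxE; lra.
have [h4|h4] := ltP b.2 x.2.
  apply: (indic_cont_out (oG2 b.2)) => //; rewrite -subset0 => y [] /= ?; rewrite oboxE; lra.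
exfalso; apply: xout; rewrite oboxE !lt_neqAle h1 h2 h3 h4 !andbT.
by split; apply/andP; split; apply/eqP => // e; [exact: n1|exact: n3].
Qed.

Lemma leb2_obox_lty (a b : R * R) : (mu (obox a b) < +oo)%E.
Proof.
have [[h1 h2]|h] := pselect (a.1 <= b.1 /\ a.2 <= b.2); first by rewrite leb2_obox ?ltry.
rewrite (_ : obox a b = set0) ?measure0// -subset0 => x.
rewrite oboxE => -[/andP[? ?] /andP[? ?]]; apply: h; split; lra.
Qed.

(** By [conv_adj] the mollification acts on the indicator of the box, where it converges at every
    point of continuity, hence almost everywhere, with |d| as a dominating function. *)
Lemma conv_box (a b : R * R) d : integ mu d ->
  \int[mu]_x (\1_(obox a b) x * conv (r_ n) d x) @[n --> \oo] --> \int[mu]_x (\1_(obox a b) x * d x).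
Proof.
move=> di.
have mB : rmeas (\1_(obox a b) : plane R -> R) by apply: rmeas_indic; exact: measurable_obox.
have bB := indic_bound (obox a b).
have -> : (fun n => \int[mu]_x (\1_(obox a b) x * conv (r_ n) d x)) =
   (fun n => \int[mu]_x (conv (r_ n) (\1_(obox a b)) x * d x)).
  by apply/funext => n; have [_ ->] := conv_adj (r0 n) mB bB di.
have md := integ_meas di.
apply: (@int_cvg _ (plane R) R mu _ _ (fun x => `|d x|)).
- move=> n; apply: rmeasM => //.
  by apply: conv_meas => //; apply: integ_indic; [exact: measurable_obox|exact: leb2_obox_lty].
- exact: rmeasM.
- apply: (ae_imp (obox_cont_ae a b)) => x cx.
  by apply: cvgM; [exact: conv_cvg cx|exact: cvg_cst].
- exact: integ_norm.
- by move=> n x; rewrite normrM ler_piMl// conv_bounded.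
Qed.

Lemma indicI (A B : set (R * R)) x : \1_(A `&` B) x = \1_A x * \1_B x :> R.
Proof. by rewrite !indicE in_setI -natrM mulnb. Qed.

Lemma indicT A x : A x -> \1_A x = 1 :> R.
Proof. by move=> Ax; rewrite indicE mem_set. Qed.

Lemma indicF A x : ~ A x -> \1_A x = 0 :> R.
Proof. by move=> Ax; rewrite indicE memNset. Qed.

Lemma integ_restr E f : measurable (E : set (plane R)) -> integ mu f -> integ mu (fun x => \1_E x * f x).
Proof.
move=> mE fi; apply: (@integM_bounded _ (plane R) R mu _ _ 1) => //; first exact: rmeas_indic.
exact: indic_bound.
Qed.

(** Convergence of the mollifications of d tested against a fixed G. This weak form is enough for
    all limits of derivatives taken below. *)
Definition wcvg d G := \int[mu]_x (G x * conv (r_ n) d x) @[n --> \oo] --> \int[mu]_x (G x * d x).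

(** The mollifications of d are bounded in L^2 by d itself, so the admissible G form a closed subset
    of L^2. *)
Lemma wcvg_approx d G : integ mu d -> sqi mu d -> sqi mu G ->
  (forall eta : R, 0 < eta -> exists2 G', sqi mu G' /\ wcvg d G' &
     \int[mu]_x ((G x - G' x) ^+ 2) <= eta) ->
  wcvg d G.
Proof.
move=> di sd sG H; set A := \int[mu]_x (d x ^+ 2).
have A0 : 0 <= A by apply: int_ge0 => x; exact: sqr_ge0.
apply/cvgrPdist_le => e e0.
(* The weight in Young's inequality: it makes the term in A at most e/8, and G is then approximated
   within e/8/l so that the other term obeys the same bound. *)
pose l := 8 * (A + 1) / e.
have A1 : 0 < A + 1 by rewrite ltr_wpDl.
have l0 : 0 < l by rewrite divr_gt0// mulr_gt0.
have lA : l^-1 * A <= e / 8.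
  have lE : e / 8 * l = A + 1 by rewrite /l; field; rewrite gt_eqF.
  by rewrite mulrC ler_pdivrMr// lE lerDl.
have [|G' [sG' wG'] HG'] := H (e / 8 / l); first by apply: divr_gt0 => //; exact: divr_gt0.
have sD := sqiB sG sG'.
have small k : integ mu k -> sqi mu k -> \int[mu]_x (k x ^+ 2) <= A ->
    `|\int[mu]_x (G x * k x) - \int[mu]_x (G' x * k x)| <= e / 4.
  move=> ki sk kA; rewrite -intB; [|exact: sqi_mul..].
  rewrite (_ : \int[mu]_x _ = \int[mu]_x ((G x - G' x) * k x)); last first.
    by apply: eq_int => x; rewrite mulrBl.
  have Y := young_int l0 sD sk; rewrite (le_trans Y)//.
  have h1 : l * \int[mu]_x ((G x - G' x) ^+ 2) <= e / 8.
    by rewrite mulrC -ler_pdivlMr.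
  have h2 : l^-1 * \int[mu]_x (k x ^+ 2) <= e / 8.
    by rewrite (le_trans _ lA)// ler_wpM2l// invr_ge0 ltW.
  lra.
move/cvgrPdist_le : wG' => /(_ (e / 4)) wG'; have e4 : 0 < e / 4 by rewrite divr_gt0.
near=> n.
have W : `|\int[mu]_x (G' x * d x) - \int[mu]_x (G' x * conv (r_ n) d x)| <= e / 4.
  by near: n; exact: wG'.
have [ci _] := conv_int (r0 n) di; have [csq cA] := conv_sq (r0 n) di sd.
have S1 := small d di sd (lexx A).
have S2 := small _ ci csq cA.
rewrite (le_trans (ler_distD (\int[mu]_x (G' x * d x)) _ _))//.
rewrite distrC in S2.
have H3 := le_trans (ler_distD (\int[mu]_x (G' x * conv (r_ n) d x)) _ _) (lerD W S2).
by rewrite (le_trans (lerD S1 H3))// quarters_le// ltW.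
Unshelve. all: by end_near. Qed.

Lemma wcvg_sum (I : Type) (s : seq I) (F : I -> R * R -> R) d : integ mu d -> sqi mu d ->
  (forall i, sqi mu (F i) /\ wcvg d (F i)) ->
  sqi mu (fun x => \sum_(i <- s) F i x) /\ wcvg d (fun x => \sum_(i <- s) F i x).
Proof.
move=> di sd HF; elim: s => [|i s [IH1 IH2]].
  split.
    under eq_fun do rewrite big_nil; split; first exact: rmeas_cst.
    by under eq_fun do rewrite expr0n; exact: integ0.
  rewrite /wcvg; have E k : \int[mu]_x ((\sum_(i <- [::]) F i x) * k x) = 0.
    transitivity (\int[mu]_x (0 : R)); last exact: int0.
    by apply: eq_int => x; rewrite big_nil mul0r.
  by rewrite E; under eq_fun do rewrite E; exact: cvg_cst.
have [sF wF] := HF i; split.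
  by under eq_fun do rewrite big_cons; exact: sqiD.
have E k : sqi mu k -> \int[mu]_x ((\sum_(i <- i :: s) F i x) * k x) =
    \int[mu]_x (F i x * k x) + \int[mu]_x ((\sum_(i <- s) F i x) * k x).
  move=> sk; rewrite -intD; [|exact: sqi_mul..].
  by apply: eq_int => x; rewrite big_cons mulrDl.
rewrite /wcvg E// (_ : (fun n => _) = (fun n => \int[mu]_x (F i x * conv (r_ n) d x) +
    \int[mu]_x ((\sum_(i <- s) F i x) * conv (r_ n) d x))); first exact: cvgD.
by apply/funext => n; rewrite E//; have [] := conv_sq (r0 n) di sd.
Qed.

(** Dynkin induction from boxes. Intersecting with a fixed box keeps indicators in L^2; a countable
    disjoint union is an L^2 limit of finite ones, to which [wcvg_approx] applies. *)
Lemma conv_sets (a b : R * R) d : integ mu d -> sqi mu d ->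
  forall E, measurable (E : set (plane R)) ->
  \int[mu]_x (\1_(E `&` obox a b) x * conv (r_ n) d x) @[n --> \oo] -->
  \int[mu]_x (\1_(E `&` obox a b) x * d x).
Proof.
move=> di sd E mE; set Q := obox a b.
have mQ : measurable (Q : set (plane R)) by exact: measurable_obox.
have ci n : integ mu (conv (r_ n) d) by have [] := conv_int (r0 n) di.
have csq n := conv_sq (r0 n) di sd.
have mI (A : set (plane R)) : measurable A -> measurable (A `&` Q) by move=> mA; exact: measurableI.
pose P (A : set (plane R)) := \int[mu]_x (\1_(A `&` Q) x * conv (r_ n) d x) @[n --> \oo] -->
  \int[mu]_x (\1_(A `&` Q) x * d x).
have EE : (<<s oboxes >>) E by rewrite -measurable_oboxes.
have subm (A : set (plane R)) : (<<s oboxes >>) A -> measurable A by rewrite -measurable_oboxes.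
apply: (@dynkin_induction _ (plane R) oboxes P measurable_oboxes (@oboxes_setI R)) => //.
- by rewrite /P setTI; exact: conv_box.
- by move=> _ [a' [b' ->]]; rewrite /P oboxI; exact: conv_box.
- move=> A mA PA; rewrite /P.
  have ind x : \1_(~` A `&` Q) x = \1_Q x - \1_(A `&` Q) x :> R.
    rewrite !indicE !in_setI in_setC; case: (x \in A); case: (x \in Q); rewrite /= ?subrr ?subr0//.
  have spl (k : R * R -> R) : integ mu k -> \int[mu]_x (\1_(~` A `&` Q) x * k x) =
      \int[mu]_x (\1_Q x * k x) - \int[mu]_x (\1_(A `&` Q) x * k x).
    move=> ki; rewrite -intB; [|exact: integ_restr|by apply: integ_restr => //; exact: mI].
    by apply: eq_int => x; rewrite ind mulrBl.
  rewrite spl//; under eq_fun do rewrite spl//.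
  by apply: cvgB => //; exact: conv_box.
- move=> F mF tF PF.
  pose U N := \bigcup_(k in [set k | (k < N)%N]) F k.
  have mU N : measurable (U N) by apply: bigcup_measurable => k _.
  have mUi : measurable (\bigcup_k F k) by apply: bigcup_measurable => k _.
  have finQ (A : set (plane R)) : measurable A -> sqi mu (\1_(A `&` Q)).
    move=> mA; split; first by apply: rmeas_indic; exact: mI.
    rewrite (_ : (fun x => _) = \1_(A `&` Q)).
      apply: integ_indic; first exact: mI.
      by apply: le_lt_trans (leb2_obox_lty a b); apply: le_measure; rewrite ?inE//; exact: mI.
    by apply/funext => x; rewrite indicE; case: (_ \in _); rewrite /= ?expr1n ?expr0n.
  have sumU N x : \1_(U N `&` Q) x = \sum_(k <- iota 0 N) \1_(F k `&` Q) x :> R.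
    elim: N => [|N IH]; first by rewrite big_nil indicF// => -[[]].
    rewrite -addn1 iotaD big_cat/= big_seq1 -IH add0n addn1 !indicI -mulrDl; congr (_ * _).
    have [FN|nFN] := pselect (F N x).
      rewrite (indicT FN) indicT; last by exists N => /=.
      rewrite indicF ?add0r// => -[k /= kN Fk].
      by move/trivIsetP : tF => /(_ k N I I); rewrite (ltn_eqF kN) => /(_ isT) /seteqP[/(_ x)] /= H _; apply: H.
    rewrite (indicF nFN) addr0.
    have [UN|nUN] := pselect (U N x).
      by rewrite !indicT//; move: UN => [k /= kN Fk]; exists k => //=; rewrite ltnW.
    rewrite !indicF// => -[k /=]; rewrite ltnS leq_eqVlt => /predU1P[->//|kN Fx].
    by apply: nUN; exists k.
  apply: wcvg_approx => //; first exact: finQ.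
  move=> eta eta0.
  have tail : \int[mu]_x ((\1_((\bigcup_k F k) `&` Q) x - \1_(U N `&` Q) x) ^+ 2) @[N --> \oo] --> (0 : R).
    have i0 := int0 mu; rewrite -[X in _ --> X]i0; apply: (@int_cvg _ (plane R) R mu _ _ (\1_Q)).
    - by move=> N; under eq_fun do rewrite expr2; apply: rmeasM; apply: rmeasB; apply: rmeas_indic; exact: mI.
    - exact: rmeas_cst.
    - apply: aeW => x; apply: cvg_near_cst.
      have [[k _ Fk]|nF] := pselect ((\bigcup_k F k) x).
        near=> N; have kN : (k < N)%N by near: N; exact: nbhs_infty_gt.
        rewrite !indicI (@indicT (\bigcup_k F k)); last by exists k.
        by rewrite (@indicT (U N)) ?subrr ?expr0n//; exists k.
      near=> N; rewrite !indicI (indicF nF) (@indicF (U N)) ?subrr ?expr0n// => -[k _ Fk].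
      by apply: nF; exists k.
    - by apply: integ_indic => //; exact: leb2_obox_lty.
    - move=> N x; rewrite (indicI (\bigcup_k F k)) (indicI (U N)) -mulrBl.
      have [Qx|nQx] := pselect (Q x); last by rewrite (indicF nQx) mulr0 expr0n normr0.
      rewrite (indicT Qx) mulr1.
      have [h1|h1] := pselect ((\bigcup_k F k) x); have [h2|h2] := pselect (U N x);
        by rewrite ?(indicT h1) ?(indicF h1) ?(indicT h2) ?(indicF h2)
          ?subrr ?subr0 ?sub0r ?expr0n ?sqrrN ?expr1n ?normr0 ?normr1.
  move/cvgrPdist_le : tail => /(_ _ eta0)[N _ /(_ N (leqnn N))].
  rewrite sub0r normrN => tailN.
  exists (\1_(U N `&` Q)); last by rewrite (le_trans (ler_norm _) tailN).
  have -> : (\1_(U N `&` Q) : R * R -> R) = (fun x => \sum_(k <- iota 0 N) \1_(F k `&` Q) x).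
    by apply/funext => x; exact: sumU.
  by apply: wcvg_sum => // k; split; [exact: finQ|exact: PF].
Unshelve. all: by end_near. Qed.

End weak_convergence.

(** * The fundamental lemma of the calculus of variations *)

Import HBNNSimple.

Section weak_convergence2.
Context {R : realType}.
Local Notation mu := (leb2 R).
Implicit Types (x y v : R * R) (D K : set (R * R)) (f g F d G : R * R -> R).
Variable r_ : nat -> R.
Hypothesis r0 : forall n, 0 < r_ n.
Hypothesis rc : r_ n @[n --> \oo] --> (0 : R).

Lemma wcvgZ (c : R) d G : integ mu d -> sqi mu d -> sqi mu G -> wcvg r_ d G ->
  wcvg r_ d (fun x => c * G x).
Proof.
move=> di sd sG wG; rewrite /wcvg.
have E k : sqi mu k -> \int[mu]_x (c * G x * k x) = c * \int[mu]_x (G x * k x).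
  by move=> sk; rewrite -intZ; [apply: eq_int => x; rewrite mulrA|exact: sqi_mul].
rewrite E// (_ : (fun n => _) = (fun n => c * \int[mu]_x (G x * conv (r_ n) d x))).
  by apply: cvgM => //; exact: cvg_cst.
by apply/funext => n; rewrite E//; have [] := conv_sq (r0 n) di sd.
Qed.

Lemma wcvgB d G H : integ mu d -> sqi mu d -> sqi mu G -> sqi mu H ->
  wcvg r_ d G -> wcvg r_ d H -> wcvg r_ d (fun x => G x - H x).
Proof.
move=> di sd sG sH wG wH; rewrite /wcvg.
have E k : sqi mu k -> \int[mu]_x ((G x - H x) * k x) = \int[mu]_x (G x * k x) - \int[mu]_x (H x * k x).
  by move=> sk; rewrite -intB; [apply: eq_int => x; rewrite mulrBl|exact: sqi_mul..].
rewrite E// (_ : (fun n => _) = (fun n => \int[mu]_x (G x * conv (r_ n) d x) - \int[mu]_x (H x * conv (r_ n) d x))).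
  exact: cvgB.
by apply/funext => n; rewrite E//; have [] := conv_sq (r0 n) di sd.
Qed.

Lemma sqi_indic_box (E : set (plane R)) (a b : R * R) : measurable E -> sqi mu (\1_(E `&` obox a b)).
Proof.
move=> mE; have mEQ : measurable (E `&` obox a b) by apply: measurableI => //; exact: measurable_obox.
apply: (@sqi_bounded _ (plane R) R mu _ 1 (E `&` obox a b)) => //.
- by apply: le_lt_trans (leb2_obox_lty a b); apply: le_measure; rewrite ?inE//; exact: measurable_obox.
- exact: rmeas_indic.
- exact: indic_bound.
- by move=> x nx; rewrite indicF.
Qed.

(** Simple functions increasing to G converge to it in L^2, and their level sets are handled by
    [conv_sets]. *)
Lemma conv_weak_ge0 (a b : R * R) d G : integ mu d -> sqi mu d -> sqi mu G ->
  (forall x, 0 <= G x) -> (forall x, ~ obox a b x -> G x = 0) -> wcvg r_ d G.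
Proof.
move=> di sd sG G0 Gs.
have mG := sqi_meas sG.
have mGE : measurable_fun setT (EFin \o G : plane R -> \bar R) by exact/measurable_EFinP.
pose s n : {nnsfun plane R >-> R} := nnsfun_approx measurableT mGE n.
have GE0 x : setT x -> (0 <= (EFin \o G : plane R -> \bar R) x)%E by move=> _; rewrite lee_fin.
have sle n x : s n x <= G x.
  by have := @le_approx _ _ _ setT (EFin \o G : plane R -> \bar R) n x GE0 I; rewrite /s nnsfun_approxE lee_fin.
have s0 n x : 0 <= s n x by [].
have scv x : s n x @[n --> \oo] --> G x.
  have := @cvg_nnsfun_approx _ _ _ setT measurableT _ mGE GE0 x I.
  by move/fine_cvg => /=; apply.
have ms n : rmeas (s n).
  have H : measurable_fun setT (s n) by [].
  exact: H.
apply: wcvg_approx => // eta eta0.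
have tail : \int[mu]_x ((G x - s n x) ^+ 2) @[n --> \oo] --> (0 : R).
  have i0 := int0 mu; rewrite -[X in _ --> X]i0.
  apply: (@int_cvg _ (plane R) R mu _ _ (fun x => G x ^+ 2)).
  - by move=> n; under eq_fun do rewrite expr2; apply: rmeasM; apply: rmeasB.
  - exact: rmeas_cst.
  - apply: aeW => x.
    have H : G x - s n x @[n --> \oo] --> (0 : R).
      by rewrite -[X in _ --> X](subrr (G x)); apply: cvgB => //; exact: cvg_cst.
    have H2 : (G x - s n x) * (G x - s n x) @[n --> \oo] --> (0 * 0 : R) by exact: cvgM.
    by rewrite mul0r in H2; apply: cvg_trans H2; apply: near_eq_cvg; apply: nearW => n; rewrite expr2.
  - exact: sqi_sq.
  - move=> n x; rewrite ger0_norm ?sqr_ge0// lerXn2r ?nnegrE ?subr_ge0//.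
    by rewrite lerBlDr lerDl.
move/cvgrPdist_le : tail => /(_ _ eta0)[N _ /(_ N (leqnn N))].
rewrite sub0r normrN => tailN.
exists (s N); last by rewrite (le_trans (ler_norm _) tailN).
have fr := fimfunP (s N).
(* Outside the box the simple function is squeezed between 0 and G = 0, so cutting its level sets by
   the box only affects the term c = 0. *)
have E : (s N : R * R -> R) = (fun x => \sum_(c <- finmap.enum_fset (fset_set (range (s N))))
    (c * \1_(s N @^-1` [set c] `&` obox a b) x)).
  apply/funext => x; rewrite {1}fimfunE fsbig_finite//=.
  have [Qx|nQx] := pselect (obox a b x).
    by apply: eq_bigr => c _; rewrite (indicI _ (obox a b)) (indicT Qx) mulr1.
  rewrite [RHS]big1; last by move=> c _; rewrite indicF ?mulr0// => -[].
  apply: big1 => c _; have [->|c0] := eqVneq c 0; first by rewrite mul0r.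
  rewrite indicF ?mulr0//= => sc; move: c0; rewrite -sc => /eqP; apply.
  by apply/eqP; rewrite eq_le s0 andbT -(Gs _ nQx).
rewrite E; apply: wcvg_sum => // c.
have mc : measurable (s N @^-1` [set c]) by exact: measurable_sfunP.
split; first by apply: sqiZ; exact: sqi_indic_box.
apply: wcvgZ => //; first exact: sqi_indic_box.
exact: conv_sets.
Qed.

Lemma conv_weak (a b : R * R) d G : integ mu d -> sqi mu d -> sqi mu G ->
  (forall x, ~ obox a b x -> G x = 0) -> wcvg r_ d G.
Proof.
move=> di sd sG Gs; have mG := sqi_meas sG.
pose Gp x := (`|G x| + G x) / 2; pose Gm x := (`|G x| - G x) / 2.
have sA : sqi mu (fun x => `|G x|).
  by split; [exact: rmeas_norm|under eq_fun do rewrite real_normK ?num_real//; exact: sqi_sq].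
have sp : sqi mu Gp by rewrite /Gp; under eq_fun do rewrite mulrC; apply: sqiZ; exact: sqiD.
have sm : sqi mu Gm by rewrite /Gm; under eq_fun do rewrite mulrC; apply: sqiZ; exact: sqiB.
have -> : G = (fun x => Gp x - Gm x) by apply/funext => x; rewrite /Gp /Gm; lra.
apply: wcvgB => //; apply: (@conv_weak_ge0 a b) => //.
- by move=> x; rewrite /Gp divr_ge0//; have := ler_norm (- G x); rewrite normrN; lra.
- by move=> x /Gs; rewrite /Gp => ->; rewrite normr0 addr0 mul0r.
- by move=> x; rewrite /Gm divr_ge0//; have := ler_norm (G x); lra.
- by move=> x /Gs; rewrite /Gm => ->; rewrite normr0 subr0 mul0r.
Qed.

(** Version for d merely integrable, as du Bois-Reymond requires: d is truncated where |d| exceeds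
    N, and the error is uniform in n because mollification contracts the L^1 norm. *)
Lemma conv_sets_L1 (a b : R * R) d E : integ mu d -> measurable (E : set (plane R)) ->
  \int[mu]_x (\1_(E `&` obox a b) x * conv (r_ n) d x) @[n --> \oo] -->
  \int[mu]_x (\1_(E `&` obox a b) x * d x).
Proof.
move=> di mE; have md := integ_meas di.
pose A (N : nat) : set (plane R) := [set x | `|d x| <= N%:R].
have mA N : measurable (A N).
  rewrite (_ : A N = (fun x => `|d x|) @^-1` `]-oo, N%:R]%classic).
    by rewrite -[X in measurable X]setTI; apply: (rmeas_norm md) => //; exact: measurable_itv.
  by apply/seteqP; split => x; rewrite /A /= in_itv.
pose dN N x := \1_(A N) x * d x.
have idN N : integ mu (dN N) by exact: integ_restr.
have sdN N : sqi mu (dN N).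
  split; first exact: integ_meas (idN N).
  apply: (@integ_le _ (plane R) R mu _ (fun x => N%:R * `|d x|)).
  - by under eq_fun do rewrite expr2; apply: rmeasM; exact: integ_meas (idN N).
  - by apply: integZ; exact: integ_norm.
  - move=> x; rewrite /dN; have [Ax|nAx] := pselect (A N x).
      by rewrite (indicT Ax) mul1r normrX expr2 ler_wpM2r.
    by rewrite (indicF nAx) mul0r expr0n normr0 mulr_ge0.
have tail : \int[mu]_x `|d x - dN N x| @[N --> \oo] --> (0 : R).
  have i0 := int0 mu; rewrite -[X in _ --> X]i0.
  apply: (@int_cvg _ (plane R) R mu _ _ (fun x => `|d x|)).
  - by move=> N; apply: rmeas_norm; apply: rmeasB => //; exact: integ_meas (idN N).
  - exact: rmeas_cst.
  - apply: aeW => x; apply: cvg_near_cst; near=> N.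
    rewrite /dN indicT ?mul1r ?subrr ?normr0// /A /=.
    have h : `|d x| < (Num.bound `|d x|)%:R by exact: archi_boundP.
    by rewrite (le_trans (ltW h))// ler_nat; near: N; exact: nbhs_infty_ge.
  - exact: integ_norm.
  - move=> N x; rewrite normr_id /dN.
    have [Ax|nAx] := pselect (A N x); first by rewrite (indicT Ax) mul1r subrr normr0.
    by rewrite (indicF nAx) mul0r subr0.
set EQ := E `&` obox a b.
have mEQ : measurable EQ by apply: measurableI => //; exact: measurable_obox.
have small k : integ mu k -> `|\int[mu]_x (\1_EQ x * k x)| <= \int[mu]_x `|k x|.
  move=> ki; have ii := integ_restr mEQ ki; rewrite (le_trans (int_norm_le ii))//.
  apply: int_le; [exact: integ_norm|exact: integ_norm|].
  by move=> x; rewrite normrM ler_piMl// indic_bound.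
apply/cvgrPdist_le => e e0.
have e3 : 0 < e / 3 by rewrite divr_gt0.
move/cvgrPdist_le : tail => /(_ _ e3)[N _ /(_ N (leqnn N))].
rewrite sub0r normrN => tailN.
have {}tailN := le_trans (ler_norm _) tailN.
have /cvgrPdist_le /(_ _ e3) W := @conv_sets R r_ r0 rc a b _ (idN N) (sdN N) E mE.
near=> n.
have Wn : `|\int[mu]_x (\1_EQ x * dN N x) - \int[mu]_x (\1_EQ x * conv (r_ n) (dN N) x)| <= e / 3.
  by near: n; exact: W.
have iB := integB di (idN N).
have S1 : `|\int[mu]_x (\1_EQ x * d x) - \int[mu]_x (\1_EQ x * dN N x)| <= e / 3.
  rewrite -intB; [|exact: integ_restr..].
  rewrite (_ : \int[mu]_x _ = \int[mu]_x (\1_EQ x * (d x - dN N x))); last by apply: eq_int => x; rewrite mulrBr.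
  by rewrite (le_trans (small _ iB)).
have cd := conv_int (r0 n) di; have cdN := conv_int (r0 n) (idN N).
have S2 : `|\int[mu]_x (\1_EQ x * conv (r_ n) (dN N) x) - \int[mu]_x (\1_EQ x * conv (r_ n) d x)| <= e / 3.
  rewrite distrC -intB; [|by apply: integ_restr => //; case: cd|by apply: integ_restr => //; case: cdN].
  have [iC _] := conv_int (r0 n) iB.
  rewrite (_ : \int[mu]_x _ = \int[mu]_x (\1_EQ x * conv (r_ n) (fun y => d y - dN N y) x)); last first.
    by apply: eq_int => x; rewrite convB// mulrBr.
  by rewrite (le_trans (small _ iC))// (le_trans (conv_L1 (r0 n) iB)).
rewrite (le_trans (ler_distD (\int[mu]_x (\1_EQ x * dN N x)) _ _))//.
have H3 := le_trans (ler_distD (\int[mu]_x (\1_EQ x * conv (r_ n) (dN N) x)) _ _) (lerD Wn S2).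
by rewrite (le_trans (lerD S1 H3))// thirds_le.
Unshelve. all: by end_near. Qed.

End weak_convergence2.

Lemma count_bigcup_negligible d (T : measurableType d) (R : realType)
    (mu : {measure set T -> \bar R}) (I : countType) (N : I -> set T) :
  (forall i, mu.-negligible (N i)) -> mu.-negligible (\bigcup_i N i).
Proof.
move=> nN.
have : mu.-negligible (\bigcup_n (if unpickle n is Some q then N q else set0)).
  by apply: negligible_bigcup => n; case: (unpickle n) => [q|]; [exact: nN|exact: negligible_set0].
apply: negligibleS => x [q _ Nq].
by exists (pickle q) => //; rewrite pickleK.
Qed.

Section du_bois_reymond.
Context {R : realType}.
Local Notation mu := (leb2 R).
Implicit Types (x y v : R * R) (D K : set (R * R)) (f g F d G : R * R -> R).

Lemma moll_test_at D x r : 0 < r -> disc x r `<=` D -> test_function D (fun y => moll r (x - y)).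
Proof.
move=> r0 xD; rewrite /moll; apply: testMl; first exact: smooth_cst.
have -> : (fun y => bump0 r (x - y)) = (fun y => flat 0 (1 - rad x r y)).
  by apply/funext => y; rewrite /bump0 /rad /= !subr0 -!(opprB y.1) -!(opprB y.2) !sqrrN.
apply: (@test_radial _ D x r (fun s => flat 0 (1 - s)) setT) => //.
- by move=> k; exact: flat_1sub_Ck1.
- by move=> s s1; rewrite flat_neg// subr_le0 ltW.
Qed.

Definition cbox x (r : R) : set (R * R) := [set y | `|x.1 - y.1| <= r /\ `|x.2 - y.2| <= r].

Lemma cboxE x r : cbox x r = `[x.1 - r, x.1 + r]%classic `*` `[x.2 - r, x.2 + r]%classic.
Proof.
apply/seteqP; split => y; rewrite /cbox /= !in_itv /= !ler_norml.
  by move=> [/andP[? ?] /andP[? ?]]; split; apply/andP; split; lra.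
by move=> [/andP[? ?] /andP[? ?]]; split; apply/andP; split; lra.
Qed.

Lemma cbox_compact x r : compact (cbox x r).
Proof. by rewrite cboxE; apply: compact_setX; exact: segment_compact. Qed.

Lemma disc_cbox x r : 0 < r -> disc x r `<=` cbox x r.
Proof. by move=> r0 y /(disc_box r0) [h1 h2]; rewrite /cbox /= distrC (distrC x.2). Qed.

Lemma integ_of_compact K f : compact K -> (mu.-integrable K (EFin \o f)) ->
  integ mu (fun x => \1_K x * f x).
Proof.
move=> cK iK; have mK := compact_plane_measurable cK.
have := (@integrable_mkcond _ (plane R) R mu K (EFin \o f) mK).1 iK.
suff -> : (EFin \o f) \_ K = EFin \o (fun x => \1_K x * f x) by [].
apply/funext => x; rewrite patchE /= indicE.
by case: (x \in K) => /=; rewrite ?mulr1n ?mulr0n ?mul1r ?mul0r.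
Qed.

Lemma int_restrict D K f : K `<=` D -> (forall x, ~ K x -> f x = 0) ->
  \int[mu]_(x in D) f x = \int[mu]_x f x.
Proof.
move=> KD f0; rewrite Rintegral_mkcond; apply: eq_int => x; rewrite patchE.
case: ifPn => // xD; rewrite f0// => /KD Dx.
by move: xD; rewrite mem_set.
Qed.

(** Translated mollifiers are test functions, so the mollifications of d vanish near any given point
    of D; by [conv_sets_L1] so do the integrals of d over all measurable sets nearby. Rational boxes
    then reduce the claim to countably many local ones. *)
Lemma du_bois_reymond D d : open D -> loc_integrable D d ->
  (forall phi, test_function D phi -> \int[mu]_(x in D) (d x * phi x) = 0) ->
  eq_ae D d (fun=> 0).
Proof.
move=> oD ld H0.
pose Z (q : rat * rat * rat * rat) := {ae mu, forall x, rbox q x -> d x = 0}.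
have cover x : D x -> exists2 q, Z q & rbox q x.
  move=> Dx; have [e e0 He] := open_oboxP oD Dx.
  (* [O] has half-side k and [K] half-side 3 k: discs of radius at most k around points of [O] stay
     in [K], and [K] stays in the box of half-side e = 4 k. *)
  pose k := e / 4; have k0 : 0 < k by rewrite divr_gt0.
  have ke : e = 4 * k by rewrite /k mulrC divfK.
  pose O := obox (x.1 - k, x.2 - k) (x.1 + k, x.2 + k).
  have oO : open O by exact: obox_open.
  have Ox : O x by rewrite /O oboxE /=; split; apply/andP; split; lra.
  have [q qO qx] : (\bigcup_(q in [set q | (rbox q : set (R * R)) `<=` O]) rbox q) x by rewrite -open_bigcup_rbox.
  exists q => //; rewrite /Z.
  pose K := cbox x (3 * k).
  have KD : K `<=` D.
    move=> y; rewrite /K /cbox /= !ler_norml => -[/andP[? ?] /andP[? ?]].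
    by apply: He; rewrite oboxE /=; split; apply/andP; split; lra.
  have cK : compact K by exact: cbox_compact.
  pose d' y := \1_K y * d y.
  have id' : integ mu d' by apply: integ_of_compact => //; exact: ld.
  pose r_ (n : nat) := k / n.+1%:R.
  have r0 n : 0 < r_ n by rewrite divr_gt0.
  have rk n : r_ n <= k by rewrite ler_pdivrMr// ler_peMr ?ler1n// ltW.
  have rc : r_ n @[n --> \oo] --> (0 : R).
    rewrite -[X in _ --> X](mulr0 k); apply: cvgM; first exact: cvg_cst.
    exact: cvg_harmonic.
  have conv0 n y : O y -> conv (r_ n) d' y = 0.
    rewrite /O oboxE /= => -[/andP[? ?] /andP[? ?]].
    have dK : disc y (r_ n) `<=` K.
      move=> z /(disc_cbox (r0 n)); rewrite /cbox /= !ler_norml => -[/andP[? ?] /andP[? ?]].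
      by have ? := rk n; rewrite /K /cbox /= !ler_norml; split; apply/andP; split; lra.
    have tm := moll_test_at (r0 n) (subset_trans dK KD).
    rewrite -(H0 _ tm) (@int_restrict D K).
    - apply: eq_int => z; rewrite /d'; have [Kz|nKz] := pselect (K z).
        by rewrite (indicT Kz) mul1r mulrC.
      rewrite (indicF nKz) mul0r mulr0 /moll /bump0 flat_neg ?mulr0 ?mulr0//.
      rewrite subr_le0 leNgt; apply/negP => lt1; apply: nKz; apply: dK.
      rewrite /disc /= ltW//; move: lt1; rewrite /rad /= !subr0.
      by rewrite -!(opprB z.1) -!(opprB z.2) !sqrrN.
    - exact: KD.
    - move=> z nKz; rewrite /moll /bump0 flat_neg ?mulr0 ?mulr0//.
      rewrite subr_le0 leNgt; apply/negP => lt1; apply: nKz; apply: dK.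
      rewrite /disc /= ltW//; move: lt1; rewrite /rad /= !subr0.
      by rewrite -!(opprB z.1) -!(opprB z.2) !sqrrN.
  have int0E E : measurable (E : set (plane R)) -> \int[mu]_z (\1_(E `&` O) z * d' z) = 0.
    move=> mE; have L := @conv_sets_L1 R r_ r0 rc (x.1 - k, x.2 - k) (x.1 + k, x.2 + k) d' E id' mE.
    apply: (cvg_unique _ L); first exact: Rhausdorff.
    rewrite (_ : (fun n => _) = (fun=> 0)); first exact: cvg_cst.
    apply/funext => n; transitivity (\int[mu]_z (0 : R)); last exact: int0.
    apply: eq_int => z; have [EOz|nEO] := pselect ((E `&` O) z).
      by rewrite conv0 ?mulr0//; case: EOz.
    by rewrite (indicF nEO) mul0r.
  have mO : measurable (O : set (plane R)) by exact: measurable_obox.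
  have OK : O `<=` K.
    move=> y; rewrite /O oboxE /K /cbox /= !ler_norml => -[/andP[? ?] /andP[? ?]].
    by split; apply/andP; split; lra.
  have AE : ae_eq mu O (EFin \o d') (cst 0%E).
    apply: integral_ae_eq => //.
    - by apply: (integrableS measurableT) => //.
    - move=> E EO mE.
      rewrite integral0 -[LHS]fineK; last first.
        apply: integrable_fin_num => //; apply: (integrableS measurableT) => //.
      congr EFin; rewrite -[RHS](int0E E mE) -/(Rintegral mu E d') Rintegral_mkcond.
      apply: eq_int => z; rewrite patchE; case: ifPn => [/set_mem Ez|/negP nEz].
        by rewrite (@indicT R (E `&` O)) ?mul1r//; split => //; exact: EO.
      by rewrite (@indicF R (E `&` O)) ?mul0r// => -[Ez _]; apply: nEz; exact: mem_set.
  apply: (ae_imp AE) => y /= H qy; have Oy := qO _ qy.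
  have [] := H Oy; rewrite /d' indicT ?mul1r//; exact: OK.
rewrite /eq_ae.
pose N (q : rat * rat * rat * rat) : set (plane R) := [set x | `[< Z q >] /\ ~ (rbox q x -> d x = 0)].
have nN q : mu.-negligible (N q).
  have [Zq|nZ] := pselect (Z q); last first.
    apply: negligibleS (negligible_set0 mu) => x [/asboolP] //.
  by apply: negligibleS Zq => x [_].
apply: negligibleS (count_bigcup_negligible nN) => x /= nx.
have [Dx dx] : D x /\ d x <> 0 by apply/not_implyP.
have [q Zq qx] := cover _ Dx.
exists q => //; split; first exact/asboolP.
by move=> /(_ qx).
Qed.

End du_bois_reymond.

(** * Weak gradients and product rules *)

Section radial_derivatives.
Context {R : realType}.
Implicit Types (P x v w : R * R).

Definition drad P (r : R) v x : R := 2 * ((x.1 - P.1) * v.1 + (x.2 - P.2) * v.2) / r ^+ 2.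

Lemma is_derive_drad P r v w x :
  is_derive x w (drad P r v) (2 * (w.1 * v.1 + w.2 * v.2) / r ^+ 2).
Proof.
have d1 : is_derive x w (fun y : R * R => y.1 - P.1) (w.1 - 0).
  exact: (is_deriveBf (is_derive_fst x w) (is_derive_cst P.1 x w)).
have d2 : is_derive x w (fun y : R * R => y.2 - P.2) (w.2 - 0).
  exact: (is_deriveBf (is_derive_snd x w) (is_derive_cst P.2 x w)).
have c (k : R) := is_derive_cst k x w.
have H := is_deriveMf (is_deriveMf (c 2) (is_deriveDf (is_deriveMf d1 (c v.1)) (is_deriveMf d2 (c v.2)))) (c (r ^+ 2)^-1).
by apply: is_derive_eq H _ => /=; ring.
Qed.

Variables (I : set R) (E E1 E2 : R -> R).
Hypothesis I0 : forall s, 0 <= s -> I s.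
Hypothesis dE : forall s, I s -> is_derive s (1 : R) E (E1 s).
Hypothesis dE1 : forall s, I s -> is_derive s (1 : R) E1 (E2 s).

Lemma radial_derive P r v x :
  'D_v (fun y => E (rad P r y)) x = E1 (rad P r x) * drad P r v x.
Proof.
have [] := @is_derive_compf R E (rad P r) x v _ _ (is_derive_rad P r x v) (dE (I0 (rad_ge0 P r x))).
by [].
Qed.

Lemma radial_derive2 P r v w x :
  'D_w (fun y => 'D_v (fun z => E (rad P r z)) y) x =
  E2 (rad P r x) * drad P r w x * drad P r v x
  + E1 (rad P r x) * (2 * (w.1 * v.1 + w.2 * v.2) / r ^+ 2).
Proof.
rewrite (_ : (fun y => _) = (fun y => E1 (rad P r y) * drad P r v y)); last first.
  by apply/funext => y; rewrite radial_derive.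
have H1 := @is_derive_compf R E1 (rad P r) x w _ _ (is_derive_rad P r x w) (dE1 (I0 (rad_ge0 P r x))).
by have [_ ->] := is_deriveMf H1 (is_derive_drad P r v w x).
Qed.

(** Symmetry of mixed derivatives is read off an explicit formula. It is wanted for the mollifier
    alone, from which every mollified function inherits it. *)
Lemma radial_derive_sym P r v w x :
  'D_w (fun y => 'D_v (fun z => E (rad P r z)) y) x =
  'D_v (fun y => 'D_w (fun z => E (rad P r z)) y) x.
Proof.
rewrite !radial_derive2 [w.1 * _]mulrC [w.2 * _]mulrC.
by congr (_ + _); rewrite mulrAC.
Qed.

End radial_derivatives.

Lemma e21_neq (R : realType) : (e2 R == e1 R) = false.
Proof. by apply/negP => /eqP /(congr1 (@fst R R)) /= /eqP; rewrite eq_sym oner_eq0. Qed.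

Section weak_gradients.
Context {R : realType}.
Local Notation mu := (leb2 R).
Implicit Types (x y v : R * R) (D K : set (R * R)) (f g F u phi G : R * R -> R).

(* Functions on [D] are extended by 0. *)
Definition wgrad D v u g := [/\ sqi mu u, sqi mu g, forall x, ~ D x -> u x = 0,
  forall x, ~ D x -> g x = 0 &
  forall phi, test_function D phi ->
    \int[mu]_x (u x * 'D_v phi x) = - \int[mu]_x (g x * phi x)].

Lemma sqi_integ u r : sqi mu u -> (forall x, ~ cube r x -> u x = 0) -> integ mu u.
Proof.
move=> su u0; have c1 : sqi mu (\1_(setT `&` cube r) : R * R -> R) by exact: sqi_indic_box.
have := sqi_mul c1 su; congr integ; apply/funext => x.
have [cx|ncx] := pselect (cube r x); first by rewrite indicT ?mul1r.
by rewrite u0 ?mulr0.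
Qed.

Lemma moll_derive_sym r v w x : basis_vec v -> basis_vec w ->
  'D_w (fun y => 'D_v (moll r) y) x = 'D_v (fun y => 'D_w (moll r) y) x.
Proof.
move=> bv bw.
pose c := (\int[mu]_y bump0 r y)^-1.
pose E (s : R) := c * flat 0 (1 - s).
have d j (t : R) : is_derive t (1 : R) (fun s : R => flat j (1 - s))
    (j%:R * flat j.+1 (1 - t) - flat j.+2 (1 - t)).
  have D1 : is_derive t (1 : R) (fun s : R => 1 - s) (0 - 1).
    exact: (@is_deriveB R R R (cst (1 : R)) (@id R) t 1 0 1 (is_derive_cst _ _ _) (is_derive_id _ _)).
  have := @is_derive1_comp R (flat j) (fun s => 1 - s) t _ _ (is_derive_flat j (1 - t)) D1.
  by rewrite sub0r mulrN1 opprB.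
have dE (s : R) : setT s -> is_derive s (1 : R) E (c * (0%:R * flat 1 (1 - s) - flat 2 (1 - s))).
  by move=> _; exact: (@is_deriveZ _ _ _ _ c _ _ _ (d 0%N s)).
have dE1 (s : R) : setT s -> is_derive s (1 : R) (fun s => c * (0%:R * flat 1 (1 - s) - flat 2 (1 - s)))
   (c * (0%:R * (1%:R * flat 2 (1 - s) - flat 3 (1 - s)) - (2%:R * flat 3 (1 - s) - flat 4 (1 - s)))).
  move=> _.
  have B := @is_deriveB R R R _ (fun s => flat 2 (1 - s)) s 1 _ _
    (@is_deriveZ _ _ _ _ (0%:R : R) _ _ _ (d 1%N s)) (d 2%N s).
  exact: (@is_deriveZ _ _ _ _ c _ _ _ B).
have I0 (s : R) : 0 <= s -> [set: R] s by [].
exact: (@radial_derive_sym R setT E _ _ I0 dE dE1 0 r v w x).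
Qed.

Variables (D : set (R * R)) (rD : R).
Hypothesis oD : open D.
Hypothesis bD : D `<=` cube rD.

Lemma wgrad_integ v u g : wgrad D v u g -> integ mu u /\ integ mu g.
Proof.
by move=> [su sg u0 g0 _]; split; apply: (sqi_integ (r := rD)) => // x nx;
  [apply: u0|apply: g0]; move=> /bD.
Qed.

(** Since the disc lies in D, moll(x - .) is an admissible test function and the derivative passes
    from the mollifier to u. *)
Lemma conv_wgrad v u g r x : basis_vec v -> 0 < r -> wgrad D v u g -> disc x r `<=` D ->
  'D_v (conv r u) x = conv r g x.
Proof.
move=> bv r0 wu xD; have [iu ig] := wgrad_integ wu; have [su sg u0 g0 H] := wu.
have [_ ->] := conv_derive x r0 iu bv.
have tm := moll_test_at r0 xD.
have E y : 'D_v (fun y => moll r (x - y)) y = - 'D_v (moll r) (x - y).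
  have dm := is_derive_lineP (smooth_is_derive (x - y) (test_smooth (moll_test r0)) bv).
  have D1 : is_derive (0 : R) (1 : R) (fun s : R => - s) (- 1).
    exact: (@is_deriveN R R R (@id R) 0 1 1 (is_derive_id _ _)).
  rewrite -oppr0 in dm.
  have := @is_derive1_comp R (fun h => moll r (h *: v + (x - y))) (fun s => - s) 0 _ _ dm D1.
  rewrite mulrN1 => H1.
  have : is_derive y v (fun y => moll r (x - y)) (- 'D_v (moll r) (x - y)).
    apply: is_derive_line.
    set F1 := (X in is_derive _ _ X _) in H1; set F2 := (X in is_derive _ _ X _).
    suff -> : F2 = F1 by [].
    apply/funext => h; rewrite /F1 /F2 /=; congr (moll r _).
    by rewrite scaleNr opprD addrCA.
  by case.
have := H _ tm.
rewrite (_ : \int[mu]_y (u y * _) = - \int[mu]_y ('D_v (moll r) (x - y) * u y)); last first.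
  rewrite -intN; first by apply: eq_int => y; rewrite E mulrN mulrC.
  have [C C0 HC] := test_bounded (test_derive bv (moll_test r0)).
  have m1 : rmeas (fun t : plane R => (id t).1) by exact: measurable_fst.
  have m2 : rmeas (fun t : plane R => (id t).2) by exact: measurable_snd.
  exact: (superpos_integ m1 m2 iu x (test_derive bv (moll_test r0))).
move/oppr_inj => ->; apply: eq_int => y; exact: mulrC.
Qed.

Lemma disc_near K (r_ : nat -> R) : compact K -> K `<=` D -> (forall n, 0 < r_ n) ->
  r_ n @[n --> \oo] --> (0 : R) ->
  \forall n \near \oo, forall x, K x -> disc x (r_ n) `<=` D.
Proof.
move=> cK KD r0 rc.
have := (compact_near_coveringP K).1 cK nat \oo (fun n x => disc x (r_ n) `<=` D) _.
apply => x /KD Dx.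
have [e e0 He] := open_oboxP oD Dx.
have e2 : 0 < e / 2 by rewrite divr_gt0.
exists ([set y | `|x.1 - y.1| < e / 2 /\ `|x.2 - y.2| < e / 2], [set n | r_ n < e / 2]).
  split => /=; last exact: (cvgr_lt _ rc _ e2).
  by apply/nbhs_ballP; exists (e / 2).
move=> [y n] /= [[y1 y2] rn] z /(disc_cbox (r0 n)) [z1 z2].
apply: He; rewrite oboxE /=; move: y1 y2 z1 z2; rewrite !ltr_norml !ler_norml.
move=> /andP[? ?] /andP[? ?] /andP[? ?] /andP[? ?].
by split; apply/andP; split; lra.
Qed.

(** The term with a second derivative of g is the one that cancels between the two orders of
    differentiation in [weak_jacobian]. *)
Lemma wgrad_ibp v v' u uv phi g : basis_vec v -> basis_vec v' -> wgrad D v u uv ->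
  test_function D phi -> smooth g ->
  \int[mu]_x (uv x * phi x * 'D_v' g x) =
  - (\int[mu]_x (u x * 'D_v phi x * 'D_v' g x) +
     \int[mu]_x (u x * (phi x * 'D_v (fun y => 'D_v' g y) x))).
Proof.
move=> bv bv' [su suv _ _ H] tphi sg; have sphi := test_smooth tphi.
have sd : smooth (fun x => 'D_v' g x) by exact: smooth_derive.
have tn : test_function D (fun x => phi x * 'D_v' g x) by exact: testMr.
have t1 : test_function D (fun x => 'D_v phi x * 'D_v' g x).
  by apply: testMr => //; exact: test_derive.
have t2 : test_function D (fun x => phi x * 'D_v (fun y => 'D_v' g y) x).
  by apply: testMr => //; exact: smooth_derive.
have i1 : integ mu (fun x => u x * 'D_v phi x * 'D_v' g x).
  by have := sqi_mul su (test_sqi t1); congr integ; apply/funext => x; rewrite mulrA.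
have i2 := sqi_mul su (test_sqi t2).
rewrite -intD// (_ : \int[mu]_x (_ + _) = \int[mu]_x (u x * 'D_v (fun x => phi x * 'D_v' g x) x)).
  by rewrite H// opprK; apply: eq_int => x; rewrite mulrA.
by apply: eq_int => x; rewrite deriveMs//; ring.
Qed.

Let opp_sub_cancel (p1 p2 q1 q2 s1 s2 : R) : p1 = - (q1 + s1) -> p2 = - (q2 + s2) ->
  s1 = s2 -> - (q1 - q2) = p1 - p2.
Proof. by move=> -> -> ->; ring. Qed.

Section product_rules.
Variables (w w1 w2 : R * R -> R) (M : R).
Hypothesis ww1 : wgrad D (e1 R) w w1.
Hypothesis ww2 : wgrad D (e2 R) w w2.
Hypothesis cw : forall x, D x -> {for x, continuous w}.
Hypothesis bw : forall x, `|w x| <= M.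

Let wv v := if v == e1 R then w1 else w2.

Let wwv v : basis_vec v -> wgrad D v w (wv v).
Proof.
rewrite /wv; move=> [->|->]; first by rewrite eqxx.
by rewrite e21_neq.
Qed.

(** Everything later proofs use about the approximations of w: bounded pointwise convergence for the
    function, but only weak convergence for its derivatives, against L^2 functions supported in a
    compact subset of D. *)
Lemma mollify : exists w_ : nat -> R * R -> R, [/\ forall n, smooth (w_ n),
  forall n x, `|w_ n x| <= M,
  forall x, D x -> w_ n x @[n --> \oo] --> w x,
  (forall n x, 'D_(e1 R) (fun y => 'D_(e2 R) (w_ n) y) x = 'D_(e2 R) (fun y => 'D_(e1 R) (w_ n) y) x) &
  forall v G K, basis_vec v -> compact K -> K `<=` D -> sqi mu G -> (forall x, ~ K x -> G x = 0) ->
    \int[mu]_x (G x * 'D_v (w_ n) x) @[n --> \oo] --> \int[mu]_x (G x * wv v x)].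
Proof.
have [iw _] := wgrad_integ ww1.
have mw := integ_meas iw.
pose r_ (n : nat) : R := n.+1%:R^-1.
have r0 n : 0 < r_ n by rewrite invr_gt0.
have rc : r_ n @[n --> \oo] --> (0 : R) by exact: cvg_harmonic.
exists (fun n => conv (r_ n) w); split.
- by move=> n; exact: conv_smooth.
- by move=> n x; exact: conv_bounded.
- by move=> x Dx; apply: (@conv_cvg _ _ _ _ M) => //; exact: cw.
- have m1 : rmeas (fun t : plane R => (id t).1) by exact: measurable_fst.
  have m2 : rmeas (fun t : plane R => (id t).2) by exact: measurable_snd.
  have b1 : basis_vec (e1 R) by left. have b2 : basis_vec (e2 R) by right.
  move=> n x; have tm := moll_test (r0 n).
  have E v : basis_vec v -> (fun y => 'D_v (conv (r_ n) w) y) =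
      superpos mu id w (fun y => 'D_v (moll (r_ n)) y).
    by move=> bv; apply/funext => y; have [] := superpos_derive m1 m2 iw y bv tm.
  have S1 := superpos_derive m1 m2 iw x b1 (test_derive b2 tm).
  have S2 := superpos_derive m1 m2 iw x b2 (test_derive b1 tm).
  have g1 := congr1 (fun f => 'D_(e1 R) f x) (E _ b2).
  have g2 := congr1 (fun f => 'D_(e2 R) f x) (E _ b1).
  apply: (etrans g1); apply/esym; apply: (etrans g2).
  have [_ q1] := S1; have [_ q2] := S2.
  apply: (etrans q2); apply/esym; apply: (etrans q1).
  have Ef : (fun y => 'D_(e1 R) (fun z => 'D_(e2 R) (moll (r_ n)) z) y) =
      (fun y => 'D_(e2 R) (fun z => 'D_(e1 R) (moll (r_ n)) z) y).
    by apply/funext => y; exact: (moll_derive_sym (r_ n) y b2 b1).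
  exact: (congr1 (fun g => superpos mu id w g x) Ef).
- move=> v G K bv cK KD sG G0; have ww := wwv bv.
  have [_ ig] := wgrad_integ ww; have [_ sg _ _ _] := ww.
  have [k k0 Kk] := compact_cube cK.
  have := @conv_weak R r_ r0 rc (- k, - k) (k, k) (wv v) G ig sg sG.
  have G0k x : ~ obox (- k, - k) (k, k) x -> G x = 0 by move=> nx; apply: G0 => /Kk.
  move=> /(_ G0k); apply: cvg_trans; apply: near_eq_cvg.
  have := disc_near cK KD r0 rc.
  apply: filterS => n Hn; apply: eq_int => x.
  have [Kx|nKx] := pselect (K x); last by rewrite G0// !mul0r.
  by rewrite (conv_wgrad bv (r0 n) ww (Hn x Kx)).
Qed.

(** The equation of A should be tested with phi w, which is not smooth. With w bounded and
    continuous, dominated convergence settles the two terms free of derivatives of w, and weak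
    convergence settles the third. *)
Lemma weak_product v A Av phi : basis_vec v -> wgrad D v A Av -> test_function D phi ->
  \int[mu]_x (Av x * (phi x * w x)) + \int[mu]_x (A x * (phi x * wv v x))
  + \int[mu]_x (A x * (w x * 'D_v phi x)) = 0.
Proof.
move=> bv wA tphi; have [sA sAv A0 Av0 H] := wA.
have [w_ [sw bw_ cw_ _ weak]] := mollify.
have [sphi [K [cK KD phi0]]] := tphi.
have [C C0 phiC] := test_bounded tphi.
have [C' C'0 dphiC] := test_bounded (test_derive bv tphi).
have mphi := test_meas tphi; have mdphi := test_meas (test_derive bv tphi).
have mw : rmeas (w : plane R -> R) by have [/sqi_meas] := ww1.
have [iA iAv] := wgrad_integ wA.
have M0 : 0 <= M by rewrite (le_trans _ (bw 0)).
have dphi0 x : ~ K x -> 'D_v phi x = 0 by apply: zero_off_derive => //; exact: compact_plane_closed.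
(* test the equation of A with phi * w_n *)
have eqn n : \int[mu]_x (Av x * (phi x * w_ n x)) + \int[mu]_x ((A x * phi x) * 'D_v (w_ n) x)
    + \int[mu]_x (A x * (w_ n x * 'D_v phi x)) = 0.
  have tn : test_function D (fun x => phi x * w_ n x) by exact: testMr.
  have i1 : integ mu (fun x => (A x * phi x) * 'D_v (w_ n) x).
    have td : test_function D (fun x => phi x * 'D_v (w_ n) x).
      by apply: testMr => //; exact: smooth_derive.
    have := sqi_mul sA (test_sqi td).
    by congr integ; apply/funext => x; rewrite mulrA.
  have i2 : integ mu (fun x => A x * (w_ n x * 'D_v phi x)).
    have td : test_function D (fun x => w_ n x * 'D_v phi x).
      by apply: testMl => //; exact: test_derive.
    exact: (sqi_mul sA (test_sqi td)).
  rewrite -addrA -intD// (_ : \int[mu]_x (_ + _) = \int[mu]_x (A x * 'D_v (fun x => phi x * w_ n x) x)).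
    by rewrite H// subrr.
  by apply: eq_int => x; rewrite deriveMs//; ring.
have L1 : \int[mu]_x (Av x * (phi x * w_ n x)) @[n --> \oo] --> \int[mu]_x (Av x * (phi x * w x)).
  apply: (@int_cvg _ (plane R) R mu _ _ (fun x => C * M * `|Av x|)).
  - by move=> n; apply: rmeasM; [exact: sqi_meas sAv|apply: rmeasM => //; exact: smooth_meas].
  - by apply: rmeasM; [exact: sqi_meas sAv|exact: rmeasM].
  - apply: aeW => x; have [Kx|nKx] := pselect (K x).
      by apply: cvgM; [exact: cvg_cst|apply: cvgM; [exact: cvg_cst|exact/cw_/KD]].
    by under eq_fun do rewrite phi0// mul0r; rewrite phi0// mul0r; exact: cvg_cst.
  - by apply: integZ; exact: integ_norm.
  - by move=> n x; rewrite !normrM mulrC ler_wpM2r// ler_pM.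
have L3 : \int[mu]_x (A x * (w_ n x * 'D_v phi x)) @[n --> \oo] --> \int[mu]_x (A x * (w x * 'D_v phi x)).
  apply: (@int_cvg _ (plane R) R mu _ _ (fun x => M * C' * `|A x|)).
  - by move=> n; apply: rmeasM; [exact: sqi_meas sA|apply: rmeasM => //; exact: smooth_meas].
  - by apply: rmeasM; [exact: sqi_meas sA|exact: rmeasM].
  - apply: aeW => x; have [Kx|nKx] := pselect (K x).
      by apply: cvgM; [exact: cvg_cst|apply: cvgM; [exact/cw_/KD|exact: cvg_cst]].
    by under eq_fun do rewrite dphi0// !mulr0; rewrite dphi0// !mulr0; exact: cvg_cst.
  - by apply: integZ; exact: integ_norm.
  - by move=> n x; rewrite !normrM mulrC ler_wpM2r// ler_pM.
have sAphi : sqi mu (fun x => A x * phi x).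
  have := @sqiM_bounded _ (plane R) R mu A phi C mphi phiC sA.
  by congr sqi; apply/funext => x; rewrite mulrC.
have L2 := weak v (fun x => A x * phi x) K bv cK KD sAphi _.
have {}L2 := L2 (fun x nKx => etrans (congr1 (fun t => A x * t) (phi0 x nKx)) (mulr0 _)).
have -> : \int[mu]_x (A x * (phi x * wv v x)) = \int[mu]_x (A x * phi x * wv v x).
  by apply: eq_int => x; rewrite mulrA.
apply: (cvg_unique _ (cvgD (cvgD L1 L2) L3)); first exact: Rhausdorff.
rewrite (_ : _ + _ = fun=> 0); first exact: cvg_cst.
by apply/funext => n; exact: eqn.
Qed.

(* The Jacobian of two weakly differentiable functions is a divergence. *)
Lemma weak_jacobian a a1 a2 phi : wgrad D (e1 R) a a1 -> wgrad D (e2 R) a a2 ->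
  test_function D phi ->
  \int[mu]_x (a1 x * phi x * w2 x) - \int[mu]_x (a2 x * phi x * w1 x) =
  - (\int[mu]_x (a x * 'D_(e1 R) phi x * w2 x) - \int[mu]_x (a x * 'D_(e2 R) phi x * w1 x)).
Proof.
move=> wa1 wa2 tphi; have [sa sa1 a0 a10 H1] := wa1; have [_ sa2 _ a20 H2] := wa2.
have [w_ [sw bw_ cw_ sym weak]] := mollify.
have [sphi [K [cK KD phi0]]] := tphi.
have b1 : basis_vec (e1 R) by left. have b2 : basis_vec (e2 R) by right.
have cl := compact_plane_closed cK.
have wv1 : wv (e1 R) = w1 by rewrite /wv eqxx.
have wv2 : wv (e2 R) = w2.
  by rewrite /wv e21_neq.
have lim u psi v : sqi mu u -> test_function D psi -> (forall x, ~ K x -> psi x = 0) -> basis_vec v ->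
    \int[mu]_x (u x * psi x * 'D_v (w_ n) x) @[n --> \oo] --> \int[mu]_x (u x * psi x * wv v x).
  move=> su tpsi psi0 bv; have [C C0 psiC] := test_bounded tpsi.
  apply: (weak v _ K) => //.
    have := @sqiM_bounded _ (plane R) R mu u psi C (test_meas tpsi) psiC su.
    by congr sqi; apply/funext => x; rewrite mulrC.
  by move=> x nKx; rewrite psi0// mulr0.
have Q n : \int[mu]_x (a x * (phi x * 'D_(e1 R) (fun y => 'D_(e2 R) (w_ n) y) x)) =
    \int[mu]_x (a x * (phi x * 'D_(e2 R) (fun y => 'D_(e1 R) (w_ n) y) x)).
  exact: (congr1 (fun g : R * R -> R => \int[mu]_x (a x * (phi x * g x))) (funext (sym n))).
have td1 := test_derive b1 tphi; have td2 := test_derive b2 tphi.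
have z1 x : ~ K x -> 'D_(e1 R) phi x = 0 by exact: zero_off_derive.
have z2 x : ~ K x -> 'D_(e2 R) phi x = 0 by exact: zero_off_derive.
have La := cvgB (lim a1 phi (e2 R) sa1 tphi phi0 b2) (lim a2 phi (e1 R) sa2 tphi phi0 b1).
have Lb := cvgN (cvgB (lim a _ (e2 R) sa td1 z1 b2) (lim a _ (e1 R) sa td2 z2 b1)).
rewrite wv1 wv2 in La Lb.
have T n := opp_sub_cancel (wgrad_ibp b1 b2 wa1 tphi (sw n)) (wgrad_ibp b2 b1 wa2 tphi (sw n)) (Q n).
apply: (cvg_unique _ (La _)); first exact: Rhausdorff.
apply: cvg_trans (Lb _ _); apply: near_eq_cvg; apply: nearW => n /=.
rewrite !fctE.
exact: T.
Qed.

End product_rules.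
End weak_gradients.

(** * From Sobolev spaces on D to functions extended by 0 *)

Section sobolev.
Context {R : realType}.
Local Notation mu := (leb2 R).
Implicit Types (x y v : R * R) (K : set (R * R)) (f g u phi eta : R * R -> R).

Definition ext (D : set (R * R)) f x : R := \1_D x * f x.

Lemma extT (D : set (R * R)) f x : D x -> ext D f x = f x.
Proof. by move=> Dx; rewrite /ext indicT// mul1r. Qed.

Lemma extF (D : set (R * R)) f x : ~ D x -> ext D f x = 0.
Proof. by move=> Dx; rewrite /ext indicF// mul0r. Qed.

Lemma ext_patch (D : set (R * R)) f : f \_ D = ext D f.
Proof.
apply/funext => x; rewrite patchE.
by case: ifPn => [/set_mem Dx|/negP nD]; [rewrite extT|rewrite extF// => Dx; apply: nD; exact: mem_set].
Qed.

Lemma int_ext (D : set (R * R)) f : \int[mu]_(x in D) f x = \int[mu]_x ext D f x.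
Proof. by rewrite Rintegral_mkcond ext_patch. Qed.

Lemma L2P (D : set (R * R)) f : L2 D f <-> sqi mu (ext D f).
Proof.
rewrite /L2 ext_patch; split => [H|[mf fi]].
  split; last exact: Lfun2_integrable_sqr.
  by move: H; rewrite inE => /andP[mf _]; move: mf; rewrite inE.
rewrite inE; apply/andP; split; rewrite inE//=.
rewrite /finite_norm unlock poweR_lty//.
have /integrableP[_] := fi; congr (_ < _)%E.
apply: eq_integral => x _ /=; rewrite powR_mulrn// real_normK// ?num_real//.
by rewrite ger0_norm// sqr_ge0.
Qed.

Lemma compact_cover (D : set (R * R)) x : open D -> D x ->
  exists2 q, rbox q x & exists2 K, compact K & (rbox q `<=` K /\ K `<=` D).
Proof.
move=> oD Dx; have [e e0 He] := open_oboxP oD Dx.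
have Ox : obox (x.1 - e / 2, x.2 - e / 2) (x.1 + e / 2, x.2 + e / 2) x.
  by rewrite oboxE /=; split; apply/andP; split; lra.
have [q qO qx] : (\bigcup_(q in [set q | (rbox q : set (R * R)) `<=`
    obox (x.1 - e / 2, x.2 - e / 2) (x.1 + e / 2, x.2 + e / 2)]) rbox q) x.
  by rewrite -open_bigcup_rbox//; exact: obox_open.
exists q => //; exists (cbox x (e / 2)); first exact: cbox_compact.
split => [y /qO|y].
  rewrite oboxE /cbox /= !ler_norml => -[/andP[? ?] /andP[? ?]].
  by split; apply/andP; split; lra.
rewrite /cbox /= !ler_norml => -[/andP[? ?] /andP[? ?]]; apply: He; rewrite oboxE /=.
by split; apply/andP; split; lra.
Qed.

(** Local integrability yields measurability on compact subsets only; countably many rational boxes,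
    each inside a compact subset of D, patch it together. *)
Lemma loc_integrable_meas (D : set (R * R)) f : open D -> loc_integrable D f -> rmeas (ext D f : plane R -> R).
Proof.
move=> oD lf.
have mD : measurable (D : set (plane R)) := open_plane_measurable oD.
rewrite -ext_patch.
suff mf : measurable_fun (D : set (plane R)) (f : plane R -> measurableTypeR R).
  exact: (@measurable_restrictT _ _ (plane R) (measurableTypeR R) D f mD).1 mf.
move=> _ Y mY.
pose Q := [set q | exists2 K, compact K & ((rbox q : set (R * R)) `<=` K /\ K `<=` D)].
have E : D `&` f @^-1` Y = \bigcup_(q in setT) (if `[< Q q >] then rbox q `&` (f @^-1` Y) else set0).
  apply/seteqP; split => x.
    move=> [Dx fY]; have [q qx HK] := compact_cover oD Dx; exists q => //; rewrite asboolT//.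
  by move=> [q _]; case: asboolP => // -[K cK [qK KD]] [qx fY]; split => //; exact/KD/qK.
have : measurable (\bigcup_(q in setT) (if `[< Q q >] then rbox q `&` (f @^-1` Y) else set0) : set (plane R)).
  apply: count_bigcup_measurable => q; case: asboolP => // -[K cK [qK KD]].
  have mf := integ_meas (integ_of_compact cK (lf K cK KD)).
  have F : rbox q `&` (f @^-1` Y) = rbox q `&` ((fun x => \1_K x * f x) @^-1` Y).
    by apply/seteqP; split => x [qx]; rewrite /preimage /= => fY; split => //;
      move: fY; rewrite indicT ?mul1r//; exact: qK.
  have : measurable (rbox q `&` ((fun x => \1_K x * f x) @^-1` Y) : set (plane R)).
    apply: measurableI; first exact: measurable_obox.
    by rewrite -[X in measurable X]setTI; exact: mf.
  by congr measurable.
by congr measurable.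
Qed.

Variables (D : set (R * R)) (rD : R).
Hypothesis oD : open D.
Hypothesis bD : D `<=` cube rD.

Let mD : measurable (D : set (plane R)). Proof. exact: open_plane_measurable. Qed.

Lemma ext_integ f : sqi mu (ext D f) -> integ mu (ext D f).
Proof. by move=> sf; apply: (sqi_integ (r := rD)) => // x nx; apply: extF => /bD. Qed.

Lemma sqi_loc_integrable f : sqi mu (ext D f) -> loc_integrable D f.
Proof.
move=> /ext_integ fi K cK KD; have mK := compact_plane_measurable cK.
have := integrableS measurableT mK (@subsetT _ K) fi.
apply: eq_integrable => // x /set_mem Kx /=; rewrite extT//; exact: KD.
Qed.

Lemma ext_Dphi v f phi : test_function D phi -> basis_vec v ->
  \int[mu]_(x in D) (f x * 'D_v phi x) = \int[mu]_x (ext D f x * 'D_v phi x).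
Proof.
by move=> _ _; rewrite int_ext; apply: eq_int => x; rewrite /ext mulrA.
Qed.

Lemma is_wpartialP v f g : basis_vec v -> sqi mu (ext D f) -> sqi mu (ext D g) ->
  is_wpartial D v f g <-> wgrad D v (ext D f) (ext D g).
Proof.
move=> bv sf sg; split => [[_ _ H]|[_ _ _ _ H]].
  split => //; [by move=> x /extF ->|by move=> x /extF ->|move=> phi tphi].
  rewrite -ext_Dphi// H// (int_ext D); apply: congr1; apply: (@eq_int _ (plane R) R mu) => x; rewrite /ext mulrA //.
split; [exact: sqi_loc_integrable..|move=> phi tphi].
by rewrite ext_Dphi// H// (int_ext D); apply: congr1; apply: (@eq_int _ (plane R) R mu) => x; rewrite /ext mulrA.
Qed.

Lemma W12_wgrad v u : basis_vec v -> W12 D u -> wgrad D v (ext D u) (ext D (wpartial D v u)).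
Proof.
move=> bv [/L2P su H]; have [wu /L2P swu] := H v bv.
exact/is_wpartialP.
Qed.

(** [wpartial] is a chosen representative; through this uniqueness it agrees almost everywhere with
    any weak derivative computed by hand. *)
Lemma wpartial_unique v u g g' : loc_integrable D g -> loc_integrable D g' ->
  is_wpartial D v u g -> is_wpartial D v u g' -> eq_ae D g g'.
Proof.
move=> lg lg' [_ _ H] [_ _ H'].
have lB : loc_integrable D (fun x => g x - g' x).
  move=> K cK KD; have mK := compact_plane_measurable cK.
  have := integrableB mK (lg K cK KD) (lg' K cK KD).
  by apply: eq_integrable.
have [] // := @du_bois_reymond R D (fun x => g x - g' x) oD lB _ => [phi tphi|N [mN N0 HN]].
  have [sphi [K [cK KD phi0]]] := tphi.
  have mK := compact_plane_measurable cK.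
  have [C C0 phiC] := test_bounded tphi.
  have E h : loc_integrable D h -> \int[mu]_(x in D) (h x * phi x) = \int[mu]_x (phi x * (\1_K x * h x))
      /\ integ mu (fun x => phi x * (\1_K x * h x)).
    move=> lh; split.
      rewrite (int_restrict KD); last by move=> x /phi0 ->; rewrite mulr0.
      apply: eq_int => x; have [Kx|nKx] := pselect (K x); first by rewrite indicT// mul1r mulrC.
      by rewrite phi0// mulr0 mul0r.
    exact: (integM_bounded (test_meas tphi) phiC (integ_of_compact cK (lh K cK KD))).
  have [e1 i1] := E _ lB; have [e2 i2] := E _ lg; have [e3 i3] := E _ lg'.
  rewrite e1 (_ : \int[mu]_x _ = \int[mu]_x (phi x * (\1_K x * g x) - phi x * (\1_K x * g' x))).
    rewrite intB// -e2 -e3; apply/eqP; rewrite subr_eq0; apply/eqP/oppr_inj.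
    by rewrite -H// -H'.
  by apply: eq_int => x; ring.
exists N; split => // x nx; apply: HN => /= Dx; apply: nx => /Dx /eqP; rewrite subr_eq0 => /eqP.
by [].
Qed.

Lemma wgrad_wpartial v u g : basis_vec v -> wgrad D v (ext D u) (ext D g) ->
  [/\ is_wpartial D v u (wpartial D v u), L2 D (wpartial D v u) & eq_ae D (wpartial D v u) g].
Proof.
move=> bv wu; have [su sg _ _ _] := wu.
have wp : is_wpartial D v u g by exact/is_wpartialP.
have wp' : is_wpartial D v u (wpartial D v u) by exact: getI wp.
have [lu lg _] := wp; have [_ lg' _] := wp'.
have ae := wpartial_unique lg' lg wp' wp; split => //.
apply/L2P; have mg' := loc_integrable_meas oD lg'; split => //.
have i1 := sqi_sq sg; have m1 : rmeas (fun x : plane R => ext D (wpartial D v u) x ^+ 2) by exact: rmeasM.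
apply/integrableP; split; first exact/measurable_EFinP.
have /integrableP[_] := i1; congr (_ < _)%E.
apply: (@ae_eq_integral _ (plane R) R mu setT) => //.
- by apply/measurable_EFinP; apply: rmeas_norm; exact: integ_meas i1.
- by apply/measurable_EFinP; exact: rmeas_norm.
- apply: (ae_imp ae) => x /= H _; rewrite /ext.
  have [Dx|nDx] := pselect (D x); first by rewrite H.
  by rewrite indicF// !mul0r.
Qed.

Lemma wgrad_W12 u g1 g2 : wgrad D (e1 R) (ext D u) (ext D g1) -> wgrad D (e2 R) (ext D u) (ext D g2) ->
  [/\ W12 D u, eq_ae D (wpartial D (e1 R) u) g1 & eq_ae D (wpartial D (e2 R) u) g2].
Proof.
move=> w1 w2; have b1 : basis_vec (e1 R) by left. have b2 : basis_vec (e2 R) by right.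
have [p1 l1 a1] := wgrad_wpartial b1 w1; have [p2 l2 a2] := wgrad_wpartial b2 w2.
split; [|exact: a1|exact: a2]; split; first by apply/L2P; case: w1.
by move=> v [->|->]; split; [exact: p1|exact: l1|exact: p2|exact: l2].
Qed.

End sobolev.

(** * The Ginzburg-Landau system in real form *)

Section complex_parts.
Context {R : realType}.
Implicit Types z w : R[i].

Lemma cReM z w : complex.Re (z * w) = complex.Re z * complex.Re w - complex.Im z * complex.Im w.
Proof. by case: z w => [a b] [c d]. Qed.
Lemma cImM z w : complex.Im (z * w) = complex.Re z * complex.Im w + complex.Im z * complex.Re w.
Proof. by case: z w => [a b] [c d]. Qed.
Lemma cReD z w : complex.Re (z + w) = complex.Re z + complex.Re w.
Proof. by case: z w => [a b] [c d]. Qed.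
Lemma cImD z w : complex.Im (z + w) = complex.Im z + complex.Im w.
Proof. by case: z w => [a b] [c d]. Qed.
Lemma cReN z : complex.Re (- z) = - complex.Re z.
Proof. by case: z. Qed.
Lemma cImN z : complex.Im (- z) = - complex.Im z.
Proof. by case: z. Qed.
Lemma Re_conjc z : complex.Re (conjc z) = complex.Re z.
Proof. by case: z. Qed.
Lemma Im_conjc z : complex.Im (conjc z) = - complex.Im z.
Proof. by case: z. Qed.
Lemma cabs_sq z : cabs z ^+ 2 = complex.Re z ^+ 2 + complex.Im z ^+ 2.
Proof. by case: z => a b; rewrite /cabs /= sqr_sqrtr// addr_ge0// sqr_ge0. Qed.
Definition partsE := (cReM, cImM, cReD, cImD, cReN, cImN, Re_conjc, Im_conjc).
Lemma neg_iC_div (r : R) : - 'i%C / r%:C%C = (0 +i* - r^-1)%C :> R[i].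
Proof.
rewrite -(fmorphV (real_complex R)); apply/eqP; rewrite eq_complex !partsE /=.
by apply/andP; split; apply/eqP; ring.
Qed.

Lemma Re_pA1 (D : set (R * R)) (A : R * R -> R * R) psi x :
  complex.Re (pA D A psi x).1 = wpartial D (e1 R) (im_part psi) x + (A x).1 * re_part psi x.
Proof. by rewrite /pA /gradC /re_part /= !partsE /= oppr0 mul0r mulN1r opprK mul0r subr0 add0r. Qed.

Lemma Im_pA1 (D : set (R * R)) (A : R * R -> R * R) psi x :
  complex.Im (pA D A psi x).1 = - wpartial D (e1 R) (re_part psi) x + (A x).1 * im_part psi x.
Proof. by rewrite /pA /gradC /im_part /= !partsE /= oppr0 mul0r mulN1r mul0r add0r addr0. Qed.

Lemma Re_pA2 (D : set (R * R)) (A : R * R -> R * R) psi x :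
  complex.Re (pA D A psi x).2 = wpartial D (e2 R) (im_part psi) x + (A x).2 * re_part psi x.
Proof. by rewrite /pA /gradC /re_part /= !partsE /= oppr0 mul0r mulN1r opprK mul0r subr0 add0r. Qed.

Lemma Im_pA2 (D : set (R * R)) (A : R * R -> R * R) psi x :
  complex.Im (pA D A psi x).2 = - wpartial D (e2 R) (re_part psi) x + (A x).2 * im_part psi x.
Proof. by rewrite /pA /gradC /im_part /= !partsE /= oppr0 mul0r mulN1r mul0r add0r addr0. Qed.

(** The second component serves for testing with fields (0, V). The weak derivatives of conj psi are
    choices of their own and are left as they stand here. *)
Lemma Re_current2 (D : set (R * R)) (kappa H : R) psi (A : R * R -> R * R) x : kappa != 0 -> H != 0 ->
  complex.Re (current D kappa H psi A x).2 =
  (re_part psi x * (wpartial D (e2 R) (im_part psi) x - wpartial D (e2 R) (im_part (fun y => conjc (psi y))) x)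
   - im_part psi x * (wpartial D (e2 R) (re_part psi) x + wpartial D (e2 R) (re_part (fun y => conjc (psi y))) x)) / (2 * (kappa * H))
  + (re_part psi x ^+ 2 + im_part psi x ^+ 2) * (A x).2.
Proof.
move=> k0 H0; rewrite /current /= neg_iC_div !partsE /= cabs_sq /re_part /im_part.
by field; rewrite k0 H0.
Qed.

End complex_parts.

(** * Calculus of weak gradients on bounded sets *)

Section weak_gradient_calculus.
Context {R : realType}.
Local Notation mu := (leb2 R).
Implicit Types (x y v : R * R) (K : set (R * R)) (f g u phi eta : R * R -> R).

Lemma wgrad_ae (D : set (R * R)) v u u' g : basis_vec v -> wgrad D v u g -> rmeas (u' : plane R -> R) ->
  {ae mu, forall x, u x = u' x} -> (forall x, ~ D x -> u' x = 0) -> wgrad D v u' g.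
Proof.
move=> bv [su sg u0 g0 H] mu' uu' u'0.
have su' : sqi mu u'.
  split => //; have [] // := @int_ae_eq _ (plane R) R mu (fun x => u x ^+ 2) (fun x => u' x ^+ 2) (sqi_sq su).
    exact: rmeasM.
  by apply: (ae_imp uu') => x ->.
split => // phi tphi; rewrite -(H phi tphi); apply/esym.
have std := test_sqi (test_derive bv tphi).
have ae' : {ae mu, forall x, u x * 'D_v phi x = u' x * 'D_v phi x} by apply: (ae_imp uu') => x ->.
exact: (@int_ae_eq _ (plane R) R mu _ _ (sqi_mul su std) (rmeasM mu' (sqi_meas std)) ae').2.
Qed.

Lemma wgradN (D : set (R * R)) v u g : basis_vec v -> wgrad D v u g -> wgrad D v (fun x => - u x) (fun x => - g x).
Proof.
move=> bv [su sg u0 g0 H]; split.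
- exact: sqiN.
- exact: sqiN.
- by move=> x /u0 ->; rewrite oppr0.
- by move=> x /g0 ->; rewrite oppr0.
move=> phi tphi; have std := test_sqi (test_derive bv tphi); have st := test_sqi tphi.
rewrite (_ : \int[mu]_x _ = \int[mu]_x (- (u x * 'D_v phi x))); last first.
  by apply: (@eq_int _ (plane R) R mu) => x; rewrite mulNr.
rewrite (_ : \int[mu]_x (- g x * phi x) = \int[mu]_x (- (g x * phi x))); last first.
  by apply: (@eq_int _ (plane R) R mu) => x; rewrite mulNr.
by rewrite !intN ?H//; exact: sqi_mul.
Qed.

Lemma ext_cont (D : set (R * R)) f x : open D -> {within closure D, continuous f} -> D x ->
  {for x, continuous (ext D f)}.
Proof.
move=> oD cf Dx.
have := continuous_subspaceW (@subset_closure _ D) cf.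
rewrite continuous_open_subspace// => /(_ x (mem_set Dx)) cfx.
have := @cvgM R _ (nbhs x) _ (\1_D : R * R -> R) f _ _ (indic_cont_in oD Dx) cfx.
by apply.
Qed.

Lemma ext_meas (D : set (R * R)) f : open D -> {within closure D, continuous f} ->
  rmeas (ext D f : plane R -> R).
Proof.
move=> oD cf; have mD : measurable (D : set (plane R)) := open_plane_measurable oD.
have := continuous_subspaceW (@subset_closure _ D) cf.
rewrite continuous_open_subspace// => /(continuous_inP _ oD) H.
rewrite -ext_patch; apply: (@measurable_restrictT _ _ (plane R) (measurableTypeR R) D f mD).1.
apply: (measurability (@measurable_realfun.RGenOpens.G R) (measurable_realfun.RGenOpens.measurableE R)).
move=> _ [_ [a [b ->] <-]]; apply: open_plane_measurable.
by apply: H; exact: interval_open.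
Qed.

(** A strict violation at one point would persist on a box of positive measure. This turns the bound
    by the sup norm into a pointwise one for the continuous representative. *)
Lemma ae_le_cont (D : set (R * R)) g (c : R) : open D ->
  (forall x, D x -> {for x, continuous g}) -> {ae mu, forall x, D x -> g x <= c} ->
  forall x, D x -> g x <= c.
Proof.
move=> oD cg [N [mN N0 HN]] x Dx; rewrite leNgt; apply/negP => cx.
have gx : nbhs x [set y | c < g y] by apply: (cvgr_gt _ (cg x Dx) _ cx).
have Dn : nbhs x D by exact: open_nbhs_nbhs.
have Ux : ([set y | c < g y] `&` D)^° x by exact: filterI gx Dn.
have [e e0 He] := open_oboxP (@open_interior _ _) Ux; have HU := @interior_subset _ ([set y | c < g y] `&` D).
have bE : obox (x.1 - e, x.2 - e) (x.1 + e, x.2 + e) `<=` N.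
  move=> y; rewrite oboxE /= => -[/andP[? ?] /andP[? ?]].
  apply: HN => /= Hy.
  have [gy Dy] : [set y | c < g y] y /\ D y.
    by apply: HU; apply: He; rewrite oboxE /=; split; apply/andP; split.
  by have := Hy Dy; rewrite leNgt gy.
have : (mu (obox ((x.1 - e)%R, (x.2 - e)%R) ((x.1 + e)%R, (x.2 + e)%R)) <= mu N)%E.
  by apply: le_measure => //; rewrite inE//; exact: measurable_obox.
rewrite N0 leb2_obox /=; [|lra|lra].
apply/negP; rewrite -ltNge lte_fin; apply: mulr_gt0; lra.
Qed.

Section on_bounded_sets.
Variables (D : set (R * R)) (rD : R).
Hypothesis oD : open D.
Hypothesis bD : D `<=` cube rD.

Lemma smooth_ext_bounded f : smooth f -> exists2 C : R, 0 <= C & forall x, `|ext D f x| <= C.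
Proof.
move=> sf; have cK := @cbox_compact R 0 rD.
have [C C0 HC] := continuous_compact_bounded cK (smooth_cont sf).
exists C => // x; have [Dx|nDx] := pselect (D x); last by rewrite extF// normr0.
rewrite extT//; apply: HC; move: (bD Dx); rewrite /cube oboxE /cbox /= !ler_norml !sub0r => -[/andP[? ?] /andP[? ?]].
by split; apply/andP; split; lra.
Qed.

Lemma smooth_ext_sqi f : smooth f -> sqi mu (ext D f).
Proof.
move=> sf; have [C C0 HC] := smooth_ext_bounded sf.
have mD : measurable (D : set (plane R)) := open_plane_measurable oD.
apply: (@sqi_bounded _ (plane R) R mu _ C (cube rD)) => //.
- exact: cube_meas.
- exact: leb2_cube_lty.
- by apply: rmeasM; [exact: rmeas_indic|exact: smooth_meas].
- by move=> x nx; apply: extF => /bD.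
Qed.

Lemma smoothM_sqi f u : smooth f -> sqi mu u -> (forall x, ~ D x -> u x = 0) -> sqi mu (fun x => f x * u x).
Proof.
move=> sf su u0; have [C C0 HC] := smooth_ext_bounded sf.
have mD : measurable (D : set (plane R)) := open_plane_measurable oD.
have := @sqiM_bounded _ (plane R) R mu u (ext D f) C (rmeasM (rmeas_indic mD) (smooth_meas sf)) HC su.
congr sqi; apply/funext => x; have [Dx|nDx] := pselect (D x); first by rewrite extT.
by rewrite u0// !mulr0.
Qed.

Lemma wgrad_mul v u g eta : basis_vec v -> wgrad D v u g -> smooth eta ->
  wgrad D v (fun x => eta x * u x) (fun x => eta x * g x + 'D_v eta x * u x).
Proof.
move=> bv [su sg u0 g0 H] se; have sde := smooth_derive se bv.
split.
- exact: smoothM_sqi.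
- by apply: sqiD; exact: smoothM_sqi.
- by move=> x /u0 ->; rewrite mulr0.
- by move=> x nx; rewrite u0// g0// !mulr0 addr0.
move=> phi tphi; have sphi := test_smooth tphi.
have t1 := testMl se tphi; have t2 := testMl sde tphi.
have i1 := sqi_mul sg (test_sqi t1); have i2 := sqi_mul su (test_sqi t2).
have i3 := sqi_mul su (test_sqi (test_derive bv t1)).
rewrite (_ : \int[mu]_x _ = \int[mu]_x (u x * 'D_v (fun x => eta x * phi x) x - u x * ('D_v eta x * phi x))); last first.
  by apply: (@eq_int _ (plane R) R mu) => x; rewrite deriveMs//; ring.
rewrite (_ : \int[mu]_x ((_ + _) * _) = \int[mu]_x (g x * (eta x * phi x) + u x * ('D_v eta x * phi x))); last first.
  by apply: (@eq_int _ (plane R) R mu) => x; ring.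
by rewrite intB// intD// H// opprD.
Qed.

Lemma wgrad_smooth v eta : basis_vec v -> smooth eta -> wgrad D v (ext D eta) (ext D (fun x => 'D_v eta x)).
Proof.
move=> bv se; have sde := smooth_derive se bv.
split; [exact: smooth_ext_sqi|exact: smooth_ext_sqi|by move=> x /extF ->|by move=> x /extF ->|].
move=> phi tphi; have sphi := test_smooth tphi.
have dphi := test_derive bv tphi.
have t0 := testMl se tphi; have t1 := testMl se dphi; have t2 := testMl sde tphi.
have [_ [K [cK KD phi0]]] := tphi.
have z x : ~ D x -> 'D_v phi x = 0.
  move=> nDx; apply: (zero_off_derive v (compact_plane_closed cK) phi0) => /KD; exact: nDx.
rewrite (_ : \int[mu]_x _ = \int[mu]_x (eta x * 'D_v phi x)); last first.
  apply: (@eq_int _ (plane R) R mu) => x; have [Dx|nDx] := pselect (D x); first by rewrite extT.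
  by rewrite z// !mulr0.
rewrite (_ : \int[mu]_x (_ * phi x) = \int[mu]_x ('D_v eta x * phi x)); last first.
  apply: (@eq_int _ (plane R) R mu) => x; have [Dx|nDx] := pselect (D x); first by rewrite extT.
  by rewrite phi0 ?mulr0// => /KD.
apply/eqP; rewrite -subr_eq0 opprK -(int_derive0 bv t0); apply/eqP.
rewrite -intD; [|exact: (test_integ t1)|exact: (test_integ t2)].
by apply: (@eq_int _ (plane R) R mu) => x; rewrite deriveMs// addrC.
Qed.

End on_bounded_sets.
End weak_gradient_calculus.

Lemma Re_cdot (R : realType) (z w : R[i] * R[i]) : complex.Re (cdot z w) =
  complex.Re z.1 * complex.Re w.1 + complex.Im z.1 * complex.Im w.1
  + (complex.Re z.2 * complex.Re w.2 + complex.Im z.2 * complex.Im w.2).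
Proof. by case: z w => [z1 z2] [w1 w2]; rewrite /cdot /= !partsE !mulrN !opprK. Qed.

Lemma Re_cdot_pA (R : realType) (D : set (R * R)) (A : R * R -> R * R) (psi phi : R * R -> R[i]) x :
  complex.Re (cdot (pA D A psi x) (pA D A phi x)) =
  (wpartial D (e1 R) (im_part psi) x + (A x).1 * re_part psi x)
    * (wpartial D (e1 R) (im_part phi) x + (A x).1 * re_part phi x)
  + (- wpartial D (e1 R) (re_part psi) x + (A x).1 * im_part psi x)
    * (- wpartial D (e1 R) (re_part phi) x + (A x).1 * im_part phi x)
  + ((wpartial D (e2 R) (im_part psi) x + (A x).2 * re_part psi x)
    * (wpartial D (e2 R) (im_part phi) x + (A x).2 * re_part phi x)
  + (- wpartial D (e2 R) (re_part psi) x + (A x).2 * im_part psi x)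
    * (- wpartial D (e2 R) (re_part phi) x + (A x).2 * im_part phi x)).
Proof.
rewrite Re_cdot; congr (_ * _ + _ * _ + (_ * _ + _ * _)).
- exact: Re_pA1.
- exact: Re_pA1.
- exact: Im_pA1.
- exact: Im_pA1.
- exact: Re_pA2.
- exact: Re_pA2.
- exact: Im_pA2.
- exact: Im_pA2.
Qed.

Section real_system.
Context {R : realType}.
Local Notation mu := (leb2 R).
Implicit Types (x y v : R * R) (f g u phi eta V : R * R -> R).

(* For psi = a + i b, [cre] and [cim] are the real and imaginary parts of a
   component of p_{hA} psi, and [moment] is h times a component of the current. *)
Definition cre (h : R) (B u w' : R * R -> R) x := w' x + h * B x * u x.
Definition cim (h : R) (B w u' : R * R -> R) x := - u' x + h * B x * w x.

Definition energy (h : R) (a b a1 a2 b1 b2 A1 A2 : R * R -> R) x :=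
  cre h A1 a b1 x ^+ 2 + cim h A1 b a1 x ^+ 2 + (cre h A2 a b2 x ^+ 2 + cim h A2 b a2 x ^+ 2).

Definition moment (h : R) (a b u' w' B : R * R -> R) x :=
  a x * cre h B a w' x + b x * cim h B b u' x.

(** What the argument retains of the system, with psi = a + i b and all functions extended by 0;
    [A12] is the derivative of A_1 along [e2], [A21] that of A_2 along [e1]. [rg_psi] is the real
    part of the equation tested with eta psi, [rg_A] the Maxwell equation tested with (0, V) and
    multiplied by h. The Neumann conditions allow eta and V to be arbitrary smooth functions,
    nonzero on the boundary. *)
Record real_GL (D : set (R * R)) (kappa h M : R) (a b a1 a2 b1 b2 A1 A2 A12 A21 : R * R -> R) : Prop := {
  rg_a1 : wgrad D (e1 R) a a1;
  rg_a2 : wgrad D (e2 R) a a2;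
  rg_b1 : wgrad D (e1 R) b b1;
  rg_b2 : wgrad D (e2 R) b b2;
  rg_A1 : wgrad D (e2 R) A1 A12;
  rg_A2 : wgrad D (e1 R) A2 A21;
  rg_ca : forall x, D x -> {for x, continuous a};
  rg_cb : forall x, D x -> {for x, continuous b};
  rg_M : forall x, a x ^+ 2 + b x ^+ 2 <= M ^+ 2;
  rg_psi : forall eta, smooth eta ->
    \int[mu]_x (eta x * energy h a b a1 a2 b1 b2 A1 A2 x)
    + \int[mu]_x ('D_(e1 R) eta x * (a x * a1 x + b x * b1 x))
    + \int[mu]_x ('D_(e2 R) eta x * (a x * a2 x + b x * b2 x))
    = kappa ^+ 2 * \int[mu]_x ((1 - (a x ^+ 2 + b x ^+ 2)) * (a x ^+ 2 + b x ^+ 2) * eta x);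
  rg_A : forall V, smooth V ->
    h * \int[mu]_x ((A21 x - A12 x - \1_D x) * 'D_(e1 R) V x)
    = \int[mu]_x (moment h a b a2 b2 A2 x * V x) }.

Lemma sq_bound (M a b : R) : 0 <= M -> a ^+ 2 + b ^+ 2 <= M ^+ 2 -> `|a| <= M /\ `|b| <= M.
Proof.
move=> M0 H; split; rewrite -ler_sqr ?nnegrE// real_normK ?num_real//;
  by apply: le_trans H; rewrite ?lerDl ?lerDr sqr_ge0.
Qed.

Lemma intD3 f g u : integ mu f -> integ mu g -> integ mu u ->
  \int[mu]_x f x + \int[mu]_x g x + \int[mu]_x u x = \int[mu]_x (f x + g x + u x).
Proof. by move=> fi gi ui; rewrite (intD (integD fi gi) ui) (intD fi gi). Qed.

Lemma mul4_eq0 (p1 p2 p3 p4 q1 q2 q3 q4 : R) : p1 = 0 -> p2 = 0 -> p3 = 0 -> p4 = 0 ->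
  p1 * q1 + p2 * q2 + (p3 * q3 + p4 * q4) = 0.
Proof. by move=> -> -> -> ->; rewrite !mul0r !addr0. Qed.

Lemma cre_extT (D : set (R * R)) h B u w' x : D x ->
  cre h (ext D B) (ext D u) (ext D w') x = w' x + h * B x * u x.
Proof. by move=> Dx; rewrite /cre !extT. Qed.

Lemma cim_extT (D : set (R * R)) h B w u' x : D x ->
  cim h (ext D B) (ext D w) (ext D u') x = - u' x + h * B x * w x.
Proof. by move=> Dx; rewrite /cim !extT. Qed.

Lemma integrand_off (p1 p2 p3 p4 a b c d1 d2 u1 w1 u2 w2 : R) :
  p1 = 0 -> p2 = 0 -> p3 = 0 -> p4 = 0 -> a = 0 -> b = 0 ->
  c * (p1 ^+ 2 + p2 ^+ 2 + (p3 ^+ 2 + p4 ^+ 2)) + d1 * (a * u1 + b * w1) + d2 * (a * u2 + b * w2) = 0.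
Proof. by move=> -> -> -> -> -> ->; ring. Qed.

Lemma integrand_on (h c d1 d2 a b a1 a2 b1 b2 A1 A2 : R) :
  c * ((b1 + h * A1 * a) ^+ 2 + (- a1 + h * A1 * b) ^+ 2 + ((b2 + h * A2 * a) ^+ 2 + (- a2 + h * A2 * b) ^+ 2))
  + d1 * (a * a1 + b * b1) + d2 * (a * a2 + b * b2) =
  (b1 + h * A1 * a) * ((c * b1 + d1 * b) + h * A1 * (c * a))
  + (- a1 + h * A1 * b) * (- (c * a1 + d1 * a) + h * A1 * (c * b))
  + ((b2 + h * A2 * a) * ((c * b2 + d2 * b) + h * A2 * (c * a))
  + (- a2 + h * A2 * b) * (- (c * a2 + d2 * a) + h * A2 * (c * b))).
Proof. by ring. Qed.

Lemma cre_val h B u w' x (s t : R) : u x = s -> w' x = t -> cre h B u w' x = t + h * B x * s.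
Proof. by move=> us wt; rewrite /cre us wt. Qed.

Lemma cim_val h B w u' x (s t : R) : w x = s -> u' x = t -> cim h B w u' x = - t + h * B x * s.
Proof. by move=> us wt; rewrite /cim us wt. Qed.

Lemma current_val (h a b a2 b2 A2 V : R) : h != 0 ->
  h^-1 * ((a * (b2 + h * A2 * a) + b * (- a2 + h * A2 * b)) * V) =
  ((a * (b2 - - b2) - b * (a2 + a2)) / (2 * h) + (a ^+ 2 + b ^+ 2) * A2) * V.
Proof. by move=> h0; field. Qed.

Lemma Re_cdot0 (z : R[i] * R[i]) (r : R) : complex.Re (cdot z (0%:C%C, r%:C%C)) = complex.Re z.2 * r.
Proof. by rewrite Re_cdot /= !mulr0 !add0r addr0. Qed.

Lemma eq_curl_mul (p q r s t p' q' r' s' t' : R) : p = p' -> q = q' -> r = r' -> s = s' -> t = t' ->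
  (p - q - r) * (s - t) = (p' - q' - r') * (s' - t').
Proof. by move=> -> -> -> -> ->. Qed.

Lemma mul_sub0 (p s s' t : R) : s = s' -> t = 0 -> p * (s - t) = p * s'.
Proof. by move=> -> ->; rewrite subr0. Qed.

Lemma current_off (u w p q r A V : R) : u = 0 -> w = 0 ->
  ((u * p - w * q) / r + (u ^+ 2 + w ^+ 2) * A) * V = 0.
Proof. by move=> -> ->; ring. Qed.

Lemma eq_current (r V u w p q s t A u' w' p' q' s' t' A' : R) :
  u = u' -> w = w' -> p = p' -> q = q' -> s = s' -> t = t' -> A = A' ->
  ((u * (p - q) - w * (s + t)) / r + (u ^+ 2 + w ^+ 2) * A) * V =
  ((u' * (p' - q') - w' * (s' + t')) / r + (u' ^+ 2 + w' ^+ 2) * A') * V.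
Proof. by move=> -> -> -> -> -> -> ->. Qed.

Lemma subrr3 (z : R) : 0 - 0 - 0 = 0 :> R.
Proof. by rewrite !subr0. Qed.

Lemma cre_off h B u w' x : B x = 0 -> w' x = 0 -> cre h B u w' x = 0.
Proof. by move=> B0 w0; rewrite /cre B0 w0 mulr0 mul0r addr0. Qed.

Lemma cim_off h B w u' x : B x = 0 -> u' x = 0 -> cim h B w u' x = 0.
Proof. by move=> B0 w0; rewrite /cim B0 w0 mulr0 mul0r addr0 oppr0. Qed.

Lemma cre_sqi h B u w' (C : R) : sqi mu B -> sqi mu w' -> rmeas (u : plane R -> R) ->
  (forall x, `|u x| <= C) -> sqi mu (cre h B u w').
Proof.
move=> sB sw mu' uC; apply: sqiD => //.
have := sqiZ h (@sqiM_bounded _ (plane R) R mu B u C mu' uC sB).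
by congr sqi; apply/funext => x; ring.
Qed.

Lemma cim_sqi h B w u' (C : R) : sqi mu B -> sqi mu u' -> rmeas (w : plane R -> R) ->
  (forall x, `|w x| <= C) -> sqi mu (cim h B w u').
Proof. by move=> sB su mw wC; apply: (@cre_sqi h B w (fun x => - u' x) C) => //; exact: sqiN. Qed.

End real_system.

(** * Reduction of the complex system to its real form *)

Section extraction.
Context {R : realType}.
Local Notation mu := (leb2 R).
Implicit Types (x y v : R * R) (f g u phi eta V : R * R -> R).

Variables (D : set (R * R)) (rD : R).
Hypothesis oD : open D.
Hypothesis bD : D `<=` cube rD.
Variables (kappa H : R) (psi psi0 : R * R -> R[i]) (A : R * R -> R * R) (M : R).
Hypotheses (kappa0 : 0 < kappa) (H0 : 0 < H).
Hypothesis sol : GL_solution D kappa H psi A.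
Hypothesis cpsi0 : continuous_on (closure D) psi0.
Hypothesis psi0E : eq_ae D psi0 psi.
Hypothesis M0 : 0 <= M.
Hypothesis psi0M : forall x, D x -> re_part psi0 x ^+ 2 + im_part psi0 x ^+ 2 <= M ^+ 2.

Let h := kappa * H.
Let a := ext D (re_part psi0).
Let b := ext D (im_part psi0).
Let a1 := ext D (wpartial D (e1 R) (re_part psi)).
Let a2 := ext D (wpartial D (e2 R) (re_part psi)).
Let b1 := ext D (wpartial D (e1 R) (im_part psi)).
Let b2 := ext D (wpartial D (e2 R) (im_part psi)).
Let A1 := ext D (fun x => (A x).1).
Let A2 := ext D (fun x => (A x).2).
Let A12 := ext D (wpartial D (e2 R) (fun x => (A x).1)).
Let A21 := ext D (wpartial D (e1 R) (fun x => (A x).2)).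

Let bv1 : basis_vec (e1 R). Proof. by left. Qed.
Let bv2 : basis_vec (e2 R). Proof. by right. Qed.
Let mD : measurable (D : set (plane R)). Proof. exact: open_plane_measurable. Qed.

Let ma : rmeas (a : plane R -> R). Proof. by apply: ext_meas => //; case: cpsi0. Qed.
Let mb : rmeas (b : plane R -> R). Proof. by apply: ext_meas => //; case: cpsi0. Qed.

Let aeE : {ae mu, forall x, ext D (re_part psi) x = a x /\ ext D (im_part psi) x = b x}.
Proof.
apply: (ae_imp psi0E) => x E; rewrite /a /b /ext.
have [Dx|nDx] := pselect (D x); last by rewrite indicF// !mul0r.
by rewrite /re_part /im_part E.
Qed.

Let wa v : basis_vec v -> wgrad D v a (ext D (wpartial D v (re_part psi))).
Proof.
move=> bv; apply: (wgrad_ae bv (W12_wgrad bD bv (GL_psi sol).1)) => //.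
  by apply: (ae_imp aeE) => x [].
by move=> x nx; exact: extF.
Qed.

Let wb v : basis_vec v -> wgrad D v b (ext D (wpartial D v (im_part psi))).
Proof.
move=> bv; apply: (wgrad_ae bv (W12_wgrad bD bv (GL_psi sol).2)) => //.
  by apply: (ae_imp aeE) => x [].
by move=> x nx; exact: extF.
Qed.

Let abM x : a x ^+ 2 + b x ^+ 2 <= M ^+ 2.
Proof.
have [Dx|nDx] := pselect (D x); first by rewrite /a /b !extT//; exact: psi0M.
by rewrite /a /b !extF// expr0n addr0 sqr_ge0.
Qed.

Let aM x : `|a x| <= M. Proof. by have [] := sq_bound M0 (abM x). Qed.
Let bM x : `|b x| <= M. Proof. by have [] := sq_bound M0 (abM x). Qed.

Let wA1 := W12_wgrad bD bv2 (GL_A sol).1.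
Let wA2 := W12_wgrad bD bv1 (GL_A sol).2.
Let sA1 : sqi mu A1. Proof. by case: wA1. Qed.
Let sA2 : sqi mu A2. Proof. by case: wA2. Qed.
Let sa : sqi mu a. Proof. by case: (wa bv1). Qed.
Let sb : sqi mu b. Proof. by case: (wb bv1). Qed.
Let sa1 : sqi mu a1. Proof. by case: (wa bv1). Qed.
Let sa2 : sqi mu a2. Proof. by case: (wa bv2). Qed.
Let sb1 : sqi mu b1. Proof. by case: (wb bv1). Qed.
Let sb2 : sqi mu b2. Proof. by case: (wb bv2). Qed.

Let ms f := @sqi_meas _ (plane R) R mu f.

Let mult eta : smooth eta -> forall u, W12 D u ->
  [/\ W12 D (fun x => eta x * u x),
    eq_ae D (wpartial D (e1 R) (fun x => eta x * u x)) (fun x => eta x * wpartial D (e1 R) u x + 'D_(e1 R) eta x * u x) &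
    eq_ae D (wpartial D (e2 R) (fun x => eta x * u x)) (fun x => eta x * wpartial D (e2 R) u x + 'D_(e2 R) eta x * u x)].
Proof.
move=> se u Wu.
have E v : basis_vec v -> wgrad D v (ext D (fun x => eta x * u x))
   (ext D (fun x => eta x * wpartial D v u x + 'D_v eta x * u x)).
  move=> bv; have := wgrad_mul oD bD bv (W12_wgrad bD bv Wu) se.
  by congr wgrad; apply/funext => x; rewrite /ext; ring.
exact: (wgrad_W12 oD bD (E _ bv1) (E _ bv2)).
Qed.

Let sqiW v u : basis_vec v -> W12 D u -> sqi mu (ext D u) /\ sqi mu (ext D (wpartial D v u)).
Proof. by move=> bv /(W12_wgrad bD bv) []. Qed.

(** Testing with eta psi splits the integrand into eta times the energy density and terms with grad
    eta; in the latter the contributions of A to the real part cancel. *)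
Lemma extraction_psi eta : smooth eta ->
    \int[mu]_x (eta x * energy h a b a1 a2 b1 b2 A1 A2 x)
    + \int[mu]_x ('D_(e1 R) eta x * (a x * a1 x + b x * b1 x))
    + \int[mu]_x ('D_(e2 R) eta x * (a x * a2 x + b x * b2 x))
    = kappa ^+ 2 * \int[mu]_x ((1 - (a x ^+ 2 + b x ^+ 2)) * (a x ^+ 2 + b x ^+ 2) * eta x).
Proof.
move=> se.
have sde1 := smooth_derive se bv1; have sde2 := smooth_derive se bv2.
have [Wp p1 p2] := mult se (GL_psi sol).1; have [Wq q1 q2] := mult se (GL_psi sol).2.
(* The test function is built from [psi], which is known to be W^{1,2}; the passage to [psi0] is
   made afterwards, under the integral, almost everywhere. *)
pose phi x : R[i] := (eta x * re_part psi x +i* (eta x * im_part psi x))%C.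
have Wphi : W12C D phi := conj Wp Wq.
have bsupp : bounded_support D phi.
  exists (2 * `|rD| + 1) => x Dx; rewrite ltNge => /negP[].
  have := bD Dx; rewrite /cube oboxE /= => -[x1 x2].
  have y1 : `|x.1| <= `|rD| by rewrite ler_norml; have := ler_norm rD; move=> ?; apply/andP; split; lra.
  have y2 : `|x.2| <= `|rD| by rewrite ler_norml; have := ler_norm rD; move=> ?; apply/andP; split; lra.
  rewrite /enorm /dotp -!expr2 -(@ger0_norm _ (2 * `|rD| + 1)); last by have := normr_ge0 rD; lra.
  rewrite -sqrtr_sqr ler_sqrt; last exact: sqr_ge0.
  rewrite -(real_normK (num_real x.1)) -(real_normK (num_real x.2)).
  have := normr_ge0 x.1; have := normr_ge0 x.2; nra.
have := congr1 (@complex.Re R) (GL_eq_psi sol Wphi bsupp).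
rewrite /Cint /=.
set L := Rintegral _ _ _; set Q := Rintegral _ _ _ => LQ.
pose al1 := cre h A1 a b1; pose be1 := cim h A1 b a1.
pose al2 := cre h A2 a b2; pose be2 := cim h A2 b a2.
have sal1 : sqi mu al1 by exact: (cre_sqi h sA1 sb1 ma aM).
have sal2 : sqi mu al2 by exact: (cre_sqi h sA2 sb2 ma aM).
have sbe1 : sqi mu be1 by exact: (cim_sqi h sA1 sa1 mb bM).
have sbe2 : sqi mu be2 by exact: (cim_sqi h sA2 sa2 mb bM).
have off : forall x, ~ D x -> [/\ a x = 0, b x = 0, al1 x = 0, be1 x = 0 & al2 x = 0 /\ be2 x = 0].
  move=> x nx; have e f : ext D f x = 0 by exact: extF.
  split; [exact: e|exact: e|exact: (cre_off _ _ (e _) (e _))|exact: (cim_off _ _ (e _) (e _))|].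
  by split; [exact: (cre_off _ _ (e _) (e _))|exact: (cim_off _ _ (e _) (e _))].
have ie : integ mu (fun x => eta x * energy h a b a1 a2 b1 b2 A1 A2 x).
  have t u : sqi mu u -> (forall x, ~ D x -> u x = 0) -> integ mu (fun x => eta x * u x * u x).
    by move=> su u0; apply: sqi_mul => //; exact: (smoothM_sqi oD bD).
  have I := integD (integD (t _ sal1 _) (t _ sbe1 _)) (integD (t _ sal2 _) (t _ sbe2 _)).
  have := I (fun x nx => let: And5 _ _ z _ _ := off x nx in z) (fun x nx => let: And5 _ _ _ z _ := off x nx in z)
    (fun x nx => let: And5 _ _ _ _ (conj z _) := off x nx in z) (fun x nx => let: And5 _ _ _ _ (conj _ z) := off x nx in z).
  by congr integ; apply/funext => x; rewrite /energy -/al1 -/be1 -/al2 -/be2; ring.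
have de v u w : basis_vec v -> sqi mu u -> sqi mu w ->
    integ mu (fun x => 'D_v eta x * (a x * u x + b x * w x)).
  move=> bv su sw; have sdv := smooth_derive se bv.
  have s1 : sqi mu (fun x => 'D_v eta x * a x) by apply: (smoothM_sqi oD bD) => // x nx; exact: extF.
  have s2 : sqi mu (fun x => 'D_v eta x * b x) by apply: (smoothM_sqi oD bD) => // x nx; exact: extF.
  have := integD (sqi_mul s1 su) (sqi_mul s2 sw).
  by congr integ; apply/funext => x; ring.
have i1 := de _ _ _ bv1 sa1 sb1; have i2 := de _ _ _ bv2 sa2 sb2.
have EL : \int[mu]_x (eta x * energy h a b a1 a2 b1 b2 A1 A2 x)
    + \int[mu]_x ('D_(e1 R) eta x * (a x * a1 x + b x * b1 x))
    + \int[mu]_x ('D_(e2 R) eta x * (a x * a2 x + b x * b2 x)) = L.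
  apply: (etrans (intD3 ie i1 i2)); rewrite /L (int_ext D).
  have [sp sp1] := sqiW bv1 Wp; have [_ sp2] := sqiW bv2 Wp.
  have [sq sq1] := sqiW bv1 Wq; have [_ sq2] := sqiW bv2 Wq.
  pose u := ext D (re_part psi); pose w := ext D (im_part psi).
  have su : sqi mu u by have [] := sqiW bv1 (GL_psi sol).1.
  have sw : sqi mu w by have [] := sqiW bv1 (GL_psi sol).2.
  pose G x := cre h A1 u b1 x * cre h A1 (ext D (fun x => eta x * re_part psi x)) (ext D (wpartial D (e1 R) (fun x => eta x * im_part psi x))) x
    + cim h A1 w a1 x * cim h A1 (ext D (fun x => eta x * im_part psi x)) (ext D (wpartial D (e1 R) (fun x => eta x * re_part psi x))) x
    + (cre h A2 u b2 x * cre h A2 (ext D (fun x => eta x * re_part psi x)) (ext D (wpartial D (e2 R) (fun x => eta x * im_part psi x))) x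
    + cim h A2 w a2 x * cim h A2 (ext D (fun x => eta x * im_part psi x)) (ext D (wpartial D (e2 R) (fun x => eta x * re_part psi x))) x).
  have mcre B f g : sqi mu B -> sqi mu f -> sqi mu g -> rmeas (cre h B f g : plane R -> R).
    move=> /ms mB /ms mf /ms mg; rewrite /cre.
    exact: (rmeasD mg (rmeasM (rmeasM (rmeas_cst h) mB) mf)).
  have mcim B f g : sqi mu B -> sqi mu f -> sqi mu g -> rmeas (cim h B f g : plane R -> R).
    move=> /ms mB /ms mf /ms mg; rewrite /cim.
    exact: (rmeasD (rmeasN mg) (rmeasM (rmeasM (rmeas_cst h) mB) mf)).
  have mG : rmeas (G : plane R -> R).
    apply: rmeasD; apply: rmeasD; apply: rmeasM; [exact: mcre|exact: mcre|exact: mcim|exact: mcim|exact: mcre|exact: mcre|exact: mcim|exact: mcim].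
  have GE : ext D (re_part (fun x => cdot (pA D (fun x => (kappa * H) *: A x) psi x) (pA D (fun x => (kappa * H) *: A x) phi x))) = G.
    apply/funext => x; have [Dx|nDx] := pselect (D x); last first.
      have e f : ext D f x = 0 by exact: extF.
      have c1 : cre h A1 u b1 x = 0 := cre_off _ _ (e _) (e _).
      have c2 : cim h A1 w a1 x = 0 := cim_off _ _ (e _) (e _).
      have c3 : cre h A2 u b2 x = 0 := cre_off _ _ (e _) (e _).
      have c4 : cim h A2 w a2 x = 0 := cim_off _ _ (e _) (e _).
      exact: (etrans (extF _ nDx) (esym (mul4_eq0 _ _ _ _ c1 c2 c3 c4))).
    have e f : ext D f x = f x by exact: extT.
    have q := Re_cdot_pA D (fun x => (kappa * H) *: A x) psi phi x.
    refine (etrans (extT _ Dx) _).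
    refine (etrans q _).
    rewrite /G; congr (_ * _ + _ * _ + (_ * _ + _ * _)); apply: esym.
    - exact: (cre_extT h _ _ _ Dx).
    - exact: (cre_extT h _ _ _ Dx).
    - exact: (cim_extT h _ _ _ Dx).
    - exact: (cim_extT h _ _ _ Dx).
    - exact: (cre_extT h _ _ _ Dx).
    - exact: (cre_extT h _ _ _ Dx).
    - exact: (cim_extT h _ _ _ Dx).
    - exact: (cim_extT h _ _ _ Dx).
  rewrite GE.
  have [] // := @int_ae_eq _ (plane R) R mu _ G (integD (integD ie i1) i2) mG.
  have AE := ae_and aeE (ae_and (ae_and p1 p2) (ae_and q1 q2)).
  apply: (ae_imp AE) => x [[E1 E2] [[P1 P2] [Q1 Q2]]].
  have [Dx|nDx] := pselect (D x); last first.
    have e f : ext D f x = 0 by exact: extF.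
    have c1 : cre h A1 a b1 x = 0 := cre_off _ _ (e _) (e _).
    have c2 : cim h A1 b a1 x = 0 := cim_off _ _ (e _) (e _).
    have c3 : cre h A2 a b2 x = 0 := cre_off _ _ (e _) (e _).
    have c4 : cim h A2 b a2 x = 0 := cim_off _ _ (e _) (e _).
    have c1' : cre h A1 u b1 x = 0 := cre_off _ _ (e _) (e _).
    have c2' : cim h A1 w a1 x = 0 := cim_off _ _ (e _) (e _).
    have c3' : cre h A2 u b2 x = 0 := cre_off _ _ (e _) (e _).
    have c4' : cim h A2 w a2 x = 0 := cim_off _ _ (e _) (e _).
    apply: (etrans (integrand_off _ _ _ _ _ _ _ c1 c2 c3 c4 (e _) (e _))).
    exact: (esym (mul4_eq0 _ _ _ _ c1' c2' c3' c4')).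
  have e f : ext D f x = f x by exact: extT.
  have ea : re_part psi x = a x := etrans (esym (e _)) E1.
  have eb : im_part psi x = b x := etrans (esym (e _)) E2.
  have X1 : ext D (fun x => eta x * re_part psi x) x = eta x * a x := etrans (e _) (congr1 (fun t => eta x * t) ea).
  have X2 : ext D (fun x => eta x * im_part psi x) x = eta x * b x := etrans (e _) (congr1 (fun t => eta x * t) eb).
  have Zp v (u0 u1 c : R * R -> R) : u0 x = c x ->
      (D x -> wpartial D v u1 x = eta x * wpartial D v u0 x + 'D_v eta x * u0 x) ->
      ext D (wpartial D v u1) x = eta x * ext D (wpartial D v u0) x + 'D_v eta x * c x.
    by move=> cx H1; rewrite (extT _ Dx) (extT _ Dx) (H1 Dx) cx.
  apply: (etrans (integrand_on _ _ _ _ _ _ _ _ _ _ _ _)); apply: esym.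
  rewrite /G; congr (_ * _ + _ * _ + (_ * _ + _ * _)).
  - exact: (cre_val h A1 E1 (erefl (b1 x))).
  - exact: (cre_val h A1 X1 (Zp _ _ _ _ eb Q1)).
  - exact: (cim_val h A1 E2 (erefl (a1 x))).
  - exact: (cim_val h A1 X2 (Zp _ _ _ _ ea P1)).
  - exact: (cre_val h A2 E1 (erefl (b2 x))).
  - exact: (cre_val h A2 X1 (Zp _ _ _ _ eb Q2)).
  - exact: (cim_val h A2 E2 (erefl (a2 x))).
  - exact: (cim_val h A2 X2 (Zp _ _ _ _ ea P2)).
rewrite EL LQ /Q int_ext.
have iw : integ mu (fun x => kappa ^+ 2 * ((1 - (a x ^+ 2 + b x ^+ 2)) * (a x ^+ 2 + b x ^+ 2) * eta x)).
  have se' := smooth_ext_sqi oD bD se.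
  have w1 : forall x, `|(1 - (a x ^+ 2 + b x ^+ 2)) * a x| <= (1 + M ^+ 2) * M.
    move=> x; rewrite normrM ler_pM//.
    rewrite (le_trans (ler_normB _ _))// normr1 lerD2l ger0_norm ?abM//.
    by rewrite addr_ge0// sqr_ge0.
  have w2 : forall x, `|(1 - (a x ^+ 2 + b x ^+ 2)) * b x| <= (1 + M ^+ 2) * M.
    move=> x; rewrite normrM ler_pM//.
    rewrite (le_trans (ler_normB _ _))// normr1 lerD2l ger0_norm ?abM//.
    by rewrite addr_ge0// sqr_ge0.
  have m1 : rmeas (fun x : plane R => 1 - (a x ^+ 2 + b x ^+ 2)).
    by apply: rmeasB; [exact: rmeas_cst|apply: rmeasD; exact: rmeasM].
  have s1 := @sqiM_bounded _ (plane R) R mu _ _ _ (rmeasM m1 ma) w1 se'.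
  have s2 := @sqiM_bounded _ (plane R) R mu _ _ _ (rmeasM m1 mb) w2 se'.
  have := integZ (kappa ^+ 2) (integD (sqi_mul s1 sa) (sqi_mul s2 sb)).
  congr integ; apply/funext => x; have [Dx|nDx] := pselect (D x); first by rewrite extT//; ring.
  by have [-> -> _ _ _] := off x nDx; ring.
pose u := ext D (re_part psi); pose w := ext D (im_part psi).
have su : sqi mu u by have [] := sqiW bv1 (GL_psi sol).1.
have sw : sqi mu w by have [] := sqiW bv1 (GL_psi sol).2.
pose G x := kappa ^+ 2 * ((1 - (u x ^+ 2 + w x ^+ 2)) * (u x ^+ 2 + w x ^+ 2) * eta x).
have GE : ext D (re_part (fun x => (kappa ^+ 2 * (1 - cabs (psi x) ^+ 2))%:C%C * psi x * conjc (phi x))) = G.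
  apply/funext => x; have [Dx|nDx] := pselect (D x); last first.
    by rewrite extF// /G /u /w !extF// expr0n addr0 mulr0 mul0r mulr0.
  rewrite extT// /G /u /w !extT// {1}/re_part !partsE /= cabs_sq -/(re_part psi x) -/(im_part psi x).
  ring.
have mG : rmeas (G : plane R -> R).
  have mu2 : rmeas (fun x : plane R => u x ^+ 2 + w x ^+ 2) by apply: rmeasD; apply: rmeasM; exact: ms.
  apply: rmeasM; first exact: rmeas_cst.
  apply: rmeasM; last exact: smooth_meas.
  by apply: rmeasM => //; apply: rmeasB => //; exact: rmeas_cst.
rewrite GE.
rewrite -(@intZ _ (plane R) R mu)//; last first.
  have := integZ (kappa ^+ 2)^-1 iw; congr integ; apply/funext => x.
  by rewrite mulrA mulVf ?mul1r// expf_neq0// gt_eqF.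
have [] // := @int_ae_eq _ (plane R) R mu _ G iw mG.
  by apply: (ae_imp aeE) => x [E1 E2]; rewrite /G /u /w E1 E2.
Qed.

Lemma extraction_A V : smooth V ->
    h * \int[mu]_x ((A21 x - A12 x - \1_D x) * 'D_(e1 R) V x)
    = \int[mu]_x (moment h a b a2 b2 A2 x * V x).
Proof.
move=> sV; have sdV := smooth_derive sV bv1; have h0 : 0 < h by exact: mulr_gt0.
have [WV V1 _] := wgrad_W12 oD bD (wgrad_smooth oD bD bv1 sV) (wgrad_smooth oD bD bv2 sV).
have sz : smooth (fun _ : R * R => 0 : R) by exact: smooth_cst.
have [WZ _ Z2] := wgrad_W12 oD bD (wgrad_smooth oD bD bv1 sz) (wgrad_smooth oD bD bv2 sz).
(* The curl of this field is the derivative of V along [e1], so a scalar relation results in which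
   only the second component of the current appears. *)
pose B x : R * R := (0, V x).
have := congr1 (@complex.Re R) (@GL_eq_A _ _ _ _ _ _ sol B (conj WZ WV)).
rewrite /Cint /=.
set L := Rintegral _ _ _; set Q := Rintegral _ _ _ => LQ.
have sA21 : sqi mu A21 by case: wA2.
have sA12 : sqi mu A12 by case: wA1.
have s1 : sqi mu (\1_D : R * R -> R).
  have := smooth_ext_sqi oD bD (smooth_cst 1).
  by congr sqi; apply/funext => x; rewrite /ext mulr1.
pose f x := A21 x - A12 x - \1_D x.
have sf : sqi mu f by exact: (sqiB (sqiB sA21 sA12) s1).
have offA : forall x, ~ D x -> f x = 0.
  move=> x nx; have zA : A21 x = 0 := extF _ nx. have zB : A12 x = 0 := extF _ nx.
  have zC : \1_D x = 0 :> R := indicF nx.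
  exact: (etrans (congr1 (fun t => t - _ - _) zA) (etrans (congr1 (fun t => 0 - t - _) zB) (etrans (congr1 (fun t => 0 - 0 - t) zC) (subrr3 _)))).
have iL : integ mu (fun x => f x * 'D_(e1 R) V x).
  have := sqi_mul sf (smooth_ext_sqi oD bD sdV); congr integ; apply/funext => x.
  have [Dx|nDx] := pselect (D x); first by rewrite extT.
  by rewrite offA// !mul0r.
have EL : \int[mu]_x (f x * 'D_(e1 R) V x) = L.
  rewrite /L (int_ext D).
  pose G x := f x * (ext D (wpartial D (e1 R) V) x - ext D (wpartial D (e2 R) (fun=> 0)) x).
  have [_ sV1] := sqiW bv1 WV; have [_ sZ2] := sqiW bv2 WZ.
  have mG : rmeas (G : plane R -> R) by exact: (rmeasM (ms sf) (rmeasB (ms sV1) (ms sZ2))).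
  have GE : ext D (fun x => (curl D A x - 1) * curl D B x) = G.
    apply/funext => x; have [Dx|nDx] := pselect (D x); last by rewrite (extF _ nDx) /G (offA x nDx) mul0r.
    apply: (etrans (extT _ Dx)); apply: esym.
    exact: (eq_curl_mul (extT _ Dx) (extT _ Dx) (indicT Dx) (extT _ Dx) (extT _ Dx)).
  rewrite GE.
  have ae' : {ae mu, forall x, f x * 'D_(e1 R) V x = G x}.
    apply: (ae_imp (ae_and V1 Z2)) => x [E1 E2].
    have [Dx|nDx] := pselect (D x); last by rewrite /G (offA x nDx) !mul0r.
    have z1 : ext D (wpartial D (e1 R) V) x = 'D_(e1 R) V x := etrans (extT _ Dx) (E1 Dx).
    have z2 : ext D (wpartial D (e2 R) (fun=> 0)) x = 0 := etrans (extT _ Dx) (etrans (E2 Dx) (derive_cst _ _ _)).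
    exact: (esym (mul_sub0 _ z1 z2)).
  have [_ q] := @int_ae_eq _ (plane R) R mu (fun x => f x * 'D_(e1 R) V x) G iL mG ae'.
  exact: q.
rewrite EL LQ /Q (int_ext D).
pose cpsi y := conjc (psi y).
have reE : re_part cpsi = re_part psi by apply/funext => x; exact: Re_conjc.
have imE : im_part cpsi = (fun x => - im_part psi x) by apply/funext => x; exact: Im_conjc.
(* The current involves the chosen weak derivative of Im (conj psi); uniqueness identifies it with
   minus that of Im psi. For the real part the two functions coincide, hence also the choices. *)
have [_ lc cE] : [/\ is_wpartial D (e2 R) (im_part cpsi) (wpartial D (e2 R) (im_part cpsi)),
    L2 D (wpartial D (e2 R) (im_part cpsi)) &
    eq_ae D (wpartial D (e2 R) (im_part cpsi)) (fun x => - wpartial D (e2 R) (im_part psi) x)].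
  apply: (wgrad_wpartial oD bD bv2); rewrite imE.
  have := wgradN bv2 (W12_wgrad bD bv2 (GL_psi sol).2).
  by congr wgrad; apply/funext => x; rewrite /ext mulrN.
have {}lc := (L2P _ _).1 lc.
have sal2 : sqi mu (cre h A2 a b2) by exact: (cre_sqi h sA2 sb2 ma aM).
have sbe2 : sqi mu (cim h A2 b a2) by exact: (cim_sqi h sA2 sa2 mb bM).
have im : integ mu (fun x => moment h a b a2 b2 A2 x * V x).
  have t1 : sqi mu (fun x => V x * a x) by apply: (smoothM_sqi oD bD) => // x nx; exact: extF.
  have t2 : sqi mu (fun x => V x * b x) by apply: (smoothM_sqi oD bD) => // x nx; exact: extF.
  have := integD (sqi_mul t1 sal2) (sqi_mul t2 sbe2).
  by congr integ; apply/funext => x; rewrite /moment; ring.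
have ih : integ mu (fun x => h^-1 * (moment h a b a2 b2 A2 x * V x)) by exact: integZ.
pose u := ext D (re_part psi); pose w := ext D (im_part psi).
have su : sqi mu u by have [] := sqiW bv1 (GL_psi sol).1.
have sw : sqi mu w by have [] := sqiW bv1 (GL_psi sol).2.
pose bc := ext D (wpartial D (e2 R) (im_part cpsi)).
pose G x := ((u x * (b2 x - bc x) - w x * (a2 x + a2 x)) / (2 * h) + (u x ^+ 2 + w x ^+ 2) * A2 x) * V x.
have GE : ext D (re_part (fun x => cdot (current D kappa H psi A x) (((B x).1)%:C%C, ((B x).2)%:C%C))) = G.
  apply/funext => x; have [Dx|nDx] := pselect (D x); last first.
    exact: (etrans (extF _ nDx) (esym (current_off _ _ _ _ _ (extF _ nDx) (extF _ nDx)))).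
  apply: (etrans (extT _ Dx)); apply: (etrans (Re_cdot0 _ _)).
  have q := @Re_current2 R D kappa H psi A x (lt0r_neq0 kappa0) (lt0r_neq0 H0).
  apply: (etrans (congr1 (fun t => t * V x) q)).
  have e k : k x = ext D k x :> R := esym (extT k Dx).
  exact: (eq_current _ _ (e (re_part psi)) (e (im_part psi)) (e (wpartial D (e2 R) (im_part psi)))
    (e (wpartial D (e2 R) (im_part cpsi))) (e (wpartial D (e2 R) (re_part psi)))
    (etrans (congr1 (fun g => wpartial D (e2 R) g x) reE) (e (wpartial D (e2 R) (re_part psi)))) (e (fun x => (A x).2))).
have mG : rmeas (G : plane R -> R).
  apply: rmeasM; last exact: smooth_meas.
  apply: rmeasD; last first.
    by apply: rmeasM; [apply: rmeasD; apply: rmeasM; exact: ms|exact: ms].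
  apply: rmeasM; last exact: rmeas_cst.
  apply: rmeasB; apply: rmeasM; [exact: ms|exact: (rmeasB (ms sb2) (ms lc))|exact: ms|exact: (rmeasD (ms sa2) (ms sa2))].
rewrite GE.
have ae' : {ae mu, forall x, h^-1 * (moment h a b a2 b2 A2 x * V x) = G x}.
  apply: (ae_imp (ae_and aeE cE)) => x [[E1 E2] E3].
  have bcE : bc x = - b2 x.
    have [Dx|nDx] := pselect (D x); last by rewrite /bc /b2 (extF _ nDx) (extF _ nDx) oppr0.
    by rewrite /bc /b2 (extT _ Dx) (extT _ Dx) (E3 Dx).
  apply: (etrans (current_val _ _ _ _ _ _ (lt0r_neq0 h0))).
  exact: (eq_current _ _ (esym E1) (esym E2) (erefl _) (esym bcE) (erefl _) (erefl _) (erefl _)).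
have [_ q] := @int_ae_eq _ (plane R) R mu (fun x => h^-1 * (moment h a b a2 b2 A2 x * V x)) G ih mG ae'.
apply: (etrans (congr1 (fun t => h * t) (esym q))).
apply: (etrans (congr1 (fun t => h * t) (intZ h^-1 im))).
exact: (mulVKf (lt0r_neq0 h0)).
Qed.

Lemma extraction : real_GL D kappa h M a b a1 a2 b1 b2 A1 A2 A12 A21.
Proof.
split.
- exact: wa bv1.
- exact: wa bv2.
- exact: wb bv1.
- exact: wb bv2.
- exact: wA1.
- exact: wA2.
- by move=> x; apply: ext_cont => //; case: cpsi0.
- by move=> x; apply: ext_cont => //; case: cpsi0.
- exact: abM.
- exact: extraction_psi.
- exact: extraction_A.
Qed.

End extraction.

(** * Squares of weakly differentiable functions and the pointwise magnetic inequality *)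

Section products.
Context {R : realType}.
Local Notation mu := (leb2 R).
Implicit Types (x y v : R * R) (f g u phi eta V : R * R -> R).
Variables (D : set (R * R)) (rD : R).
Hypothesis oD : open D.
Hypothesis bD : D `<=` cube rD.

Let bv1 : basis_vec (e1 R). Proof. by left. Qed.
Let bv2 : basis_vec (e2 R). Proof. by right. Qed.

Section bounded_factor.
Variables (w w1 w2 : R * R -> R) (M : R).
Hypothesis ww1 : wgrad D (e1 R) w w1.
Hypothesis ww2 : wgrad D (e2 R) w w2.
Hypothesis cw : forall x, D x -> {for x, continuous w}.
Hypothesis bw : forall x, `|w x| <= M.

Lemma weak_product1 A A1 phi : wgrad D (e1 R) A A1 -> test_function D phi ->
  \int[mu]_x (A1 x * (phi x * w x)) + \int[mu]_x (A x * (phi x * w1 x))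
  + \int[mu]_x (A x * (w x * 'D_(e1 R) phi x)) = 0.
Proof.
by move=> wA tphi; have := weak_product oD bD ww1 ww2 cw bw bv1 wA tphi; rewrite eqxx.
Qed.

Lemma weak_product2 A A2 phi : wgrad D (e2 R) A A2 -> test_function D phi ->
  \int[mu]_x (A2 x * (phi x * w x)) + \int[mu]_x (A x * (phi x * w2 x))
  + \int[mu]_x (A x * (w x * 'D_(e2 R) phi x)) = 0.
Proof.
by move=> wA tphi; have := weak_product oD bD ww1 ww2 cw bw bv2 wA tphi; rewrite e21_neq.
Qed.

Lemma wgrad_sq_aux v wv : basis_vec v -> wgrad D v w wv ->
  (forall phi, test_function D phi -> \int[mu]_x (wv x * (phi x * w x)) + \int[mu]_x (w x * (phi x * wv x))
  + \int[mu]_x (w x * (w x * 'D_v phi x)) = 0) ->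
  wgrad D v (fun x => w x ^+ 2) (fun x => 2 * (w x * wv x)).
Proof.
move=> bv [sw swv w0 wv0 _] H; have mw := sqi_meas sw; split.
- exact: (@sqiM_bounded _ (plane R) R mu w w M mw bw sw).
- exact: (sqiZ 2 (@sqiM_bounded _ (plane R) R mu wv w M mw bw swv)).
- by move=> x /w0 ->; rewrite expr0n.
- by move=> x /w0 ->; rewrite mul0r mulr0.
move=> phi tphi; have := H phi tphi.
have [C C0 phiC] := test_bounded tphi.
have sp := @sqiM_bounded _ (plane R) R mu w phi C (test_meas tphi) phiC sw.
have i1 := sqi_mul swv sp.
have E1 : \int[mu]_x (w x * (phi x * wv x)) = \int[mu]_x (wv x * (phi x * w x)).
  by apply: (@eq_int _ (plane R) R mu) => x; ring.
have E2 : \int[mu]_x (2 * (w x * wv x) * phi x) = 2 * \int[mu]_x (wv x * (phi x * w x)).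
  by rewrite -intZ//; apply: (@eq_int _ (plane R) R mu) => x; ring.
have E3 : \int[mu]_x (w x ^+ 2 * 'D_v phi x) = \int[mu]_x (w x * (w x * 'D_v phi x)).
  by apply: (@eq_int _ (plane R) R mu) => x; rewrite expr2 mulrA.
rewrite E1 E2 E3 => /eqP; rewrite addr_eq0 => /eqP E.
by rewrite mulr_natl mulr2n E opprK.
Qed.

(** The weak product rule with both factors equal. *)
Lemma wgrad_sq : wgrad D (e1 R) (fun x => w x ^+ 2) (fun x => 2 * (w x * w1 x)) /\
  wgrad D (e2 R) (fun x => w x ^+ 2) (fun x => 2 * (w x * w2 x)).
Proof.
split; apply: wgrad_sq_aux => // phi tphi; [exact: weak_product1|exact: weak_product2].
Qed.

End bounded_factor.

Lemma wgradD v u g u' g' : basis_vec v -> wgrad D v u g -> wgrad D v u' g' ->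
  wgrad D v (fun x => u x + u' x) (fun x => g x + g' x).
Proof.
move=> bv [su sg u0 g0 H] [su' sg' u0' g0' H']; split.
- exact: sqiD.
- exact: sqiD.
- by move=> x nx; rewrite u0// u0'// addr0.
- by move=> x nx; rewrite g0// g0'// addr0.
move=> phi tphi; have st := test_sqi tphi; have std := test_sqi (test_derive bv tphi).
have E (p q k : R * R -> R) : sqi mu p -> sqi mu q -> sqi mu k ->
    \int[mu]_x ((p x + q x) * k x) = \int[mu]_x (p x * k x) + \int[mu]_x (q x * k x).
  move=> sp sq sk; rewrite -(intD (sqi_mul sp sk) (sqi_mul sq sk)).
  by apply: (@eq_int _ (plane R) R mu) => x; rewrite mulrDl.
by rewrite E// E// H// H'// opprD.
Qed.

Lemma energy_solve (k X Y Z W p q r s : R) : Y = - (2^-1 * p) -> Z = - (2^-1 * q) -> W = r - s ->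
  X + Y + Z = k * W -> X = k * (r - s) + 2^-1 * (p + q).
Proof. by move=> -> -> -> H; lra. Qed.

Lemma quarter_bound (t : R) : (1 - t) * t * 1 <= 4^-1.
Proof.
rewrite mulr1 -subr_ge0 (_ : _ - _ = (t - 2^-1) ^+ 2) ?sqr_ge0//; by field.
Qed.

(** The right-hand side minus the left-hand side is p |p_1 psi - i p_2 psi|^2, the factorization
    behind the lowest Landau level. The terms added to the energy are combinations of product rules
    and Jacobians whose integrals vanish; [i] stands for the value of the indicator of D, which w
    does not see. *)
Lemma magnetic_pointwise (h p p1 p2 a b a1 a2 b1 b2 A1 A2 A12 A21 i : R) :
  (a ^+ 2 + b ^+ 2) * i = a ^+ 2 + b ^+ 2 -> 0 <= p ->
  h * (p * (a ^+ 2 + b ^+ 2)) + h * ((A21 - A12 - i) * (p * (a ^+ 2 + b ^+ 2)))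
  + (p1 * (a * (b2 + h * A2 * a) + b * (- a2 + h * A2 * b)) - p2 * (a * (b1 + h * A1 * a) + b * (- a1 + h * A1 * b))) <=
  p * ((b1 + h * A1 * a) ^+ 2 + (- a1 + h * A1 * b) ^+ 2 + ((b2 + h * A2 * a) ^+ 2 + (- a2 + h * A2 * b) ^+ 2))
  + (h * (A21 * (p * (a ^+ 2 + b ^+ 2)) + A2 * (p * (2 * (a * a1) + 2 * (b * b1))) + A2 * ((a ^+ 2 + b ^+ 2) * p1))
    - h * (A12 * (p * (a ^+ 2 + b ^+ 2)) + A1 * (p * (2 * (a * a2) + 2 * (b * b2))) + A1 * ((a ^+ 2 + b ^+ 2) * p2))
    + ((a1 * p * b2 - a2 * p * b1 + (a * p1 * b2 - a * p2 * b1))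
      - (b1 * p * a2 - b2 * p * a1 + (b * p1 * a2 - b * p2 * a1)))).
Proof.
move=> wi p0.
have -> : (A21 - A12 - i) * (p * (a ^+ 2 + b ^+ 2)) = (A21 - A12 - 1) * (p * (a ^+ 2 + b ^+ 2)).
  by rewrite -{2}wi; transitivity ((A21 - A12) * p * (a ^+ 2 + b ^+ 2) - p * ((a ^+ 2 + b ^+ 2) * i)); first ring; rewrite wi; ring.
rewrite -subr_ge0.
rewrite (_ : _ - _ = p * (((b1 + h * A1 * a) + (- a2 + h * A2 * b)) ^+ 2 + ((- a1 + h * A1 * b) - (b2 + h * A2 * a)) ^+ 2)); last by ring.
by rewrite mulr_ge0// addr_ge0// sqr_ge0.
Qed.

Lemma int_comb0 (h : R) f1 f2 f3 f4 : integ mu f1 -> integ mu f2 -> integ mu f3 -> integ mu f4 ->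
  \int[mu]_x f1 x = 0 -> \int[mu]_x f2 x = 0 -> \int[mu]_x f3 x = 0 -> \int[mu]_x f4 x = 0 ->
  \int[mu]_x (h * f2 x - h * f1 x + (f3 x - f4 x)) = 0.
Proof.
move=> i1 i2 i3 i4 z1 z2 z3 z4.
rewrite (intD (integB (integZ h i2) (integZ h i1)) (integB i3 i4)).
rewrite (intB (integZ h i2) (integZ h i1)) (intB i3 i4) (intZ h i1) (intZ h i2) z1 z2 z3 z4.
by rewrite !mulr0 !subr0 addr0.
Qed.

Lemma int_eq_sum0 f g : integ mu f -> integ mu g -> \int[mu]_x g x = 0 ->
  \int[mu]_x (f x + g x) = \int[mu]_x f x.
Proof. by move=> fi gi g0; rewrite (intD fi gi) g0 addr0. Qed.

End products.

(** * Energy identity, total energy and magnetic lower bound *)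

Section consequences.
Context {R : realType}.
Local Notation mu := (leb2 R).
Implicit Types (x y v : R * R) (f g u phi eta V : R * R -> R).
Variables (D : set (R * R)) (rD : R).
Hypothesis oD : open D.
Hypothesis bD : D `<=` cube rD.
Variables (kappa h M : R) (a b a1 a2 b1 b2 A1 A2 A12 A21 : R * R -> R).
Hypothesis M0 : 0 <= M.
Hypothesis G : real_GL D kappa h M a b a1 a2 b1 b2 A1 A2 A12 A21.

Let bv1 : basis_vec (e1 R). Proof. by left. Qed.
Let bv2 : basis_vec (e2 R). Proof. by right. Qed.
Let mD : measurable (D : set (plane R)). Proof. exact: open_plane_measurable. Qed.

Definition dens a b x : R := a x ^+ 2 + b x ^+ 2.
Local Notation w := (dens a b).
Local Notation e := (energy h a b a1 a2 b1 b2 A1 A2).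
Local Notation m1 := (moment h a b a1 b1 A1).
Local Notation m2 := (moment h a b a2 b2 A2).
Definition field_excess (D : set (R * R)) A12 A21 x : R := A21 x - A12 x - \1_D x.
Local Notation f := (field_excess D A12 A21).

Let aM x : `|a x| <= M. Proof. by have [] := sq_bound M0 (rg_M G x). Qed.
Let bM x : `|b x| <= M. Proof. by have [] := sq_bound M0 (rg_M G x). Qed.
Let sa : sqi mu a. Proof. by case: (rg_a1 G). Qed.
Let sb : sqi mu b. Proof. by case: (rg_b1 G). Qed.
Let sa1 : sqi mu a1. Proof. by case: (rg_a1 G). Qed.
Let sa2 : sqi mu a2. Proof. by case: (rg_a2 G). Qed.
Let sb1 : sqi mu b1. Proof. by case: (rg_b1 G). Qed.
Let sb2 : sqi mu b2. Proof. by case: (rg_b2 G). Qed.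
Let sA1 : sqi mu A1. Proof. by case: (rg_A1 G). Qed.
Let sA2 : sqi mu A2. Proof. by case: (rg_A2 G). Qed.
Let sA12 : sqi mu A12. Proof. by case: (rg_A1 G). Qed.
Let sA21 : sqi mu A21. Proof. by case: (rg_A2 G). Qed.
Let ma := sqi_meas sa.
Let mb := sqi_meas sb.
Let a0 x : ~ D x -> a x = 0. Proof. by case: (rg_a1 G) => _ _ + _ _; apply. Qed.
Let b0 x : ~ D x -> b x = 0. Proof. by case: (rg_b1 G) => _ _ + _ _; apply. Qed.

Lemma dens_ge0 x : 0 <= w x. Proof. by rewrite addr_ge0// sqr_ge0. Qed.
Lemma dens_le x : w x <= M ^+ 2. Proof. exact: (rg_M G). Qed.
Lemma dens_bound x : `|w x| <= M ^+ 2. Proof. by rewrite ger0_norm ?dens_ge0// dens_le. Qed.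
Lemma dens0 x : ~ D x -> w x = 0. Proof. by move=> nx; rewrite /dens a0// b0// expr0n addr0. Qed.

Lemma dens_cont x : D x -> {for x, continuous w}.
Proof.
move=> Dx; have ca := rg_ca G Dx; have cb := rg_cb G Dx.
have := @cvgD R _ _ (nbhs x) _ _ _ _ _ (@cvgM R _ (nbhs x) _ a a _ _ ca ca) (@cvgM R _ (nbhs x) _ b b _ _ cb cb).
by apply.
Qed.

Local Notation w1 := (fun x => 2 * (a x * a1 x) + 2 * (b x * b1 x)).
Local Notation w2 := (fun x => 2 * (a x * a2 x) + 2 * (b x * b2 x)).

Lemma wgrad_dens : wgrad D (e1 R) w w1 /\ wgrad D (e2 R) w w2.
Proof.
have [p1 p2] := wgrad_sq oD bD (rg_a1 G) (rg_a2 G) (rg_ca G) aM.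
have [q1 q2] := wgrad_sq oD bD (rg_b1 G) (rg_b2 G) (rg_cb G) bM.
by split; [exact: (wgradD bv1 p1 q1)|exact: (wgradD bv2 p2 q2)].
Qed.

Lemma dens_sqi : sqi mu w. Proof. by case: wgrad_dens => -[]. Qed.
Lemma dens_integ : integ mu w. Proof. by have [/(wgrad_integ bD)[]] := wgrad_dens. Qed.

Let sal1 : sqi mu (cre h A1 a b1). Proof. exact: (cre_sqi h sA1 sb1 ma aM). Qed.
Let sal2 : sqi mu (cre h A2 a b2). Proof. exact: (cre_sqi h sA2 sb2 ma aM). Qed.
Let sbe1 : sqi mu (cim h A1 b a1). Proof. exact: (cim_sqi h sA1 sa1 mb bM). Qed.
Let sbe2 : sqi mu (cim h A2 b a2). Proof. exact: (cim_sqi h sA2 sa2 mb bM). Qed.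

Lemma energy_integ : integ mu e.
Proof. exact: (integD (integD (sqi_sq sal1) (sqi_sq sbe1)) (integD (sqi_sq sal2) (sqi_sq sbe2))). Qed.

Lemma energy_ge0 x : 0 <= e x.
Proof. by rewrite /energy !addr_ge0// sqr_ge0. Qed.

Lemma moment2_sqi : sqi mu m2.
Proof.
apply: sqiD; [exact: (@sqiM_bounded _ (plane R) R mu _ a M ma aM sal2)|exact: (@sqiM_bounded _ (plane R) R mu _ b M mb bM sbe2)].
Qed.

Lemma moment1_sqi : sqi mu m1.
Proof.
apply: sqiD; [exact: (@sqiM_bounded _ (plane R) R mu _ a M ma aM sal1)|exact: (@sqiM_bounded _ (plane R) R mu _ b M mb bM sbe1)].
Qed.

(** Cauchy-Schwarz for Re (conj psi p_j psi); the defect is the sum of the squares of Im (conj psi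
    p_j psi). *)
Lemma moment_sq x : m1 x ^+ 2 + m2 x ^+ 2 <= w x * e x.
Proof.
rewrite /moment /energy /dens.
move: (a x) (b x) (cre h A1 a b1 x) (cim h A1 b a1 x) (cre h A2 a b2 x) (cim h A2 b a2 x) => p q r s t u.
rewrite -subr_ge0 (_ : _ - _ = (p * s - q * r) ^+ 2 + (p * u - q * t) ^+ 2); last by ring.
by rewrite addr_ge0// sqr_ge0.
Qed.

Lemma excess_sqi : sqi mu f.
Proof.
apply: sqiB; first exact: sqiB.
have := smooth_ext_sqi oD bD (smooth_cst 1).
by congr sqi; apply/funext => x; rewrite /ext mulr1.
Qed.

Lemma integ_phi_bounded phi u g : test_function D phi -> sqi mu u -> sqi mu g ->
  integ mu (fun x => phi x * u x * g x).
Proof.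
move=> tphi su sg; have [C C0 phiC] := test_bounded tphi.
exact: (sqi_mul (@sqiM_bounded _ (plane R) R mu u phi C (test_meas tphi) phiC su) sg).
Qed.

Lemma phi_energy_integ phi : test_function D phi -> integ mu (fun x => phi x * e x).
Proof.
move=> tphi; have [C C0 phiC] := test_bounded tphi.
exact: (integM_bounded (test_meas tphi) phiC energy_integ).
Qed.

Lemma phi_dens_integ phi : test_function D phi -> integ mu (fun x => phi x * w x).
Proof.
move=> tphi; have [C C0 phiC] := test_bounded tphi.
exact: (integM_bounded (test_meas tphi) phiC dens_integ).
Qed.

Lemma phi_dens_sq_integ phi : test_function D phi -> integ mu (fun x => phi x * (w x * w x)).
Proof.
move=> tphi; have := integ_phi_bounded tphi dens_sqi dens_sqi.
by congr integ; apply/funext => x; rewrite mulrA.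
Qed.

(** As a grad a + b grad b is half the weak gradient of w, one more integration by parts puts both
    derivatives on phi. *)
Lemma energy_identity phi : test_function D phi ->
  \int[mu]_x (phi x * e x) =
  kappa ^+ 2 * (\int[mu]_x (phi x * w x) - \int[mu]_x (phi x * (w x * w x)))
  + 2^-1 * (\int[mu]_x (w x * 'D_(e1 R) (fun y => 'D_(e1 R) phi y) x)
          + \int[mu]_x (w x * 'D_(e2 R) (fun y => 'D_(e2 R) phi y) x)).
Proof.
move=> tphi; have := rg_psi G (test_smooth tphi).
have [g1 g2] := wgrad_dens.
have E v u u' (wv : R * R -> R) : basis_vec v -> wgrad D v w wv -> (forall x, wv x = 2 * (a x * u x) + 2 * (b x * u' x)) ->
    \int[mu]_x ('D_v phi x * (a x * u x + b x * u' x)) = - (2^-1 * \int[mu]_x (w x * 'D_v (fun y => 'D_v phi y) x)).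
  move=> bv [_ sv _ _ H] Hv; have td := test_derive bv tphi.
  rewrite (H _ td) mulrN opprK -intZ; last exact: (sqi_mul sv (test_sqi td)).
  by apply: (@eq_int _ (plane R) R mu) => x; rewrite Hv; field.
have F1 := E _ a1 b1 _ bv1 g1 (fun=> erefl); have F2 := E _ a2 b2 _ bv2 g2 (fun=> erefl).
have F3 : \int[mu]_x ((1 - (a x ^+ 2 + b x ^+ 2)) * (a x ^+ 2 + b x ^+ 2) * phi x) =
    \int[mu]_x (phi x * w x) - \int[mu]_x (phi x * (w x * w x)).
  rewrite -(intB (phi_dens_integ tphi) (phi_dens_sq_integ tphi)).
  by apply: (@eq_int _ (plane R) R mu) => x; rewrite /dens; ring.
exact: (energy_solve F1 F2 F3).
Qed.

(** The constant 1 is an admissible multiplier thanks to the Neumann condition; then (1 - w) w <=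
    1/4. *)
Lemma total_energy : \int[mu]_x e x <= kappa ^+ 2 / 4 * fine (mu D).
Proof.
have := rg_psi G (smooth_cst 1).
have z v : \int[mu]_x ('D_v (fun _ : R * R => 1 : R) x * (a x * a1 x + b x * b1 x)) = 0.
  rewrite -[RHS](int0 mu); apply: (@eq_int _ (plane R) R mu) => x.
  by rewrite derive_cst mul0r.
have z' v : \int[mu]_x ('D_v (fun _ : R * R => 1 : R) x * (a x * a2 x + b x * b2 x)) = 0.
  rewrite -[RHS](int0 mu); apply: (@eq_int _ (plane R) R mu) => x.
  by rewrite derive_cst mul0r.
have E : \int[mu]_x (1 * e x) = \int[mu]_x e x.
  by apply: (@eq_int _ (plane R) R mu) => x; rewrite mul1r.
move=> H; have {}H := etrans (esym (congr2 (fun s t => s + t) (congr2 (fun s t => s + t) E (z _)) (z' _))) H.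
move: H; rewrite !addr0 => ->; rewrite -mulrA ler_wpM2l ?sqr_ge0//.
have fD : (mu D < +oo)%E.
  apply: le_lt_trans (leb2_cube_lty rD); apply: le_measure => //; rewrite inE//; exact: cube_meas.
rewrite -(int_indic mu mD) -intZ; last exact: integ_indic.
have i1 : integ mu (fun x => (1 - (a x ^+ 2 + b x ^+ 2)) * (a x ^+ 2 + b x ^+ 2) * 1).
  have := integB dens_integ (sqi_mul dens_sqi dens_sqi).
  by congr integ; apply/funext => x; rewrite /dens; ring.
apply: int_le => //; first by apply: integZ; exact: integ_indic.
move=> x; have [Dx|nDx] := pselect (D x).
  by rewrite (indicT Dx) [leRHS]mulr1; exact: quarter_bound.
by rewrite a0// b0// (indicF nDx) expr0n /= addr0 mulr0 mul0r mulr0.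
Qed.

(* |p_1 psi|^2 + |p_2 psi|^2 >= 2 Im (p_1 psi conj (p_2 psi)), whose integral
   against [phi] is the left-hand side after integration by parts. *)
Lemma magnetic phi : test_function D phi -> (forall x, 0 <= phi x) ->
  let L x := h * (phi x * w x) + h * (f x * (phi x * w x))
    + ('D_(e1 R) phi x * m2 x - 'D_(e2 R) phi x * m1 x) in
  integ mu L /\ \int[mu]_x L x <= \int[mu]_x (phi x * e x).
Proof.
move=> tphi phi0 L; have td1 := test_derive bv1 tphi; have td2 := test_derive bv2 tphi.
have [g1 g2] := wgrad_dens; have [_ sw1 _ _ _] := g1; have [_ sw2 _ _ _] := g2.
have sw := dens_sqi.
(* [Z1] and [Z2] are the product rules for A_1 phi w and A_2 phi w, [Z3] and [Z4] the Jacobian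
   identities of (a, b) and (b, a); all four have integral 0. *)
pose Z1 x := A12 x * (phi x * w x) + A1 x * (phi x * w2 x) + A1 x * (w x * 'D_(e2 R) phi x).
pose Z2 x := A21 x * (phi x * w x) + A2 x * (phi x * w1 x) + A2 x * (w x * 'D_(e1 R) phi x).
pose Z3 x := a1 x * phi x * b2 x - a2 x * phi x * b1 x + (a x * 'D_(e1 R) phi x * b2 x - a x * 'D_(e2 R) phi x * b1 x).
pose Z4 x := b1 x * phi x * a2 x - b2 x * phi x * a1 x + (b x * 'D_(e1 R) phi x * a2 x - b x * 'D_(e2 R) phi x * a1 x).
have I psi u g : test_function D psi -> sqi mu u -> sqi mu g ->
    [/\ integ mu (fun x => u x * (psi x * g x)), integ mu (fun x => u x * (g x * psi x)) & integ mu (fun x => u x * psi x * g x)].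
  move=> tpsi su sg; have H := integ_phi_bounded tpsi su sg.
  by split; move: H; congr integ; apply/funext => x; ring.
have C1 : integ mu Z1 /\ \int[mu]_x Z1 x = 0.
  have [i1 _ _] := I _ _ _ tphi sA12 sw; have [i2 _ _] := I _ _ _ tphi sA1 sw2; have [_ i3 _] := I _ _ _ td2 sA1 sw.
  split; first exact: (integD (integD i1 i2) i3).
  apply: (etrans (esym (intD3 i1 i2 i3))).
  exact: (weak_product2 oD bD g1 g2 dens_cont dens_bound (rg_A1 G) tphi).
have C2 : integ mu Z2 /\ \int[mu]_x Z2 x = 0.
  have [i1 _ _] := I _ _ _ tphi sA21 sw; have [i2 _ _] := I _ _ _ tphi sA2 sw1; have [_ i3 _] := I _ _ _ td1 sA2 sw.
  split; first exact: (integD (integD i1 i2) i3).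
  apply: (etrans (esym (intD3 i1 i2 i3))).
  exact: (weak_product1 oD bD g1 g2 dens_cont dens_bound (rg_A2 G) tphi).
have C (u u1 u2 g g1' g2' : R * R -> R) : sqi mu u -> sqi mu u1 -> sqi mu u2 -> sqi mu g1' -> sqi mu g2' ->
    \int[mu]_x (u1 x * phi x * g2' x) - \int[mu]_x (u2 x * phi x * g1' x) =
    - (\int[mu]_x (u x * 'D_(e1 R) phi x * g2' x) - \int[mu]_x (u x * 'D_(e2 R) phi x * g1' x)) ->
    let Z x := u1 x * phi x * g2' x - u2 x * phi x * g1' x + (u x * 'D_(e1 R) phi x * g2' x - u x * 'D_(e2 R) phi x * g1' x) in
    integ mu Z /\ \int[mu]_x Z x = 0.
  move=> su su1 su2 sg1 sg2 H Z.
  have [_ _ i1] := I _ _ _ tphi su1 sg2; have [_ _ i2] := I _ _ _ tphi su2 sg1.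
  have [_ _ i3] := I _ _ _ td1 su sg2; have [_ _ i4] := I _ _ _ td2 su sg1.
  split; first exact: (integD (integB i1 i2) (integB i3 i4)).
  rewrite (intD (integB i1 i2) (integB i3 i4)) (intB i1 i2) (intB i3 i4) H.
  exact: addNr.
have C3 : integ mu Z3 /\ \int[mu]_x Z3 x = 0.
  exact: (C a a1 a2 b b1 b2 sa sa1 sa2 sb1 sb2 (weak_jacobian oD bD (rg_b1 G) (rg_b2 G) (rg_cb G) bM (rg_a1 G) (rg_a2 G) tphi)).
have C4 : integ mu Z4 /\ \int[mu]_x Z4 x = 0.
  exact: (C b b1 b2 a a1 a2 sb sb1 sb2 sa1 sa2 (weak_jacobian oD bD (rg_a1 G) (rg_a2 G) (rg_ca G) aM (rg_b1 G) (rg_b2 G) tphi)).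
have iL : integ mu L.
  have [i2 _ _] := I _ _ _ tphi excess_sqi sw.
  have i3 := sqi_mul (test_sqi td1) moment2_sqi; have i4 := sqi_mul (test_sqi td2) moment1_sqi.
  exact: (integD (integD (integZ h (phi_dens_integ tphi)) (integZ h i2)) (integB i3 i4)).
split => //.
pose Z x := h * Z2 x - h * Z1 x + (Z3 x - Z4 x).
have iZ1 := integZ h C1.1; have iZ2 := integZ h C2.1.
have iZ : integ mu Z by exact: (integD (integB iZ2 iZ1) (integB C3.1 C4.1)).
have Z0 : \int[mu]_x Z x = 0.
  exact: (int_comb0 h C1.1 C2.1 C3.1 C4.1 C1.2 C2.2 C3.2 C4.2).
rewrite -(int_eq_sum0 (phi_energy_integ tphi) iZ Z0).
apply: int_le => //; first exact: (integD (phi_energy_integ tphi) iZ).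
move=> x; have := phi0 x; rewrite /L /Z /Z1 /Z2 /Z3 /Z4 /field_excess.
have w0 : w x * \1_D x = w x.
  have [Dx|nDx] := pselect (D x); first by rewrite (indicT Dx) mulr1.
  by rewrite (dens0 nDx) mul0r.
exact: magnetic_pointwise.
Qed.

End consequences.

(** * Control of curl A - 1 *)

Section primitive.
Context {R : realType}.
Local Notation mu := (leb2 R).
Local Notation lam := (@lebesgue_measure R).
Implicit Types (x y v P : R * R) (f g u phi eta V : R * R -> R).
Variable L : R.
Hypothesis L0 : 0 < L.

Let Y (t : measurableTypeR R) : R * R := (t, 0).
Let b : measurableTypeR R -> R := \1_(`[0, L]%classic).

Let mY1 : rmeas (fun t => (Y t).1). Proof. exact: measurable_id. Qed.
Let mY2 : rmeas (fun t => (Y t).2). Proof. exact: rmeas_cst. Qed.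

Let seg_lty (c e : R) : (lam `[c, e]%classic < +oo)%E.
Proof. by rewrite lebesgue_measure_itv /=; case: ifPn => _; rewrite -?EFinB ltry. Qed.

Let ib : integ lam b.
Proof. by apply: integ_indic; [exact: measurable_itv|exact: seg_lty]. Qed.

Let bv1 : basis_vec (e1 R). Proof. by left. Qed.

(** The integral of g over the segment of length L to the left of x. Once L reaches the width of D
    this is, on D, the primitive of g along [e1] vanishing on the left, and it is smooth with
    compact support in the plane. *)
Definition prim g := superpos lam Y b g.

Lemma prim_test D g : test_function D g -> test_function setT (prim g).
Proof.
move=> tg; split; first exact: (superpos_smooth mY1 mY2 ib tg).
have [r r0 gr] := test_cube tg.
exists (cbox 0 (r + L)); split => //; first exact: cbox_compact.
move=> x nx; rewrite /prim /superpos -[RHS](int0 lam); apply: eq_int => t.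
have [bt|nbt] := pselect (`[0, L]%classic t); last first.
  by rewrite /b indicE memNset// mulr0.
rewrite gr ?mul0r// /cube oboxE /= => -[/andP[h1 h2] /andP[h3 h4]]; apply: nx.
move: bt; rewrite /= in_itv /= => /andP[? ?].
by rewrite /cbox /= !ler_norml; split; apply/andP; split; lra.
Qed.

(** The second term comes from the far end of the segment; it vanishes for x in D when L is at least
    the width of D. *)
Lemma prim_derive D g x : test_function D g -> 'D_(e1 R) (prim g) x = g x - g (x - (L, 0)).
Proof.
move=> tg; have sg := test_smooth tg.
have [_ ->] := superpos_derive mY1 mY2 ib x bv1 tg.
pose k (t : R) := 'D_(e1 R) g (x - (t, 0)); pose F (t : R) := - g (x - (t, 0)).
have dF0 g0 (t : R) : smooth g0 -> is_derive t (1 : R) (fun t => - g0 (x - (t, 0))) ('D_(e1 R) g0 (x - (t, 0))).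
  move=> sg0; have dg := is_derive_lineP (smooth_is_derive (x - (t, 0)) sg0 bv1).
  have D1 : is_derive t (1 : R) (fun s : R => t - s) (0 - 1).
    exact: (@is_deriveB R R R (cst t) (@id R) t 1 0 1 (is_derive_cst _ _ _) (is_derive_id _ _)).
  have {}dg : is_derive (t - t) (1 : R) (fun h : R => g0 (h *: e1 R + (x - (t, 0)))) ('D_(e1 R) g0 (x - (t, 0))) by rewrite subrr.
  have D2 := @is_derive1_comp R (fun h => g0 (h *: e1 R + (x - (t, 0)))) (fun s => t - s) t _ _ dg D1.
  have D3 := @is_deriveN R R R _ t 1 _ D2.
  rewrite sub0r mulrN1 opprK in D3.
  have -> : (fun t : R => - g0 (x - (t, 0))) = - ((fun h => g0 (h *: e1 R + (x - (t, 0)))) \o (fun s => t - s)); last exact: D3.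
  apply/funext => s; rewrite fctE /=; congr (- g0 _).
  apply/eqP; rewrite -subr_eq0; apply/eqP; congr pair; rewrite /= /GRing.scale /=; ring.
have cF0 g0 (t : R) : smooth g0 -> {for t, continuous (fun t : R => - g0 (x - (t, 0)))}.
  by move=> sg0; apply/differentiable_continuous/derivable1_diffP; case: (dF0 g0 t sg0).
have dF (t : R) : is_derive t (1 : R) F (k t) by exact: dF0.
have cF (t : R) : {for t, continuous F} by exact: cF0.
have ck : continuous k.
  have kE : k = (fun s => - - 'D_(e1 R) g (x - (s, 0))) by apply/funext => s; rewrite opprK.
  by move=> t; rewrite kE; apply: cvgN; exact: (cF0 _ t (smooth_derive sg bv1)).
have FTC := @continuous_FTC2 R k F 0 L L0.
rewrite /superpos (_ : Rintegral _ _ _ = \int[lam]_(t in `[0, L]) k t); last first.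
  rewrite [RHS]Rintegral_mkcond; apply: (@eq_int _ _ _ lam) => t; rewrite patchE /b indicE.
  by case: ifPn => _; rewrite ?mulr1 ?mulr0.
rewrite /Rintegral FTC.
- by rewrite -EFinB /= /F opprK addrC subr0.
- by apply: continuous_subspaceT => t; exact: ck.
- split.
  + by move=> t _; case: (dF t).
  + by apply: cvg_at_right_filter; exact: cF.
  + by apply: cvg_at_left_filter; exact: cF.
- by move=> t _; rewrite derive1E; case: (dF t).
Qed.

(* The derivative of [x.1 * prim g x] along [e1] has integral 0. *)
Lemma prim_int D g : test_function D g -> \int[mu]_x prim g x = L * \int[mu]_x g x.
Proof.
move=> tg; have tp := prim_test tg; have sg := test_smooth tg.
have tU := testMl smooth_fst tp.
have i1 := test_integ tp.
have i2 := test_integ (testMl smooth_fst tg).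
have i3 : integ mu (fun x => (x.1 + L) * g x).
  have := integD i2 (integZ L (test_integ tg)).
  by congr integ; apply/funext => x; ring.
have [i4 E4] := int_shift (- (L, 0)) i3.
have H0 := int_derive0 bv1 tU.
have E : \int[mu]_x 'D_(e1 R) (fun y => y.1 * prim g y) x =
    \int[mu]_x (prim g x + (x.1 * g x - ((x - (L, 0)).1 + L) * g (x - (L, 0)))).
  apply: eq_int => x; rewrite (deriveMs _ smooth_fst (test_smooth tp) bv1) (prim_derive x tg).
  have [_ ->] := is_derive_fst x (e1 R); rewrite /=; ring.
move: H0; rewrite E (intD i1 (integB i2 i4)) (intB i2 i4) E4.
have -> : \int[mu]_x ((x.1 + L) * g x) = \int[mu]_x (x.1 * g x) + L * \int[mu]_x g x.
  rewrite -(intZ L (test_integ tg)) -(intD i2 (integZ L (test_integ tg))).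
  by apply: eq_int => x; ring.
by move=> H; apply/eqP; rewrite -subr_eq0 -H; apply/eqP; ring.
Qed.

(** Only t in an interval of length 2 l contribute, as g vanishes off the disc. There c |g| <= s/2
    g^2 + c^2 / (2 s), and the second term integrates to l c^2 / s: this is the smallness in l. *)
Lemma prim_young D P l g x (c s : R) : test_function D g -> 0 < l -> 0 < s -> 0 <= c ->
  (forall y, ~ disc P l y -> g y = 0) ->
  c * `|prim g x| <= s / 2 * prim (fun y => g y ^+ 2) x + l * c ^+ 2 / s.
Proof.
move=> tg l0 s0 c0 g0.
have tg2 : test_function D (fun y => g y ^+ 2) by exact: (testMl (test_smooth tg) tg).
have i1 := superpos_integ mY1 mY2 ib x tg; have i2 := superpos_integ mY1 mY2 ib x tg2.
pose S := `[x.1 - P.1 - l, x.1 - P.1 + l]%classic.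
have mS : measurable (S : set (measurableTypeR R)) by exact: measurable_itv.
have iS : integ lam (\1_S : measurableTypeR R -> R) by apply: integ_indic => //; exact: seg_lty.
have eS : lam `[x.1 - P.1 - l, x.1 - P.1 + l]%classic = (2 * l)%:E.
  rewrite lebesgue_measure_itv /= lte_fin ifT; last by lra.
  by rewrite -EFinB; congr EFin; ring.
have ES : \int[lam]_t (\1_S t : R) = 2 * l := etrans (int_indic lam mS) (congr1 fine eS).
have le1 : c * `|prim g x| <= \int[lam]_t (c * `|g (x - Y t) * b t|).
  rewrite (intZ c (integ_norm i1)) ler_wpM2l//; exact: int_norm_le.
apply: (le_trans le1).
have -> : s / 2 * prim (fun y => g y ^+ 2) x + l * c ^+ 2 / s =
   \int[lam]_t (s / 2 * (g (x - Y t) ^+ 2 * b t) + c ^+ 2 / (2 * s) * \1_S t).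
  rewrite (intD (integZ _ i2) (integZ _ iS)) (intZ _ i2) (intZ _ iS) ES; congr (_ + _).
  by field; rewrite gt_eqF.
apply: int_le.
- exact: (integZ c (integ_norm i1)).
- exact: (integD (integZ _ i2) (integZ _ iS)).
move=> t.
have cs : 0 <= c ^+ 2 / (2 * s) by rewrite divr_ge0 ?sqr_ge0// mulr_ge0// ltW.
have S1 : 0 <= \1_S t :> R by rewrite indicE.
have [bt|nbt] := pselect (`[0, L]%classic t); last first.
  have -> : b t = 0 by rewrite /b indicE memNset.
  by rewrite !mulr0 normr0 mulr0 add0r mulr_ge0.
have -> : b t = 1 by rewrite /b indicE mem_set.
rewrite !mulr1; have [St|nSt] := pselect (S t); last first.
  have -> : g (x - Y t) = 0.
    apply: g0 => /(disc_box l0) [+ _].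
    by rewrite /Y /= ler_norml => /andP[? ?]; apply: nSt; rewrite /S /= in_itv /=; apply/andP; split; lra.
  by rewrite normr0 mulr0 expr0n mulr0 add0r; exact: mulr_ge0.
have -> : \1_S t = 1 :> R by rewrite indicE mem_set.
rewrite mulr1 -subr_ge0 -(real_normK (num_real (g _))).
rewrite (_ : _ - _ = (s * `|g (x - Y t)| - c) ^+ 2 / (2 * s)); last by field; rewrite gt_eqF.
by rewrite divr_ge0 ?sqr_ge0// mulr_ge0// ltW.
Qed.

End primitive.

(** * Decay of the mass of w *)

Section real_inequalities.
Context {R : realType}.

Lemma amgm_sq (y p q : R) : 0 <= p -> 0 <= q -> y ^+ 2 <= 4 * (p * q) -> y <= p + q.
Proof.
move=> p0 q0 H; rewrite leNgt; apply/negP => lt.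
have : (p + q) ^+ 2 < y ^+ 2 by rewrite ltr_sqr ?nnegrE// ?addr_ge0// (le_trans _ (ltW lt))// addr_ge0.
by have := sqr_ge0 (p - q); nra.
Qed.

(** For phi = X^2 with grad X = (u, v), the gradient of phi is 2 X (u, v), so the current term is
    absorbed by a fraction d of phi times the energy, at the price of B / d times w. *)
Lemma moment_young (X u v B m1 m2 w t d : R) : 0 <= X -> 0 <= w -> 0 <= t -> 0 < d ->
  u ^+ 2 + v ^+ 2 <= B -> m1 ^+ 2 + m2 ^+ 2 <= w * t ->
  - (2 * X * u * m2 - 2 * X * v * m1) <= d * (X ^+ 2 * t) + B / d * w.
Proof.
move=> X0 w0 t0 d0 uvB mt.
have B0 : 0 <= B by rewrite (le_trans _ uvB)// addr_ge0// sqr_ge0.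
apply: amgm_sq; first by rewrite mulr_ge0 ?mulr_ge0 ?sqr_ge0// ltW.
  by rewrite mulr_ge0// divr_ge0// ltW.
rewrite (_ : 4 * _ = 4 * X ^+ 2 * (B * (w * t))); last by field; rewrite gt_eqF.
apply: (@le_trans _ _ (4 * X ^+ 2 * ((u ^+ 2 + v ^+ 2) * (m1 ^+ 2 + m2 ^+ 2)))).
  rewrite (_ : _ ^+ 2 = 4 * X ^+ 2 * (v * m1 - u * m2) ^+ 2); last by ring.
  rewrite ler_wpM2l ?mulr_ge0 ?sqr_ge0//.
  rewrite -subr_ge0 (_ : _ - _ = (u * m1 + v * m2) ^+ 2) ?sqr_ge0//; by ring.
by rewrite ler_wpM2l ?mulr_ge0 ?sqr_ge0//; apply: ler_pM => //; rewrite addr_ge0// sqr_ge0.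
Qed.

(** [I], [J], [X] are the integrals of phi against w, w^2 and the energy, [T] the mass on the disc,
    [F] the field error, [Mo] the current term. The k J lost to [F] is recovered from X = k (I - J)
    + ..., and (1 + e/2) (1 - e) <= 1 - e/2 leaves e/2 of h I on the left. *)
Lemma decay_algebra (h k e I J X T Mo F c Dl l2 : R) : 0 < e -> e < 1 -> 0 <= I -> 0 <= J -> 0 <= T -> 0 <= k ->
  0 < l2 -> 0 <= h -> k <= (1 - e) * h ->
  h * I + F + Mo <= X -> X = k * (I - J) + 2^-1 * Dl -> Dl <= 224 / l2 * T ->
  - Mo <= e / 2 * X + 16 / l2 / (e / 2) * T -> - F <= k * J + c ->
  e / 2 * (h * I) <= (224 + 32 / e) * (T / l2) + c.
Proof.
move=> e0 e1 I0 J0 T0 k0 l0 h0 kh H1 XE HD HM HF.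
have s1 : h * I <= (1 + e / 2) * X + 16 / l2 / (e / 2) * T + k * J + c by lra.
have eT : 16 / l2 / (e / 2) * T = 32 / e * (T / l2) by field; rewrite !gt_eqF.
have dT : 224 / l2 * T = 224 * (T / l2) by field; rewrite gt_eqF.
rewrite eT in s1; rewrite dT in HD; rewrite [(224 + _) * _]mulrDl.
have q0 : 0 <= T / l2 by rewrite divr_ge0// ltW.
move: HD s1; move: (32 / e * (T / l2)) => Z; move: (T / l2) q0 => t t0 HD s1.
have X1 : X <= k * I - k * J + 112 * t by rewrite XE; lra.
have s2 : (1 + e / 2) * X <= (1 + e / 2) * (k * I - k * J + 112 * t) by rewrite ler_pM2l//; lra.
have s3 : k * I <= (1 - e) * (h * I) by rewrite mulrA ler_wpM2r.
have hI : 0 <= h * I by rewrite mulr_ge0.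
have kJ : 0 <= k * J by rewrite mulr_ge0.
have s4 : (1 + e / 2) * (k * I) <= (1 - e / 2) * (h * I).
  have := mulr_ge0 (ltW e0) hI; have := mulr_ge0 (mulr_ge0 (ltW e0) (ltW e0)) hI.
  have : (1 + e / 2) * (k * I) <= (1 + e / 2) * ((1 - e) * (h * I)) by rewrite ler_pM2l//; lra.
  move=> ? ? ?; have -> : (1 - e / 2) * (h * I) = (1 + e / 2) * ((1 - e) * (h * I)) + e * e * (h * I) / 2 by field.
  lra.
have s5 : 0 <= e / 2 * (k * J) by rewrite mulr_ge0// divr_ge0// ltW.
have s6 : e * t <= t by rewrite ler_piMl// ltW.
have E1 : (1 + e / 2) * (k * I - k * J + 112 * t) =
  (1 + e / 2) * (k * I) - k * J - e / 2 * (k * J) + 112 * t + 56 * (e * t) by field.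
have E2 : (1 - e / 2) * (h * I) = h * I - e / 2 * (h * I) by field.
lra.
Qed.

Lemma le_of_add_eq (w p q r u : R) : p + q = r -> w * r <= u -> w * p + w * q <= u.
Proof. by move=> <-; rewrite mulrDr. Qed.

Lemma decay_conclude (e q h l M c S T I : R) : 0 < e -> 0 < q -> 0 < h -> 0 < l -> 0 <= M -> 0 <= c -> 0 <= T ->
  q * S <= I -> e / 2 * (h * I) <= (224 + 32 / e) * (T / l ^+ 2) + M ^+ 2 * l * c ->
  h * S <= 2 / (e * q) * (224 + 32 / e + c) * (T / l ^+ 2 + M ^+ 2 * l).
Proof.
move=> e0 q0 h0 l0 M0 c0 T0 qS H.
have l2 : 0 < l ^+ 2 by rewrite exprn_gt0.
have t0 : 0 <= T / l ^+ 2 by rewrite divr_ge0// ltW.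
have m0 : 0 <= M ^+ 2 * l by rewrite mulr_ge0 ?sqr_ge0// ltW.
have k0 : 0 <= 224 + 32 / e.
  by apply: addr_ge0; [exact: ler0n|apply: divr_ge0; [exact: ler0n|exact: ltW]].
have H3 : e / 2 * (h * (q * S)) <= e / 2 * (h * I).
  apply: ler_wpM2l; first by rewrite divr_ge0// ltW.
  by apply: ler_wpM2l => //; exact: ltW.
have {H3}H := le_trans H3 H.
move: (224 + 32 / e) (T / l ^+ 2) (M ^+ 2 * l) k0 t0 m0 H => k t m k0 t0 m0 H.
have H2 : e / 2 * (h * (q * S)) <= (k + c) * (t + m).
  apply: (le_trans H); rewrite -subr_ge0 (_ : _ - _ = k * m + c * t); last by ring.
  by rewrite addr_ge0// mulr_ge0.
have -> : h * S = 2 / (e * q) * (e / 2 * (h * (q * S))) by field; rewrite !gt_eqF.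
rewrite -[leRHS]mulrA; apply: ler_wpM2l => //; rewrite divr_ge0// mulr_ge0// ltW//.
Qed.

End real_inequalities.

(** * The radial cut-off *)

Section cutoff_profile.
Context {R : realType}.
Implicit Types (s : R) (P x : R * R).

Lemma is_derive_flat_1sub j (s : R) : is_derive s (1 : R) (fun s : R => flat j (1 - s))
    (j%:R * flat j.+1 (1 - s) - flat j.+2 (1 - s)).
Proof.
have D1 : is_derive s (1 : R) (fun s : R => 1 - s) (0 - 1).
  exact: (@is_deriveB R R R (cst (1 : R)) (@id R) s 1 0 1 (is_derive_cst _ _ _) (is_derive_id _ _)).
have := @is_derive1_comp R (flat j) (fun s => 1 - s) s _ _ (is_derive_flat j (1 - s)) D1.
by rewrite sub0r mulrN1 opprB.
Qed.

(** A square, so that |grad phi|^2 / phi remains bounded, as [moment_young] demands. *)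
Definition profile (s : R) : R := flat 0 (1 - s) * flat 0 (1 - s).
Definition profile1 (s : R) : R := - (2 * (flat 0 (1 - s) * flat 2 (1 - s))).
Definition profile2 (s : R) : R := 2 * (flat 2 (1 - s) * flat 2 (1 - s))
  - 2 * (flat 0 (1 - s) * (2 * flat 3 (1 - s) - flat 4 (1 - s))).

Lemma is_derive_profile (s : R) : is_derive s (1 : R) profile (profile1 s).
Proof.
have d := @is_deriveM R R _ _ s 1 _ _ (is_derive_flat_1sub 0 s) (is_derive_flat_1sub 0 s).
by apply: is_derive_eq d _; rewrite /profile1 /GRing.scale /=; ring.
Qed.

Lemma is_derive_profile1 (s : R) : is_derive s (1 : R) profile1 (profile2 s).
Proof.
have d := @is_deriveN R R R _ s 1 _ (@is_deriveZ R R R _ 2 s 1 _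
  (@is_deriveM R R _ _ s 1 _ _ (is_derive_flat_1sub 0 s) (is_derive_flat_1sub 2 s))).
by apply: is_derive_eq d _; rewrite /profile2 /GRing.scale /=; ring.
Qed.

Lemma profile_Ck1 k : Ck1 setT k profile.
Proof. by apply: Ck1M; exact: flat_1sub_Ck1. Qed.

Lemma flat_1sub_off j (s : R) : 1 < s -> flat j (1 - s) = 0.
Proof. by move=> s1; rewrite flat_neg// subr_le0 ltW. Qed.

Lemma profile_off (s : R) : 1 < s -> profile s = 0.
Proof. by move=> s1; rewrite /profile flat_1sub_off// mul0r. Qed.

Lemma profile_bound (s : R) : 0 <= profile s <= 1.
Proof.
have f1 := flat_le 0 (1 - s); have g := flat_ge0 0 (1 - s); rewrite fact0 in f1.
by rewrite mulr_ge0//= -[1]mulr1 ler_pM.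
Qed.

(** The expression is l^2 times the Laplacian of profile([rad P l]). By [flat_le], [profile2] is at
    most 2 * 2^2 + 2 * 4! = 56, and [profile1] is nonpositive; hence 224 = 4 * 56. *)
Lemma profile_lap (s : R) : 0 <= s <= 1 -> 4 * s * profile2 s + 4 * profile1 s <= 224.
Proof.
move=> /andP[s0 s1].
have p1 : profile1 s <= 0 by rewrite oppr_le0 !mulr_ge0// flat_ge0.
have f0 := flat_le 0 (1 - s); have f2 := flat_le 2 (1 - s); have f4 := flat_le 4 (1 - s).
have g0 := flat_ge0 0 (1 - s); have g2 := flat_ge0 2 (1 - s); have g3 := flat_ge0 3 (1 - s); have g4 := flat_ge0 4 (1 - s).
have p2 : profile2 s <= 56.
  rewrite /profile2; move: f0 f2 f4 g0 g2 g3 g4; rewrite (_ : 4`! = 24)%N// (_ : 2`! = 2)%N// fact0.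
  move: (flat 0 _) (flat 2 _) (flat 3 _) (flat 4 _) => p q r t f0 f2 f4 g0 g2 g3 g4.
  have : q * q <= 2 * 2 by rewrite ler_pM.
  have : p * t <= 1 * 24 by rewrite ler_pM.
  have : 0 <= p * r by rewrite mulr_ge0.
  by move=> ? ? ?; lra.
have : s * profile2 s <= 56.
  have [pn|pp] := leP (profile2 s) 0; first by rewrite (le_trans (mulr_ge0_le0 s0 pn)).
  by rewrite (le_trans _ p2)// ler_piMl// ltW.
by move=> ?; lra.
Qed.

Lemma disc_half P (l : R) x : 0 < l -> disc P (l / 2) x <-> rad P l x <= 4^-1.
Proof.
move=> l0; rewrite /disc /= /rad !ler_pdivrMr ?exprn_gt0// ?divr_gt0//.
by rewrite (_ : 1 * (l / 2) ^+ 2 = 4^-1 * l ^+ 2)//; field.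
Qed.

Lemma profile_pos : 0 < profile (4^-1 : R).
Proof. by rewrite mulr_gt0// flat_gt0// subr_gt0 invf_lt1// ltr1n. Qed.

End cutoff_profile.

Section decay.
Context {R : realType}.
Local Notation mu := (leb2 R).
Implicit Types (x y v P : R * R) (g u phi eta V : R * R -> R).
Variables (D : set (R * R)) (rD : R).
Hypothesis oD : open D.
Hypothesis bD : D `<=` cube rD.
Hypothesis rD0 : 0 < rD.
Variables (kappa h M : R) (a b a1 a2 b1 b2 A1 A2 A12 A21 : R * R -> R).
Hypothesis kappa0 : 0 < kappa.
Hypothesis h0 : 0 < h.
Hypothesis M0 : 0 <= M.
Hypothesis G : real_GL D kappa h M a b a1 a2 b1 b2 A1 A2 A12 A21.

Let bv1 : basis_vec (e1 R). Proof. by left. Qed.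
Let bv2 : basis_vec (e2 R). Proof. by right. Qed.

Local Notation w := (dens a b).
Local Notation e := (energy h a b a1 a2 b1 b2 A1 A2).
Local Notation m1 := (moment h a b a1 b1 A1).
Local Notation m2 := (moment h a b a2 b2 A2).
Local Notation f := (field_excess D A12 A21).

(** What remains of the total energy bound after the weights in the field estimate cancel kappa. *)
Definition excess_cst (D : set (R * R)) (rD : R) : R := rD * fine (mu D) / 4.

Lemma test_off phi x : test_function D phi -> ~ D x -> phi x = 0.
Proof. by move=> [_ [K [_ KD p0]]] nx; apply: p0 => /KD. Qed.

Let f0 x : ~ D x -> f x = 0.
Proof.
move=> nx; have [_ _ _ z1 _] := rg_A1 G; have [_ _ _ z2 _] := rg_A2 G.
by rewrite /field_excess (z1 _ nx) (z2 _ nx) (indicF nx) !subr0.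
Qed.

(* The Maxwell equation is tested against the primitive of [g] along [e1]; as
   [g] lives in a disc of radius [l], this primitive is small. *)
Lemma excess_young P l g : 0 < l -> test_function D g -> (forall y, ~ disc P l y -> g y = 0) ->
  h * \int[mu]_x (f x * g x) <= kappa ^+ 2 * \int[mu]_x (g x ^+ 2) + M ^+ 2 * l * excess_cst D rD.
Proof.
(* The side of the cube containing D: a translation by L along [e1] moves D off itself. *)
move=> l0 tg g0; pose L := 2 * rD; have L0 : 0 < L by rewrite mulr_gt0.
have tV := prim_test L tg; have sV := test_smooth tV.
have E1 : \int[mu]_x (f x * 'D_(e1 R) (prim L g) x) = \int[mu]_x (f x * g x).
  apply: (@eq_int _ (plane R) R mu) => x; have [Dx|nDx] := pselect (D x); last first.
    by rewrite (f0 nDx) !mul0r.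
  rewrite (prim_derive L0 x tg) (test_off tg (x := x - (L, 0))) ?subr0//.
  move=> /bD; move: (bD Dx); rewrite /cube !oboxE /= /L => -[/andP[? ?] _] [/andP[? ?] _]; lra.
have F := rg_A G sV.
rewrite -E1 -[X in h * X]/(\int[mu]_x ((A21 x - A12 x - \1_D x) * 'D_(e1 R) (prim L g) x)) F.
have tg2 : test_function D (fun y => g y ^+ 2) by exact: (testMl (test_smooth tg) tg).
have iW := test_integ (prim_test L tg2).
have sm2 := moment2_sqi M0 G.
(* Makes s L / 2 equal to kappa^2, exactly the coefficient the quartic term can absorb; the factor
   kappa^-2 in l / s then compensates the kappa^2 of the total energy. *)
pose s := 2 * kappa ^+ 2 / L.
have k2 : 0 < kappa ^+ 2 by rewrite exprn_gt0.
have s0 : 0 < s by rewrite divr_gt0// mulr_gt0.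
have im := sqi_mul sm2 (test_sqi tV).
have i2 := integZ (l / s) (sqi_sq sm2); have i1 := integZ (s / 2) iW.
apply: (@le_trans _ _ (\int[mu]_x (s / 2 * prim L (fun y => g y ^+ 2) x + l / s * m2 x ^+ 2))).
  apply: int_le => //; first exact: integD.
  move=> x; apply: (le_trans (ler_norm _)); rewrite normrM.
  apply: (le_trans (prim_young L x tg l0 s0 (normr_ge0 (m2 x)) g0)).
  by rewrite real_normK ?num_real// [l * _ / s]mulrAC.
rewrite (intD i1 i2) (intZ _ iW) (intZ _ (sqi_sq sm2)) (prim_int L0 tg2).
have -> : s / 2 * (L * \int[mu]_x (g x ^+ 2)) = kappa ^+ 2 * \int[mu]_x (g x ^+ 2).
  by rewrite mulrA; congr (_ * _); rewrite /s; field; rewrite gt_eqF.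
rewrite lerD2l.
have ie := energy_integ M0 G.
have le1 : \int[mu]_x (m2 x ^+ 2) <= M ^+ 2 * \int[mu]_x e x.
  rewrite -(intZ _ ie); apply: int_le; [exact: sqi_sq|exact: integZ|move=> x].
  apply: (@le_trans _ _ (w x * e x)); last by rewrite ler_wpM2r ?energy_ge0// (dens_le G).
  by apply: le_trans (moment_sq h a b a1 a2 b1 b2 A1 A2 x); rewrite lerDr sqr_ge0.
have le2 := le_trans le1 (ler_wpM2l (sqr_ge0 M) (total_energy oD bD M0 G)).
apply: (le_trans (ler_wpM2l (ltW (divr_gt0 l0 s0)) le2)).
by rewrite le_eqVlt; apply/orP; left; apply/eqP; rewrite /s /L /excess_cst; field; rewrite !gt_eqF.
Qed.

(** [excess_young] for g = - phi w, reached through mollifications of w because g has to be a test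
    function. Finally phi^2 <= phi gives the right-hand side the shape of the quartic term. *)
Lemma excess_bound P l phi : 0 < l -> test_function D phi -> (forall y, ~ disc P l y -> phi y = 0) ->
  (forall x, 0 <= phi x <= 1) ->
  - (h * \int[mu]_x (f x * (phi x * w x))) <=
  kappa ^+ 2 * \int[mu]_x (phi x * (w x * w x)) + M ^+ 2 * l * excess_cst D rD.
Proof.
move=> l0 tphi phi0 phi1; have [g1 g2] := wgrad_dens oD bD M0 G.
have [w_ [sw bw_ cw_ _ _]] := mollify oD bD g1 g2 (dens_cont G) (dens_bound G).
have sf := excess_sqi oD bD G; have fi := sqi_integ sf (fun x nx => f0 (fun Dx => nx (bD Dx))).
have mphi := test_meas tphi; have mf := sqi_meas sf; have mw := sqi_meas (dens_sqi oD bD M0 G).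
have pn x : `|phi x| <= 1 by have /andP[p0 p1] := phi1 x; rewrite ger0_norm.
have L1 : \int[mu]_x (f x * (phi x * w_ n x)) @[n --> \oo] --> \int[mu]_x (f x * (phi x * w x)).
  apply: (@int_cvg _ (plane R) R mu _ _ (fun x => M ^+ 2 * `|f x|)).
  - by move=> n; apply: rmeasM => //; apply: rmeasM => //; exact: smooth_meas.
  - by apply: rmeasM => //; exact: rmeasM.
  - apply: aeW => x; have [Dx|nDx] := pselect (D x).
      by apply: cvgM; [exact: cvg_cst|apply: cvgM; [exact: cvg_cst|exact: cw_]].
    by under eq_fun do rewrite f0// mul0r; rewrite f0// mul0r; exact: cvg_cst.
  - by apply: integZ; exact: integ_norm.
  - move=> n x; rewrite !normrM mulrC ler_wpM2r// -[M ^+ 2]mul1r ler_pM//; exact: bw_.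
have tp2 : test_function D (fun x => phi x * phi x) by exact: (testMl (test_smooth tphi) tphi).
have L2 : \int[mu]_x ((phi x * w_ n x) ^+ 2) @[n --> \oo] --> \int[mu]_x ((phi x * w x) ^+ 2).
  apply: (@int_cvg _ (plane R) R mu _ _ (fun x => M ^+ 2 * M ^+ 2 * (phi x * phi x))).
  - by move=> n; apply: rmeasM; apply: rmeasM => //; exact: smooth_meas.
  - by apply: rmeasM; exact: rmeasM.
  - apply: aeW => x; have [Dx|nDx] := pselect (D x).
      by apply: cvgM; (apply: cvgM; [exact: cvg_cst|exact: cw_]).
    under eq_fun do rewrite (test_off tphi nDx) mul0r.
    by rewrite (test_off tphi nDx) mul0r; exact: cvg_cst.
  - by apply: integZ; exact: test_integ tp2.
  - move=> n x; rewrite (_ : _ ^+ 2 = (w_ n x * w_ n x) * (phi x * phi x)); last by ring.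
    rewrite normrM [`|phi x * phi x|]ger0_norm -?expr2 ?sqr_ge0// ler_wpM2r ?sqr_ge0//.
    by rewrite normrX expr2 ler_pM//; exact: bw_.
have H n : - (h * \int[mu]_x (f x * (phi x * w_ n x))) <=
    kappa ^+ 2 * \int[mu]_x ((phi x * w_ n x) ^+ 2) + M ^+ 2 * l * excess_cst D rD.
  have tn : test_function D (fun x => - (phi x * w_ n x)) by apply: testN; exact: testMr.
  have := @excess_young P l _ l0 tn _.
  have z y : ~ disc P l y -> - (phi y * w_ n y) = 0 by move=> /phi0 ->; rewrite mul0r oppr0.
  move=> /(_ z).
  have -> : \int[mu]_x (f x * - (phi x * w_ n x)) = - \int[mu]_x (f x * (phi x * w_ n x)).
    rewrite -(intN (sqi_mul sf (test_sqi (testMr (sw n) tphi)))).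
    by apply: (@eq_int _ (plane R) R mu) => x; rewrite mulrN.
  rewrite mulrN; have -> : \int[mu]_x ((- (phi x * w_ n x)) ^+ 2) = \int[mu]_x ((phi x * w_ n x) ^+ 2).
    by apply: (@eq_int _ (plane R) R mu) => x; rewrite sqrrN.
  by [].
have C1 : - (h * \int[mu]_x (f x * (phi x * w_ n x))) @[n --> \oo] --> - (h * \int[mu]_x (f x * (phi x * w x))).
  by apply: cvgN; apply: cvgM => //; exact: cvg_cst.
have C2 : kappa ^+ 2 * \int[mu]_x ((phi x * w_ n x) ^+ 2) + M ^+ 2 * l * excess_cst D rD @[n --> \oo] -->
    kappa ^+ 2 * \int[mu]_x ((phi x * w x) ^+ 2) + M ^+ 2 * l * excess_cst D rD.
  by apply: cvgD; [apply: cvgM => //; exact: cvg_cst|exact: cvg_cst].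
have C3 : - (h * \int[mu]_x (f x * (phi x * w x))) <=
    kappa ^+ 2 * \int[mu]_x ((phi x * w x) ^+ 2) + M ^+ 2 * l * excess_cst D rD.
  by apply: (ler_cvg_to C1 C2); exact: nearW.
apply: (le_trans C3).
rewrite lerD2r ler_wpM2l ?sqr_ge0//; apply: int_le.
- have := integ_phi_bounded tp2 (dens_sqi oD bD M0 G) (dens_sqi oD bD M0 G).
  by congr integ; apply/funext => x; ring.
- exact: (phi_dens_sq_integ oD bD M0 G).
- move=> x; have /andP[p0 p1] := phi1 x.
  rewrite (_ : _ ^+ 2 = phi x * (phi x * (w x * w x))); last by ring.
  by rewrite ler_wpM2l// ler_piMl// -expr2 sqr_ge0.
Qed.

Definition mass P l : R := \int[mu]_x (\1_(disc P l) x * w x).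

Lemma mass_integ P l : integ mu (fun x => \1_(disc P l) x * w x).
Proof. by apply: integ_restr; [exact: disc_meas|exact: (dens_integ oD bD M0 G)]. Qed.

Lemma mass_ge0 P l : 0 <= mass P l.
Proof. by apply: int_ge0 => x; rewrite mulr_ge0// ?dens_ge0// indicE. Qed.

(** Depends on the domain and the gap only, not on kappa, H or the solution. *)
Definition decay_cst (D : set (R * R)) (rD eps : R) : R :=
  2 / (eps * profile 4^-1) * (224 + 32 / eps + excess_cst D rD).

(** The cut-off has |grad phi|^2 / phi and Laplacian of order l^-2, whence the mass over l^2; the
    term M^2 l is the field error left after absorption. *)
Lemma local_decay eps P l : 0 < l -> disc P l `<=` D -> 0 < eps -> eps < 1 -> kappa ^+ 2 <= (1 - eps) * h ->
  h * mass P (l / 2) <= decay_cst D rD eps * (mass P l / l ^+ 2 + M ^+ 2 * l).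
Proof.
move=> l0 lD ep0 ep1 kh.
pose phi x := profile (rad P l x).
have tphi : test_function D phi.
  by apply: (test_radial l0 lD (I := setT)) => //; [exact: profile_Ck1|exact: profile_off].
have phi1 x : 0 <= phi x <= 1 by exact: profile_bound.
have phi0 x : 0 <= phi x by have /andP[] := phi1 x.
have I0 (s : R) : 0 <= s -> [set: R] s by [].
have dp (s : R) : [set: R] s -> is_derive s (1 : R) profile (profile1 s) by move=> _; exact: is_derive_profile.
have dp1 (s : R) : [set: R] s -> is_derive s (1 : R) profile1 (profile2 s) by move=> _; exact: is_derive_profile1.
have d1 v x : 'D_v phi x = profile1 (rad P l x) * drad P l v x by exact: (radial_derive I0 dp).
have d2 v x := radial_derive2 I0 dp dp1 P l v v x.
have off y : ~ disc P l y -> 1 < rad P l y by move=> /negP; rewrite -ltNge.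
have phi_off y : ~ disc P l y -> phi y = 0 by move=> /off /profile_off.
have l2 : 0 < l ^+ 2 by rewrite exprn_gt0.
have drad_sq x : drad P l (e1 R) x ^+ 2 + drad P l (e2 R) x ^+ 2 = 4 * rad P l x / l ^+ 2.
  by rewrite /drad /rad /=; field; rewrite gt_eqF.
have iphi := phi_dens_integ oD bD M0 G tphi.
have iT := mass_integ P l.
have [iL mag] := magnetic oD bD M0 G tphi phi0.
have en := energy_identity oD bD M0 G tphi.
have eb := excess_bound l0 tphi phi_off phi1.
have ie := phi_energy_integ M0 G tphi.
have mo1 := sqi_mul (test_sqi (test_derive bv1 tphi)) (moment2_sqi M0 G).
have mo2 := sqi_mul (test_sqi (test_derive bv2 tphi)) (moment1_sqi M0 G).
pose Mo := \int[mu]_x ('D_(e1 R) phi x * m2 x - 'D_(e2 R) phi x * m1 x).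
have i3 := integB mo1 mo2.
have sf := excess_sqi oD bD G.
have iF : integ mu (fun x => f x * (phi x * w x)).
  have [C C0 phiC] := test_bounded tphi.
  exact: (sqi_mul sf (@sqiM_bounded _ (plane R) R mu w phi C (test_meas tphi) phiC (dens_sqi oD bD M0 G))).
have H1 : h * \int[mu]_x (phi x * w x) + h * \int[mu]_x (f x * (phi x * w x)) + Mo <= \int[mu]_x (phi x * e x).
  apply: le_trans mag; rewrite le_eqVlt; apply/orP; left; apply/eqP; rewrite /Mo.
  rewrite -(intZ h iphi) -(intZ h iF); exact: (intD3 (integZ h iphi) (integZ h iF) i3).
have HM : - Mo <= eps / 2 * \int[mu]_x (phi x * e x) + 16 / l ^+ 2 / (eps / 2) * mass P l.
  rewrite /Mo -(intN i3) -(intZ _ ie) -(intZ _ iT) -(intD (integZ _ ie) (integZ _ iT)).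
  apply: int_le; [exact: integN|exact: (integD (integZ _ ie) (integZ _ iT))|move=> x].
  have [dx|ndx] := pselect (disc P l x); last first.
    have p0 : profile1 (rad P l x) = 0 by rewrite /profile1 flat_1sub_off ?mul0r ?mulr0 ?oppr0//; exact: off.
    by rewrite !d1 p0 phi_off// indicF// !mul0r subr0 oppr0 !mulr0 addr0.
  rewrite (indicT dx) mul1r !d1 /phi /profile /profile1.
  have X0 := flat_ge0 0 (1 - rad P l x).
  (* The bound 16 is 2!^2 from [flat 2], times 4 from |grad rad|^2 = 4 rad / l^2 with rad at most 1
     on the disc. *)
  have uv : (- flat 2 (1 - rad P l x) * drad P l (e1 R) x) ^+ 2 + (- flat 2 (1 - rad P l x) * drad P l (e2 R) x) ^+ 2 <= 16 / l ^+ 2.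
    rewrite (_ : _ + _ = flat 2 (1 - rad P l x) ^+ 2 * (4 * rad P l x / l ^+ 2)); last first.
      by rewrite -drad_sq; ring.
    have f2 := flat_le 2 (1 - rad P l x); have g2 := flat_ge0 2 (1 - rad P l x).
    rewrite (_ : 2`! = 2)%N// in f2.
    have q1 : flat 2 (1 - rad P l x) ^+ 2 <= 2 * 2 by rewrite expr2 ler_pM.
    rewrite mulrA ler_pM2r ?invr_gt0//.
    apply: (@le_trans _ _ ((2 * 2) * (4 * 1))); last by rewrite le_eqVlt; apply/orP; left; apply/eqP; ring.
    apply: ler_pM => //; [exact: sqr_ge0|by rewrite mulr_ge0// rad_ge0|].
    by apply: ler_wpM2l.
  have ed : 0 < eps / 2 by rewrite divr_gt0.
  have := moment_young X0 (dens_ge0 a b x) (energy_ge0 h a b a1 a2 b1 b2 A1 A2 x) ed uv (moment_sq h a b a1 a2 b1 b2 A1 A2 x).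
  apply: le_trans; rewrite le_eqVlt; apply/orP; left; apply/eqP; ring.
have lapE x : 'D_(e1 R) (fun y => 'D_(e1 R) phi y) x + 'D_(e2 R) (fun y => 'D_(e2 R) phi y) x
    = (4 * rad P l x * profile2 (rad P l x) + 4 * profile1 (rad P l x)) / l ^+ 2.
  apply: (etrans (congr2 (fun s t => s + t) (d2 (e1 R) x) (d2 (e2 R) x))).
  transitivity (profile2 (rad P l x) * (drad P l (e1 R) x ^+ 2 + drad P l (e2 R) x ^+ 2) + 4 * profile1 (rad P l x) / l ^+ 2).
    by rewrite /=; ring.
  by rewrite drad_sq; ring.
have idv v : basis_vec v -> integ mu (fun x => w x * 'D_v (fun y => 'D_v phi y) x).
  by move=> bv; exact: (sqi_mul (dens_sqi oD bD M0 G) (test_sqi (test_derive bv (test_derive bv tphi)))).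
have HD : \int[mu]_x (w x * 'D_(e1 R) (fun y => 'D_(e1 R) phi y) x)
    + \int[mu]_x (w x * 'D_(e2 R) (fun y => 'D_(e2 R) phi y) x) <= 224 / l ^+ 2 * mass P l.
  rewrite -(intD (idv _ bv1) (idv _ bv2)) -(intZ _ iT).
  apply: int_le; [exact: (integD (idv _ bv1) (idv _ bv2))|exact: integZ|move=> x].
  apply: (le_of_add_eq (lapE x)).
  have [dx|ndx] := pselect (disc P l x); last first.
    have s1 := off x ndx.
    have p1 : profile1 (rad P l x) = 0 by rewrite /profile1 flat_1sub_off// mul0r mulr0 oppr0.
    have p2 : profile2 (rad P l x) = 0 by rewrite /profile2 !flat_1sub_off// !(mul0r,mulr0) subr0.
    by rewrite p1 p2 !mulr0 addr0 mul0r mulr0 indicF// mul0r mulr0.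
  rewrite (indicT dx) mul1r mulrC ler_wpM2r ?dens_ge0// ler_pM2r ?invr_gt0//.
  by apply: profile_lap; rewrite rad_ge0.
have I0' : 0 <= \int[mu]_x (phi x * w x) by apply: int_ge0 => x; exact: (mulr_ge0 (phi0 x) (dens_ge0 a b x)).
have J0 : 0 <= \int[mu]_x (phi x * (w x * w x)) by apply: int_ge0 => x; exact: (mulr_ge0 (phi0 x) (mulr_ge0 (dens_ge0 a b x) (dens_ge0 a b x))).
have := decay_algebra ep0 ep1 I0' J0 (mass_ge0 P l) (sqr_ge0 kappa) l2 (ltW h0) kh H1 en HD HM eb.
have q0 := @profile_pos R.
have low : profile 4^-1 * mass P (l / 2) <= \int[mu]_x (phi x * w x).
  rewrite -(intZ _ (mass_integ P (l / 2))); apply: int_le => //; first exact: (integZ _ (mass_integ _ _)).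
  move=> x; have [dx|ndx] := pselect (disc P (l / 2) x); last first.
    by rewrite (indicF ndx) mul0r mulr0; exact: (mulr_ge0 (phi0 x) (dens_ge0 a b x)).
  rewrite (indicT dx) mul1r ler_wpM2r ?dens_ge0// /phi /profile.
  have fm : flat 0 (1 - 4^-1) <= flat 0 (1 - rad P l x).
    by apply: flat0_mono; rewrite lerD2l lerN2; exact/(disc_half _ _ l0).
  by rewrite ler_pM ?flat_ge0.
have c0 : 0 <= excess_cst D rD by rewrite /excess_cst divr_ge0// mulr_ge0// ?ltW// fine_ge0.
exact: (decay_conclude ep0 q0 h0 l0 M0 c0 (mass_ge0 P l) low).
Qed.

End decay.

(** * Pointwise bound by the mass of w *)

Section log_profile.
Context {R : realType}.
Variable eps : R.
Hypothesis eps0 : 0 < eps.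
Implicit Types (s : R).

(* [ln (1 / s)] regularized at the origin, so that [green] approximates the
   Green function truncated to a disc. *)
Definition logf s : R := ln (1 + eps) - ln (s + eps).
Definition green s : R := flat 0 (1 - s) * logf s.
Definition green1 s : R := - (flat 2 (1 - s) * logf s) - flat 0 (1 - s) * (s + eps)^-1.
Definition green2 s : R := (flat 4 (1 - s) - 2 * flat 3 (1 - s)) * logf s
  + 2 * (flat 2 (1 - s) * (s + eps)^-1) + flat 0 (1 - s) * (s + eps)^-1 ^+ 2.

Let sp s : 0 <= s -> 0 < s + eps. Proof. by move=> s0; rewrite ltr_wpDl. Qed.

Let is_derive_shift s : is_derive s (1 : R) (fun s : R => s + eps) 1.
Proof.
have d := @is_deriveD R R R (@id R) (cst eps) s 1 1 0 (is_derive_id _ _) (is_derive_cst _ _ _).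
by apply: is_derive_eq d _; rewrite addr0.
Qed.

Lemma is_derive_logf s : 0 <= s -> is_derive s (1 : R) logf (- (s + eps)^-1).
Proof.
move=> s0; have d := @is_derive1_comp R (@ln R) (fun s => s + eps) s _ _ (is_derive1_ln (sp s0)) (is_derive_shift s).
have d2 := @is_deriveB R R R (cst (ln (1 + eps))) _ s 1 0 _ (is_derive_cst _ _ _) d.
by apply: is_derive_eq d2 _; rewrite mulr1 sub0r.
Qed.

Let is_derive_inv s : 0 <= s -> is_derive s (1 : R) (fun s : R => (s + eps)^-1) (- (s + eps)^-1 ^+ 2).
Proof.
move=> s0; have n0 : s + eps != 0 by rewrite gt_eqF// sp.
have d := @is_deriveV R (fun s => s + eps) s 1 1 n0 (is_derive_shift s).
by apply: is_derive_eq d _; rewrite /GRing.scale /= mulr1 exprVn.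
Qed.

Lemma is_derive_green s : 0 <= s -> is_derive s (1 : R) green (green1 s).
Proof.
move=> s0; have d := @is_deriveM R R _ _ s 1 _ _ (is_derive_flat_1sub 0 s) (is_derive_logf s0).
by apply: is_derive_eq d _; rewrite /green1 /GRing.scale /=; ring.
Qed.

Lemma is_derive_green1 s : 0 <= s -> is_derive s (1 : R) green1 (green2 s).
Proof.
move=> s0; have d := @is_deriveB R R R _ _ s 1 _ _
  (@is_deriveN R R R _ s 1 _ (@is_deriveM R R _ _ s 1 _ _ (is_derive_flat_1sub 2 s) (is_derive_logf s0)))
  (@is_deriveM R R _ _ s 1 _ _ (is_derive_flat_1sub 0 s) (is_derive_inv s0)).
by apply: is_derive_eq d _; rewrite /green2 /GRing.scale /=; ring.
Qed.

Lemma green_off s : 1 < s -> [/\ green s = 0, green1 s = 0 & green2 s = 0].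
Proof.
move=> s1; rewrite /green /green1 /green2 !flat_1sub_off//.
by split; ring.
Qed.

Lemma logf_ge0 s : 0 <= s -> s <= 1 -> 0 <= logf s.
Proof.
by move=> s0 s1; rewrite subr_ge0 ler_ln ?posrE ?sp// lerD2r.
Qed.

Lemma green_ge0 s : 0 <= s -> 0 <= green s.
Proof.
move=> s0; have [s1|s1] := leP s 1; last by have [-> _ _] := green_off s1.
by rewrite mulr_ge0 ?flat_ge0 ?logf_ge0.
Qed.

(** From ln (1 + t) <= t at t = (1 - s) / (s + eps): the factor s tames the logarithm uniformly in
    eps. *)
Lemma s_logf s : 0 <= s -> s <= 1 -> s * logf s <= 1.
Proof.
move=> s0 s1; have p := sp s0; have p1 : 0 < 1 + eps by rewrite sp.
have -> : logf s = ln (1 + (1 - s) / (s + eps)).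
  rewrite /logf -ln_div ?posrE//; congr ln; field; rewrite gt_eqF//.
have q0 : 0 <= (1 - s) / (s + eps) by rewrite divr_ge0 ?subr_ge0// ltW.
apply: (@le_trans _ _ (s * ((1 - s) / (s + eps)))).
  by rewrite ler_wpM2l// le_ln1Dx// (lt_le_trans _ q0).
rewrite mulrA ler_pdivrMr// mul1r.
by apply: (@le_trans _ _ s); [rewrite ler_piMr// gerBl|rewrite lerDl ltW].
Qed.

(** The left-hand side is r^2 times the Laplacian of [green]([rad P r]). The subtracted term is the
    regularized Dirac mass; everything else is bounded uniformly in eps, with 112 = 4 * 4! + 8 *
    2!. *)
Lemma green_lap s : 0 <= s -> s <= 1 ->
  4 * s * green2 s + 4 * green1 s <= 112 - 4 * flat 0 (1 - s) * eps / (s + eps) ^+ 2.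
Proof.
move=> s0 s1; have p := sp s0.
have f2 := flat_le 2 (1 - s); have f4 := flat_le 4 (1 - s).
have g0 := flat_ge0 0 (1 - s); have g2 := flat_ge0 2 (1 - s); have g3 := flat_ge0 3 (1 - s); have g4 := flat_ge0 4 (1 - s).
have l0 := logf_ge0 s0 s1; have l1 := s_logf s0 s1.
rewrite /green2 /green1; move: l0 l1 f2 f4 g0 g2 g3 g4.
rewrite (_ : 4`! = 24)%N// (_ : 2`! = 2)%N//.
move: (logf s) (flat 0 _) (flat 2 _) (flat 3 _) (flat 4 _) => L p0 q r t l0 l1 f2 f4 g0 g2 g3 g4.
have -> : 4 * s * ((t - 2 * r) * L + 2 * (q * (s + eps)^-1) + p0 * (s + eps)^-1 ^+ 2) + 4 * (- (q * L) - p0 * (s + eps)^-1)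
  = 4 * (t * (s * L)) - 8 * (r * (s * L)) - 4 * (q * L) + 8 * (q * (s / (s + eps))) - 4 * p0 * eps / (s + eps) ^+ 2.
  by field; rewrite gt_eqF.
rewrite lerD2r.
have sL : 0 <= s * L by rewrite mulr_ge0.
have h1 : t * (s * L) <= 24 * 1 by rewrite ler_pM.
have h2 : 0 <= r * (s * L) by rewrite mulr_ge0.
have h3 : 0 <= q * L by rewrite mulr_ge0.
have se : s / (s + eps) <= 1 by rewrite ler_pdivrMr// mul1r lerDl ltW.
have se0 : 0 <= s / (s + eps) by rewrite divr_ge0// ltW.
have h4 : q * (s / (s + eps)) <= 2 * 1 by rewrite ler_pM.
by lra.
Qed.

Lemma green_core s : 0 <= s -> s <= eps -> eps <= 2^-1 ->
  flat 0 2^-1 / eps <= 4 * flat 0 (1 - s) * eps / (s + eps) ^+ 2.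
Proof.
move=> s0 se e2; have p := sp s0.
have fm : flat 0 2^-1 <= flat 0 (1 - s) by apply: flat0_mono; lra.
have g0 := flat_ge0 0 (2^-1 : R).
rewrite ler_pdivrMr// mulrAC ler_pdivlMr ?exprn_gt0//.
apply: (@le_trans _ _ (flat 0 2^-1 * (2 * eps) ^+ 2)).
  rewrite ler_wpM2l// ler_pXn2r// ?nnegrE ?mulr_ge0 ?(ltW p) ?(ltW eps0)//; lra.
rewrite (_ : 4 * _ * _ * _ = flat 0 (1 - s) * (2 * eps) ^+ 2); last by ring.
by rewrite ler_wpM2r// sqr_ge0.
Qed.

End log_profile.

Section point_bound.
Context {R : realType}.

Lemma obox_center (P x : R * R) (c : R) : obox (P.1 - c, P.2 - c) (P.1 + c, P.2 + c) x ->
  `|x.1 - P.1| < c /\ `|x.2 - P.2| < c.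
Proof. by rewrite oboxE /= !ltr_distl. Qed.

Local Notation mu := (leb2 R).
Implicit Types (x y v P : R * R) (g u phi eta V : R * R -> R).

Let bv1 : basis_vec (e1 R). Proof. by left. Qed.
Let bv2 : basis_vec (e2 R). Proof. by right. Qed.

Definition lap phi x : R := 'D_(e1 R) (fun y => 'D_(e1 R) phi y) x + 'D_(e2 R) (fun y => 'D_(e2 R) phi y) x.

Let two_halves (r z : R) : 2 / r ^+ 2 * z + 2 / r ^+ 2 * z = 4 / r ^+ 2 * z.
Proof. by rewrite -mulrDl -mulrDl; congr (_ / _ * _); ring. Qed.

(* Green's identity for [eta] and the squared distance to [P]. *)
Lemma int_rad_lap D P r eta : 0 < r -> test_function D eta ->
  \int[mu]_x (rad P r x * lap eta x) = 4 / r ^+ 2 * \int[mu]_x eta x.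
Proof.
move=> r0 te; have se := test_smooth te; have sr := rad_smooth P r.
have E v : basis_vec v -> v.1 * v.1 + v.2 * v.2 = 1 ->
    integ mu (fun x => rad P r x * 'D_v (fun y => 'D_v eta y) x) /\
    \int[mu]_x (rad P r x * 'D_v (fun y => 'D_v eta y) x) = 2 / r ^+ 2 * \int[mu]_x eta x.
  move=> bv vv; have td := test_derive bv te; have sd := smooth_derive sr bv.
  have sde := smooth_derive se bv.
  have t1 := testMl sr td; have t2 := testMl sd te; have t3 := testMl sr (test_derive bv td).
  have t4 := testMl sd td.
  have drE y : 'D_v (rad P r) y = drad P r v y by have [_ ->] := is_derive_rad P r y v.
  have i3 := test_integ t3; have i4 := test_integ t4; have ie := test_integ te.
  split => //.
  have z1 := int_derive0 bv t1; have z2 := int_derive0 bv t2.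
  have e1' : \int[mu]_x ('D_v (rad P r) x * 'D_v eta x) + \int[mu]_x (rad P r x * 'D_v (fun y => 'D_v eta y) x) = 0.
    rewrite -z1 -(intD i4 i3); apply: (@eq_int _ (plane R) R mu) => x.
    exact: (esym (deriveMs x sr sde bv)).
  have e2' : 2 / r ^+ 2 * \int[mu]_x eta x + \int[mu]_x ('D_v (rad P r) x * 'D_v eta x) = 0.
    rewrite -z2 -(intZ _ ie) -(intD (integZ _ ie) i4); apply: (@eq_int _ (plane R) R mu) => x.
    apply: esym; apply: (etrans (deriveMs x sd se bv)); congr (_ * _ + _).
    have -> : (fun y => 'D_v (rad P r) y) = drad P r v by apply/funext.
    by have [_ ->] := is_derive_drad P r v v x; rewrite vv mulr1.
  by apply: (addrI (\int[mu]_x ('D_v (rad P r) x * 'D_v eta x))); rewrite e1' addrC e2'.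
have u1 : 1 * 1 + 0 * 0 = 1 :> R by ring.
have u2 : 0 * 0 + 1 * 1 = 1 :> R by ring.
have [i1 E1] := E _ bv1 u1.
have [i2 E2] := E _ bv2 u2.
rewrite (_ : \int[mu]_x _ = \int[mu]_x (rad P r x * 'D_(e1 R) (fun y => 'D_(e1 R) eta y) x
   + rad P r x * 'D_(e2 R) (fun y => 'D_(e2 R) eta y) x)); last first.
  by apply: (@eq_int _ (plane R) R mu) => x; exact: mulrDr.
exact: (etrans (intD i1 i2) (etrans (congr2 (fun s t => s + t) E1 E2) (two_halves _ _))).
Qed.

Variables (D : set (R * R)) (rD : R).
Hypothesis oD : open D.
Hypothesis bD : D `<=` cube rD.
Variables (kappa h M : R) (a b a1 a2 b1 b2 A1 A2 A12 A21 : R * R -> R).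
Hypothesis M0 : 0 <= M.
Hypothesis G : real_GL D kappa h M a b a1 a2 b1 b2 A1 A2 A12 A21.

Local Notation w := (dens a b).
Local Notation e := (energy h a b a1 a2 b1 b2 A1 A2).
Local Notation x0 := (flat 0 2^-1 : R).

Lemma test_green eps P r : 0 < eps -> 0 < r -> disc P r `<=` D ->
  test_function D (fun x => green eps (rad P r x)).
Proof.
move=> eps0 r0 rD'; split.
  have sf : smooth (fun x => flat 0 (1 - rad P r x)).
    apply: (@smooth_comp R setT (fun s => flat 0 (1 - s)) (rad P r)) => //; last exact: rad_smooth.
    by move=> k; exact: flat_1sub_Ck1.
  apply: (smoothM sf).
  have sl : smooth (fun x => ln (rad P r x + eps)).
    apply: (@smooth_comp R [set t | 0 < t] (@ln R) (fun x => rad P r x + eps)).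
    - by move=> x /=; rewrite ltr_wpDl ?rad_ge0.
    - by move=> k; exact: Ck1_ln.
    - by apply: smoothD; [exact: rad_smooth|exact: smooth_cst].
  exact: (smoothB (smooth_cst (ln (1 + eps))) sl).
exists (disc P r); split => //; first exact: disc_compact.
by move=> x /negP; rewrite -ltNge => /(green_off eps)[].
Qed.

(** As 1792 = 4 * 448, the term k I costs at most a quarter of t = X r2 M2, while half of t comes
    from the Dirac part of the Laplacian. The remaining quarter is at most 56 S, hence 224. *)
Lemma point_algebra (k M2 r2 X S I E J Lp : R) : 0 <= k -> 0 <= M2 -> 0 < r2 -> 0 <= X -> 1792 * (k * r2) <= X ->
  0 <= E -> 0 <= J -> E = k * (I - J) + 2^-1 * Lp -> I <= M2 * (448 * r2) ->
  Lp <= r2^-1 * (112 * S - M2 * X * r2) -> X * r2 * M2 <= 224 * S.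
Proof.
move=> k0 M20 r20 X0 kr E0 J0 EE HI HL.
have H5 : r2 * (k * (M2 * (448 * r2))) * 4 <= X * r2 * M2.
  rewrite (_ : r2 * _ * 4 = 1792 * (k * r2) * (r2 * M2)); last by ring.
  by rewrite -[leRHS]mulrA; apply: ler_wpM2r => //; apply: mulr_ge0 => //; exact: ltW.
have H3 : r2 * Lp <= 112 * S - M2 * X * r2.
  by have := ler_wpM2l (ltW r20) HL; rewrite mulVKf// gt_eqF.
rewrite (_ : M2 * X * r2 = X * r2 * M2) in H3; last by ring.
move: H5 H3 HI; move: (M2 * (448 * r2)) (X * r2 * M2) => Y t H5 H3 HI.
have H1 : 0 <= k * I + 2^-1 * Lp by have := mulr_ge0 k0 J0; rewrite EE in E0; lra.
have H2 : k * I <= k * Y by rewrite ler_wpM2l.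
have H4 : 0 <= r2 * (k * Y) + 2^-1 * (r2 * Lp).
  by rewrite [2^-1 * _]mulrCA -mulrDr mulr_ge0 ?(ltW r20)//; lra.
by move: H3 H4 H5; move: (r2 * (k * Y)) (r2 * Lp) => p q; lra.
Qed.

(** Nonnegativity of the energy makes w a weak solution of - Lap w <= 2 kappa^2 w. This is the
    resulting mean value inequality at P, the zeroth-order term being harmless because kappa^2 r^2
    is small; the regularization parameter drops out of the final bound. *)
Lemma point_bound P r : D P -> 0 < r -> disc P r `<=` D -> w P = M ^+ 2 -> 1792 * (kappa ^+ 2 * r ^+ 2) <= x0 ->
  x0 * r ^+ 2 * M ^+ 2 <= 224 * mass a b P r.
Proof.
move=> DP r0 dD wP kr.
have r2 : 0 < r ^+ 2 by rewrite exprn_gt0.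
have S0 : 0 <= mass a b P r by exact: mass_ge0.
have x00 : 0 <= x0 by exact: flat_ge0.
have [->|Mn0] := eqVneq M 0; first by rewrite expr0n /= mulr0 mulr_ge0.
have M2 : 0 < M ^+ 2 by rewrite exprn_gt0// lt_neqAle eq_sym Mn0.
(* By continuity w stays above M^2 / 2 on a small box around P. Its size depends on the solution,
   which is allowed as the final bound is free of c. *)
have [c c0 [ce cw]] : exists2 c, 0 < c & 2 * c ^+ 2 / r ^+ 2 <= 2^-1 /\
    forall x, `|x.1 - P.1| < c -> `|x.2 - P.2| < c -> M ^+ 2 / 2 <= w x.
  have lt : M ^+ 2 / 2 < w P by rewrite wP ltr_pdivrMr// mulr_natr mulr2n ltrDl.
  have Ux : ([set y | M ^+ 2 / 2 < w y])^° P by exact: (cvgr_gt _ (dens_cont G DP) _ lt).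
  have [d d0 He] := open_oboxP (@open_interior _ _) Ux; have HU := @interior_subset _ [set y | M ^+ 2 / 2 < w y].
  exists (Num.min d (r / 2)); first by rewrite lt_min d0 divr_gt0.
  split.
    rewrite ler_pdivrMr//.
    have m2 : Num.min d (r / 2) <= r / 2 by rewrite ge_min lexx orbT.
    have m0 : 0 <= Num.min d (r / 2) by rewrite le_min !ltW// divr_gt0.
    have : Num.min d (r / 2) ^+ 2 <= (r / 2) ^+ 2 by rewrite ler_pXn2r ?nnegrE// ltW// divr_gt0.
    rewrite (_ : (r / 2) ^+ 2 = r ^+ 2 / 4); [by lra|by field].
  move=> x; rewrite !lt_min => /andP[x1 _] /andP[x2 _]; apply: ltW; apply: HU; apply: He; rewrite oboxE /=.
  by move: x1 x2; rewrite !ltr_norml => /andP[? ?] /andP[? ?]; split; apply/andP; split; lra.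
(* The value of [rad P r] at the corners of the box, so that s <= eps throughout the box and
   [green_core] applies there. *)
pose eps := 2 * c ^+ 2 / r ^+ 2.
have eps0 : 0 < eps by rewrite divr_gt0// mulr_gt0// exprn_gt0.
pose eta x := green eps (rad P r x).
have te : test_function D eta by exact: test_green.
have eta0 x : 0 <= eta x by exact: (green_ge0 eps0 (rad_ge0 P r x)).
have I0 (s : R) : 0 <= s -> [set s | 0 <= s] s by [].
have dp (s : R) : [set s | 0 <= s] s -> is_derive s (1 : R) (green eps) (green1 eps s) by exact: is_derive_green.
have dp1 (s : R) : [set s | 0 <= s] s -> is_derive s (1 : R) (green1 eps) (green2 eps s) by exact: is_derive_green1.
have d2 v x := radial_derive2 I0 dp dp1 P r v v x.
have drad_sq x : drad P r (e1 R) x ^+ 2 + drad P r (e2 R) x ^+ 2 = 4 * rad P r x / r ^+ 2.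
  by rewrite /drad /rad /=; field; rewrite gt_eqF.
have lapE x : lap eta x = (4 * rad P r x * green2 eps (rad P r x) + 4 * green1 eps (rad P r x)) / r ^+ 2.
  apply: (etrans (congr2 (fun s t => s + t) (d2 (e1 R) x) (d2 (e2 R) x))).
  transitivity (green2 eps (rad P r x) * (drad P r (e1 R) x ^+ 2 + drad P r (e2 R) x ^+ 2) + 4 * green1 eps (rad P r x) / r ^+ 2).
    by rewrite /=; ring.
  by rewrite drad_sq; ring.
pose Q := obox (P.1 - c, P.2 - c) (P.1 + c, P.2 + c).
have mQ : measurable (Q : set (plane R)) by exact: measurable_obox.
have QE : mu Q = (4 * c ^+ 2)%:E by rewrite leb2_obox /=; [congr EFin; ring|lra|lra].
have iQ : integ mu (\1_Q : R * R -> R) by apply: integ_indic => //; rewrite QE ltry.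
have Qc x : Q x -> `|x.1 - P.1| < c /\ `|x.2 - P.2| < c.
  exact: obox_center.
have Qs x : Q x -> rad P r x <= eps.
  move=> /Qc [q1 q2]; rewrite /rad /eps ler_pM2r ?invr_gt0//.
  have s1 : (x.1 - P.1) ^+ 2 <= c ^+ 2 by rewrite -real_normK ?num_real// ler_pXn2r ?nnegrE ?(ltW c0)// ltW.
  have s2 : (x.2 - P.2) ^+ 2 <= c ^+ 2 by rewrite -real_normK ?num_real// ler_pXn2r ?nnegrE ?(ltW c0)// ltW.
  by lra.
have lap_off x : ~ disc P r x -> lap eta x = 0.
  by move=> /negP; rewrite -ltNge lapE => s1; have [_ -> ->] := green_off eps s1; rewrite !mulr0 addr0 mul0r.
have idisc : integ mu (\1_(disc P r) : R * R -> R).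
  by apply: integ_indic; [exact: disc_meas|apply: le_lt_trans (disc_leb P r0) _; rewrite ltry].
have iT := mass_integ oD bD M0 G P r.
have en := energy_identity oD bD M0 G te.
have idv v : basis_vec v -> integ mu (fun x => w x * 'D_v (fun y => 'D_v eta y) x).
  by move=> bv; exact: (sqi_mul (dens_sqi oD bD M0 G) (test_sqi (test_derive bv (test_derive bv te)))).
have HL : \int[mu]_x (w x * 'D_(e1 R) (fun y => 'D_(e1 R) eta y) x)
    + \int[mu]_x (w x * 'D_(e2 R) (fun y => 'D_(e2 R) eta y) x) <=
    (r ^+ 2)^-1 * (112 * mass a b P r - M ^+ 2 * x0 * r ^+ 2).
  (* The area 4 c^2 = 2 eps r^2 of the box cancels the 1 / eps of the concentrated part. *)
  have -> : M ^+ 2 * x0 * r ^+ 2 = (M ^+ 2 / 2 * (x0 / eps)) * \int[mu]_x (\1_Q x : R).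
    rewrite (etrans (int_indic mu mQ) (congr1 fine QE)) /=.
    have -> : 4 * c ^+ 2 = 2 * (eps * r ^+ 2) by rewrite /eps; field; rewrite gt_eqF.
    by field; rewrite gt_eqF.
  have i1 := integZ 112 iT; have i2 := integZ (M ^+ 2 / 2 * (x0 / eps)) iQ.
  rewrite /mass -(intZ 112 iT) -(intZ _ iQ) -(intB i1 i2) -(intZ _ (integB i1 i2)).
  rewrite -(intD (idv _ bv1) (idv _ bv2)).
  apply: int_le; [exact: (integD (idv _ bv1) (idv _ bv2))|exact: (integZ _ (integB i1 i2))|move=> x].
  apply: (le_of_add_eq (lapE x)).
  have wx := dens_ge0 a b x; have rx := rad_ge0 P r x.
  rewrite mulrA [leRHS]mulrC ler_pM2r ?invr_gt0//.
  have [dx|ndx] := pselect (disc P r x); last first.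
    have s1 : 1 < rad P r x by move: ndx => /negP; rewrite -ltNge.
    have nQ : ~ Q x by move=> /Qs se; move: s1; rewrite ltNge (le_trans se)// (le_trans ce)// invf_le1// ler1n.
    have [_ -> ->] := green_off eps s1.
    by rewrite (indicF ndx) (indicF nQ) mul0r !mulr0 subr0 addr0 mulr0.
  have gl := ler_wpM2l wx (green_lap eps0 rx dx).
  apply: (le_trans gl); rewrite (indicT dx) mul1r mulrBr [w x * 112]mulrC lerD2l lerN2.
  have k0 : 0 <= 4 * flat 0 (1 - rad P r x) * eps / (rad P r x + eps) ^+ 2.
    by rewrite divr_ge0 ?sqr_ge0// mulr_ge0 ?(ltW eps0)// mulr_ge0// flat_ge0.
  have [qx|nqx] := pselect (Q x); last by rewrite (indicF nqx) mulr0 mulr_ge0.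
  rewrite (indicT qx) mulr1; apply: ler_pM.
  - by rewrite divr_ge0// ltW.
  - by rewrite divr_ge0// ltW.
  - by have [q1 q2] := Qc x qx; exact: cw.
  - exact: (green_core eps0 rx (Qs x qx) ce).
have ie := test_integ te.
(* Green's identity against [rad] replaces an integration of the logarithm: the bound 112 on the
   Laplacian and the area bound 16 r^2 give r^2 / 4 * (112 / r^2) * 16 r^2 = 448 r^2. *)
have HE : \int[mu]_x eta x <= 448 * r ^+ 2.
  have -> : \int[mu]_x eta x = r ^+ 2 / 4 * \int[mu]_x (rad P r x * lap eta x).
    by rewrite (int_rad_lap P r0 te); field; rewrite gt_eqF.
  have le1 : \int[mu]_x (rad P r x * lap eta x) <= 112 / r ^+ 2 * \int[mu]_x (\1_(disc P r) x : R).
    rewrite -(intZ _ idisc); apply: int_le; [|exact: integZ|move=> x].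
      have := integD (test_integ (testMl (rad_smooth P r) (test_derive bv1 (test_derive bv1 te))))
        (test_integ (testMl (rad_smooth P r) (test_derive bv2 (test_derive bv2 te)))).
      by congr integ; apply/funext => x; exact: (esym (mulrDr _ _ _)).
    have rx := rad_ge0 P r x.
    have [dx|ndx] := pselect (disc P r x); last by rewrite (lap_off x ndx) (indicF ndx) !mulr0.
    rewrite (indicT dx) mulr1 lapE mulrA ler_pM2r ?invr_gt0//.
    have gl : 4 * rad P r x * green2 eps (rad P r x) + 4 * green1 eps (rad P r x) <= 112.
      apply: (le_trans (green_lap eps0 rx dx)); rewrite gerBl.
      by rewrite divr_ge0 ?sqr_ge0// mulr_ge0 ?(ltW eps0)// mulr_ge0// flat_ge0.
    apply: (@le_trans _ _ (rad P r x * 112)); first by rewrite ler_wpM2l.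
    by rewrite ler_piMl.
  have le2 : \int[mu]_x (\1_(disc P r) x : R) <= 16 * r ^+ 2.
    rewrite (int_indic mu (disc_meas P r)) -lee_fin fineK; first exact: disc_leb.
    by rewrite ge0_fin_numE// (le_lt_trans (disc_leb P r0))// ltry.
  have r4 : 0 <= r ^+ 2 / 4 by rewrite divr_ge0// ltW.
  apply: (le_trans (ler_wpM2l r4 le1)).
  rewrite (_ : _ * (_ * _) = 28 * \int[mu]_x (\1_(disc P r) x : R)); last by field; rewrite gt_eqF.
  by apply: (@le_trans _ _ (28 * (16 * r ^+ 2))); [rewrite ler_wpM2l|rewrite mulrA -natrM].
have HI : \int[mu]_x (eta x * w x) <= M ^+ 2 * (448 * r ^+ 2).
  apply: (@le_trans _ _ (M ^+ 2 * \int[mu]_x eta x)); last by rewrite ler_wpM2l// ltW.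
  rewrite -(intZ _ ie); apply: int_le; [exact: (phi_dens_integ oD bD M0 G te)|exact: integZ|move=> x].
  by rewrite mulrC ler_wpM2r// (dens_le G).
have E0 : 0 <= \int[mu]_x (eta x * e x).
  by apply: int_ge0 => x; exact: (mulr_ge0 (eta0 x) (energy_ge0 h a b a1 a2 b1 b2 A1 A2 x)).
have J0 : 0 <= \int[mu]_x (eta x * (w x * w x)).
  by apply: int_ge0 => x; exact: (mulr_ge0 (eta0 x) (mulr_ge0 (dens_ge0 a b x) (dens_ge0 a b x))).
exact: (point_algebra (sqr_ge0 kappa) (ltW M2) r2 x00 kr E0 J0 en HI HL).
Qed.

End point_bound.

(** * Conclusion *)

Section geometry.
Context {R : realType}.
Implicit Types (P Q x : R * R) (D : set (R * R)).

Lemma enorm_ge0 x : 0 <= enorm x. Proof. exact: sqrtr_ge0. Qed.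

Lemma edist_le P D Q : D Q -> edist P D <= enorm (P - Q).
Proof.
by move=> DQ; apply: ge_inf; [exists 0 => _ [Q' _ <-]; exact: enorm_ge0|exists Q].
Qed.

Lemma enorm_seg P x (l t : R) : 0 < l -> disc P l x -> 0 <= t <= 1 -> enorm (P - (P + t *: (x - P))) <= l.
Proof.
move=> l0; rewrite /disc /= /rad ler_pdivrMr ?exprn_gt0// mul1r => H /andP[t0 t1].
rewrite /enorm /dotp -[leRHS]ger0_norm ?(ltW l0)// -sqrtr_sqr ler_wsqrtr//.
apply: le_trans H; rewrite /= /GRing.scale /=.
rewrite (_ : _ + _ = t ^+ 2 * ((x.1 - P.1) ^+ 2 + (x.2 - P.2) ^+ 2)); last by ring.
by rewrite ler_piMl ?addr_ge0 ?sqr_ge0// expr_le1.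
Qed.

Lemma closure_interior D P (l : R) : 0 < l -> closure D P -> l < edist P (frontier D) -> D P.
Proof.
move=> l0 cP le; apply: contrapT => nP.
have fP : frontier D P by split => //; exact: subset_closure.
have := lt_le_trans le (edist_le P fP).
by rewrite subrr /enorm /dotp /= mulr0 addr0 sqrtr0 => /(lt_trans l0); rewrite ltxx.
Qed.

(** The segment from P to a point of the disc stays within l of P and so avoids the frontier. Its
    intersection with D is then open and closed in it, and contains P. *)
Lemma disc_sub D P (l : R) : open D -> 0 < l -> closure D P -> l < edist P (frontier D) -> disc P l `<=` D.
Proof.
move=> oD l0 cP le x dx; have DP := closure_interior l0 cP le.
pose g (t : R) : R * R := P + t *: (x - P).
pose S := g @` `[0, 1]%classic.
have cg : continuous g.
  by move=> t; apply: cvgD; [exact: cvg_cst|apply: cvgZr_tmp; exact: cvg_id].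
have cS : connected S.
  apply: connected_continuous_connected; first exact: segment_connected.
  by apply: continuous_subspaceT; exact: cg.
have S0 : (S `&` D) !=set0.
  by exists P; split => //; exists 0; [rewrite /= in_itv /= lexx ler01|rewrite /g scale0r addr0].
have SD : S `&` D = S.
  apply: cS => //; first by exists D.
  exists (closure D); first exact: closed_closure.
  apply/seteqP; split => y [Sy Dy]; split => //; first exact: subset_closure.
  apply: contrapT => nDy; have fy : frontier D y by split => //; exact: subset_closure.
  have := lt_le_trans le (edist_le P fy); case: Sy => t t01 <-.
  by rewrite ltNge enorm_seg//; move: t01; rewrite /= in_itv.
have : S x by exists 1; [rewrite /= in_itv /= lexx ler01|rewrite /g scale1r addrC subrK].
by rewrite -SD => -[].
Qed.

End geometry.

Section final.
Context {R : realType}.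
Local Notation mu := (leb2 R).

Lemma mul_div_cancel (h x n : R) : h != 0 -> h * (x / (n * h)) = x / n.
Proof. by move=> hn0; rewrite invfM [x * _]mulrA [h * _]mulrC mulfVK. Qed.

Lemma small_radius (x y : R) : x <= 1 -> 1 <= y -> x / 1792 <= y / 16.
Proof. by move=> ? ?; lra. Qed.

Lemma le_div_mul (n x y : R) : 0 < n -> y <= x / n -> n * y <= x.
Proof. by move=> n0; rewrite ler_pdivlMr// mulrC. Qed.

Lemma lt_add136 (p z : R) : 0 < p -> 2 * (68 * z) < p + 136 * z.
Proof. by move=> ?; lra. Qed.

Lemma sq_sum_le0 (u v : R) : u ^+ 2 + v ^+ 2 <= 0 -> u = 0 /\ v = 0.
Proof.
move=> H; have : u ^+ 2 + v ^+ 2 == 0 by rewrite eq_le H addr_ge0// sqr_ge0.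
by rewrite paddr_eq0 ?sqr_ge0// !sqrf_eq0 => /andP[/eqP -> /eqP ->].
Qed.

Lemma cabs_ge0 (z : R[i]) : 0 <= cabs z.
Proof. by case: z => u v; rewrite /cabs /= sqrtr_ge0. Qed.

Lemma linf_ae (D : set (R * R)) (psi : R * R -> R[i]) (M : R) : M%:E = LnormC +oo%E D psi ->
  {ae mu, forall x, D x -> cabs (psi x) <= M}.
Proof.
(* The norm of exponent +oo is an essential supremum only on a space of positive measure, and 0
   otherwise; a cube shows that the plane is of the first kind. *)
rewrite /LnormC unlock ifT; last first.
  apply: (@lt_le_trans _ _ (mu (cube 1))).
    rewrite /cube leb2_obox /= ?lte_fin ?mulr_gt0//; lra.
  by apply: le_measure; rewrite ?inE//; exact: cube_meas.
move=> ME; have := ess_sup_ge mu (abse \o (EFin \o (fun x => cabs (psi x)) \_ D)).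
rewrite -ME => H; apply: (ae_imp H) => x /=; rewrite lee_fin => Hx Dx.
by move: Hx; rewrite patchE mem_set//; apply: le_trans; exact: ler_norm.
Qed.

Lemma mass_le a b (M : R) P (l : R) : 0 < l -> integ mu (fun x => \1_(disc P l) x * dens a b x) ->
  (forall x, dens a b x <= M ^+ 2) -> mass a b P l <= M ^+ 2 * (16 * l ^+ 2).
Proof.
move=> l0 iT wM.
have idisc : integ mu (\1_(disc P l) : R * R -> R).
  by apply: integ_indic; [exact: disc_meas|apply: le_lt_trans (disc_leb P l0) _; rewrite ltry].
apply: (@le_trans _ _ (M ^+ 2 * \int[mu]_x (\1_(disc P l) x : R))).
  rewrite -(intZ _ idisc); apply: int_le => //; first exact: integZ.
  by move=> x; rewrite mulrC ler_wpM2r// indicE.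
rewrite ler_wpM2l ?sqr_ge0// (int_indic mu (disc_meas P l)) -lee_fin fineK; first exact: disc_leb.
by rewrite ge0_fin_numE// (le_lt_trans (disc_leb P l0))// ltry.
Qed.

(** [T1], [T2], [T4], [Tr] are the masses at radii l, l/2, l/4 and r. The first decay step gives h
    T2 <= 17 K M2, so that the second has T2 / (l/2)^2 <= 68 K M2 / C^2; the two terms of its
    right-hand side are each less than q M2 / 2, against q M2 <= h T4. *)
Lemma final_algebra (K q h M2 C l T1 T2 T4 Tr x0 r2 : R) : 0 < q -> 0 <= K -> 0 < h -> 0 < M2 -> 0 < l -> l <= 1 ->
  h * l ^+ 2 = C ^+ 2 -> 0 < C -> 2 * (68 * K ^+ 2) < q * C ^+ 2 -> K * l < q ->
  T1 <= M2 * (16 * l ^+ 2) -> h * T2 <= K * (T1 / l ^+ 2 + M2 * l) ->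
  h * T4 <= K * (T2 / (l / 2) ^+ 2 + M2 * (l / 2)) -> Tr <= T4 ->
  h * r2 = x0 / 1792 -> x0 * r2 * M2 <= 224 * Tr -> q = x0 ^+ 2 / (1792 * 224) -> False.
Proof.
move=> q0 K0 h0 M20 l0 l1 hl C0 CK Kl HT1 H1 H2 HT hr H3 qE.
have l2 : 0 < l ^+ 2 by rewrite exprn_gt0.
have s1 : T1 / l ^+ 2 <= 16 * M2 by rewrite ler_pdivrMr//; apply: (le_trans HT1); rewrite mulrCA mulrA.
have s2 : h * T2 <= 17 * (K * M2).
  have m : M2 * l <= M2 by rewrite ler_piMr// ltW.
  apply: (le_trans H1); rewrite [leRHS]mulrCA; apply: ler_wpM2l => //.
  by move: s1 m; move: (T1 / _) (M2 * l) => p1 p2; lra.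
have C2 : 0 < C ^+ 2 by rewrite exprn_gt0.
have s3 : T2 / (l / 2) ^+ 2 <= 68 * K * M2 / C ^+ 2.
  rewrite (_ : T2 / (l / 2) ^+ 2 = 4 * (h * T2) / (h * l ^+ 2)); last by field; rewrite !gt_eqF.
  rewrite hl ler_pM2r ?invr_gt0//.
  by rewrite (_ : 68 * K * M2 = 4 * (17 * (K * M2))); [rewrite ler_pM2l|ring].
have s4 : q * M2 <= h * T4.
  have e1 : q * M2 = h * (x0 * r2 * M2) / 224.
    rewrite (_ : h * _ = (h * r2) * x0 * M2); last by ring.
    by rewrite hr qE; field.
  have H4 : x0 * r2 * M2 <= 224 * T4 by apply: (le_trans H3); apply: ler_wpM2l => //; exact: ler0n.
  rewrite e1 ler_pdivrMr ?ltr0n// (_ : h * T4 * 224 = h * (224 * T4)); last by ring.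
  by apply: ler_wpM2l => //; exact: ltW.
have s5 : K * (T2 / (l / 2) ^+ 2) <= 68 * K ^+ 2 / C ^+ 2 * M2.
  apply: (le_trans (ler_wpM2l K0 s3)); rewrite le_eqVlt; apply/orP; left; apply/eqP; ring.
have s6 : 68 * K ^+ 2 / C ^+ 2 < q / 2 by rewrite ltr_pdivrMr//; lra.
have s7 : 68 * K ^+ 2 / C ^+ 2 * M2 < q / 2 * M2 by rewrite ltr_pM2r.
have s8 : K * l * M2 < q * M2 by rewrite ltr_pM2r.
have := le_trans s4 H2; rewrite mulrDr => s9.
have e2 : K * (M2 * (l / 2)) = K * l * M2 / 2 by ring.
have e3 : q / 2 * M2 = q * M2 / 2 by ring.
rewrite e2 in s9; rewrite e3 in s7.
move: s5 s7 s8 s9; move: (K * (T2 / _)) (68 * _ / _ * M2) (K * l * M2) (q * M2) => p1 p2 p3 p4; lra.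
Qed.

End final.

Theorem proposition4p5 (R : realType) (Omega : set (R * R))
    (hOmega : smooth_bounded_domain Omega)
    (F : R * R -> R * R) (hF : unit_field_potential F)
    (eps0 eps1 : R) (heps0 : 0 < eps0) (heps1 : 0 < eps1)
    (hlow : 0 < Theta0 F - eps1) (hup : Theta0 F - eps1 < 1 - eps0) :
  exists kappa0 C : R, [/\ 0 < kappa0, 0 < C &
    forall (kappa H : R) (psi : R * R -> R[i]) (A : R * R -> R * R),
      0 < kappa -> 0 < H ->
      GL_solution Omega kappa H psi A ->
      ~ eq_ae Omega psi (fun=> 0) ->
      kappa0 < kappa ->
      Theta0 F - eps1 <= kappa / H <= 1 - eps0 ->
      (* psi0 is the continuous representative of psi *)
      forall (psi0 : R * R -> R[i]) (P : R * R),
        continuous_on (closure Omega) psi0 ->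
        eq_ae Omega psi0 psi ->
        closure Omega P ->
        (cabs (psi0 P))%:E = LnormC +oo%E Omega psi ->
        edist P (frontier Omega) <= C / Num.sqrt (kappa * H)].
Proof.
have [oD _ _ bO _] := hOmega.
have [rD rD0 bD] := bounded_cube bO.
have ep1 : eps0 < 1 by rewrite -subr_gt0; exact: lt_trans hup.
pose K := decay_cst Omega rD eps0.
have c0 : 0 <= excess_cst Omega rD by rewrite /excess_cst divr_ge0// mulr_ge0// ?(ltW rD0)// fine_ge0.
have K0 : 0 <= K.
  have p0 := @profile_pos R.
  apply: mulr_ge0; first by apply: divr_ge0 => //; apply: mulr_ge0; exact: ltW.
  by apply: addr_ge0 => //; apply: addr_ge0; [exact: ler0n|apply: divr_ge0; [exact: ler0n|exact: ltW]].
pose x0 : R := flat 0 2^-1.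
have x00 : 0 < x0 by apply: flat_gt0; rewrite invr_gt0.
have x01 : x0 <= 1 by have := flat_le 0 (2^-1 : R); rewrite fact0.
(* With r^2 = x0 / (1792 h), [point_bound] reads q M^2 <= h times the mass at radius r. *)
pose q := x0 ^+ 2 / (1792 * 224).
have q0 : 0 < q by apply: divr_gt0; [exact: exprn_gt0|rewrite -natrM ltr0n].
(* The factor 136 = 2 * 68 makes 2 * 68 K^2 < q C; the added 1 ensures C <= C^2 and r <= l/4. *)
pose C := 1 + 136 * K ^+ 2 / q.
have kq : 0 <= 136 * K ^+ 2 / q.
  by apply: divr_ge0; [apply: mulr_ge0; [exact: ler0n|exact: sqr_ge0]|exact: ltW].
have C1 : 1 <= C by rewrite lerDl.
have C0 : 0 < C by exact: lt_le_trans C1.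
have d0 : 0 < 1 + K / q by rewrite ltr_wpDr// divr_ge0// ltW.
(* As kappa <= sqrt h, the threshold forces l (1 + K / q) < 1, which gives both l <= 1 and K l <
   q. *)
exists (C * (1 + K / q)), C; split => //; first exact: mulr_gt0.
move=> kappa H psi A k0 H0 sol psin0 kk /andP[_ kH] psi0 P cpsi0 psi0E cP PM.
rewrite leNgt; apply/negP => lt.
pose h := kappa * H; have h0 : 0 < h by exact: mulr_gt0.
have kh : kappa ^+ 2 <= (1 - eps0) * h.
  rewrite /h expr2 mulrCA ler_pM2l//; move: kH; rewrite ler_pdivrMr//.
have kh1 : kappa ^+ 2 <= h.
  by apply: (le_trans kh); rewrite ler_piMl ?(ltW h0)// gerBl ltW.
pose l := C / Num.sqrt h.
have sh : 0 < Num.sqrt h by rewrite sqrtr_gt0.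
have l0 : 0 < l by exact: divr_gt0.
have hl : h * l ^+ 2 = C ^+ 2.
  by rewrite /l exprMn exprVn sqr_sqrtr ?(ltW h0)// mulrCA mulfV ?mulr1// gt_eqF.
have ks : kappa <= Num.sqrt h.
  by rewrite -[leLHS]ger0_norm ?(ltW k0)// -sqrtr_sqr ler_wsqrtr.
have ld : l * (1 + K / q) < 1.
  rewrite /l mulrAC ltr_pdivrMr// mul1r; exact: lt_le_trans kk ks.
have l1 : l <= 1.
  by apply: le_trans (ltW ld); rewrite ler_peMr ?(ltW l0)// lerDl divr_ge0// ltW.
have Kl : K * l < q.
  have : l * (K / q) < 1 by apply: le_lt_trans ld; rewrite mulrDr mulr1 lerDr ltW.
  by rewrite mulrA ltr_pdivrMr// mul1r mulrC.
have DP := closure_interior l0 cP lt.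
have dD := disc_sub oD l0 cP lt.
pose M := cabs (psi0 P).
have M0 : 0 <= M by exact: cabs_ge0.
(* The sup norm bounds psi almost everywhere; continuity of [psi0] upgrades this to every point of
   Omega, with M the modulus at P. *)
have wM x : Omega x -> re_part psi0 x ^+ 2 + im_part psi0 x ^+ 2 <= M ^+ 2.
  have ca x' : Omega x' -> {for x', continuous (dens (ext Omega (re_part psi0)) (ext Omega (im_part psi0)))}.
    move=> Dx'; have u := ext_cont oD cpsi0.1 Dx'; have v := ext_cont oD cpsi0.2 Dx'.
    have := @cvgD R _ _ (nbhs x') _ _ _ _ _ (@cvgM R _ (nbhs x') _ _ _ _ _ u u) (@cvgM R _ (nbhs x') _ _ _ _ _ v v).
    by apply.
  have ae : {ae leb2 R, forall x, Omega x -> dens (ext Omega (re_part psi0)) (ext Omega (im_part psi0)) x <= M ^+ 2}.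
    apply: (ae_imp (ae_and psi0E (linf_ae PM))) => y [E1 E2] Dy.
    rewrite /dens !extT// /re_part /im_part -cabs_sq E1//.
    by rewrite ler_pXn2r ?nnegrE//; [exact: E2|exact: cabs_ge0].
  by move=> Dx; have := ae_le_cont oD ca ae Dx; rewrite /dens !extT.
have G := extraction oD bD k0 H0 sol cpsi0 psi0E M0 wM.
have M2 : 0 < M ^+ 2.
  rewrite exprn_gt0// lt_neqAle M0 andbT; apply/eqP => Mz; apply: psin0.
  apply: (ae_imp psi0E) => x E Dx; rewrite -E//.
  have := wM x Dx; rewrite -Mz expr0n /= /re_part /im_part.
  case: (psi0 x) => u v /= uv.
  by have [-> ->] := sq_sum_le0 uv.
have wP : dens (ext Omega (re_part psi0)) (ext Omega (im_part psi0)) P = M ^+ 2.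
  by rewrite /dens !extT// /M cabs_sq.
(* Small enough for [point_bound] since kappa^2 <= h, yet of order 1 / sqrt h, so that the lower
   bound on the mass matches the scale of the decay. *)
pose r := Num.sqrt (x0 / (1792 * h)).
have r20 : 0 < x0 / (1792 * h).
  by apply: divr_gt0; [exact: x00|apply: mulr_gt0; [rewrite ltr0n|exact: h0]].
have r0 : 0 < r by rewrite sqrtr_gt0.
have r2 : r ^+ 2 = x0 / (1792 * h) := sqr_sqrtr (ltW r20).
have hr : h * r ^+ 2 = x0 / 1792.
  by rewrite r2; apply: mul_div_cancel; rewrite gt_eqF.
have half s : 0 < s -> disc P (s / 2) `<=` disc P s.
  by move=> s0 x /(disc_half _ _ s0); rewrite /disc /= => /le_trans; apply; rewrite invf_le1// ler1n.
have l20 : 0 < l / 2 by rewrite divr_gt0.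
have rl : disc P r `<=` disc P (l / 2 / 2).
  have rl2 : r ^+ 2 <= (l / 2 / 2) ^+ 2.
    rewrite -(ler_pM2l h0) hr (_ : h * _ = h * l ^+ 2 / 16); last by field.
    by rewrite hl; apply: small_radius => //; rewrite exprn_ege1.
  move=> x; rewrite /disc /= /rad !ler_pdivrMr ?exprn_gt0 ?divr_gt0// !mul1r => Hx.
  exact: le_trans Hx rl2.
have d2 := subset_trans (half _ l0) dD.
have d4 := subset_trans (half _ l20) d2.
have dr := subset_trans rl d4.
have kr : 1792 * (kappa ^+ 2 * r ^+ 2) <= x0.
  have : kappa ^+ 2 * r ^+ 2 <= h * r ^+ 2 by rewrite ler_wpM2r// sqr_ge0.
  by rewrite hr => le; apply: le_div_mul le; rewrite ltr0n.
have B := point_bound oD bD M0 G DP r0 dr wP kr.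
have S1 := local_decay oD bD rD0 k0 h0 M0 G l0 dD heps0 ep1 kh.
have S2 := local_decay oD bD rD0 k0 h0 M0 G l20 d2 heps0 ep1 kh.
have iT s := mass_integ oD bD M0 G P s.
have mr : mass (ext Omega (re_part psi0)) (ext Omega (im_part psi0)) P r
    <= mass (ext Omega (re_part psi0)) (ext Omega (im_part psi0)) P (l / 2 / 2).
  apply: int_le; [exact: iT|exact: iT|move=> x; rewrite ler_wpM2r ?dens_ge0//].
  have [dx|ndx] := pselect (disc P r x); last by rewrite (indicF ndx) indicE.
  by rewrite (indicT dx) (indicT (rl _ dx)).
have T1 := mass_le l0 (iT l) (dens_le G).
have CK : 2 * (68 * K ^+ 2) < q * C ^+ 2.
  have CC : C <= C ^+ 2 by rewrite expr2 ler_peMl// ltW.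
  apply: (@lt_le_trans _ _ (q * C)); last by rewrite ler_pM2l.
  have -> : q * C = q + 136 * K ^+ 2 by rewrite mulrDr mulr1 mulrC divfK// gt_eqF.
  exact: lt_add136.
exact: (final_algebra q0 K0 h0 M2 l0 l1 hl C0 CK Kl T1 S1 S2 mr hr B (erefl q)).
Qed.
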